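(* Let $s,s_1,s_2\in\mathbb{R}$, $1<p,p_1,p_2<\infty$ and $0<\theta<1$. Put $s_*=(1-\theta)s_1+\theta s_2$ and $\frac1{p_*}=\frac{1-\theta}{p_1}+\frac{\theta}{p_2}$. If there is a constant $C>0$ such that $$\|f\|_{F^{s,1}_{p,1}}\le C\,\|f\|_{F^{s_1,\infty}_{p_1,\infty}}^{1-\theta}\|f\|_{F^{s_2,\infty}_{p_2,\infty}}^{\theta}\quad\text{for all } f\in F^{s_1,\infty}_{p_1,\infty}\cap F^{s_2,\infty}_{p_2,\infty},$$ then one of the following conditions is satisfied: (i) $s_*=s$, $p_*=p$, $s_1\ne s_2$, $p_1\ne p_2$, $s_2-s_1\ne n/p_2-n/p_1$; (ii) $s_*>s$, $p_*=p$, $p_1\ne p_2$; (iii) $s_*-s=n/p_*-n/p>0$, $s_2-s_1\ne n/p_2-n/p_1$; (iv) $s_*-s>n/p_*-n/p>0$.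
   Context: All spaces are on $\mathbb{R}^n$; $\mathscr{S}$ is the Schwartz class and $\mathscr{S}'$ its dual. Lorentz spaces: for $1\le p<\infty$, $1\le q\le\infty$, $L^{p,q}$ is the space of measurable $f$ on $\mathbb{R}^n$ with finite quasi-norm $\|f\|_{L^{p,q}}=\left(p\int_0^\infty[\alpha\mu_f(\alpha)^{1/p}]^q\frac{d\alpha}{\alpha}\right)^{1/q}$ if $q<\infty$, and $\sup_{\alpha>0}\alpha\mu_f(\alpha)^{1/p}$ if $q=\infty$, where $\mu_f(\alpha)=|\{x:|f(x)|>\alpha\}|$. Inhomogeneous Triebel-Lizorkin-Lorentz spaces: fix $\{\psi_j\}_{j\ge0}\subset C_c^\infty(\mathbb{R}^n)$ with $\operatorname{supp}\psi_0\subset\{|\xi|\le2\}$, $\operatorname{supp}\psi_j\subset\{2^{j-1}\le|\xi|\le2^{j+1}\}$ for $j\ge1$, $\sup_{j,\xi}2^{j|\alpha|}|D^\alpha\psi_j(\xi)|<\infty$ for every multi-index $\alpha$, and $\sum_{j\ge0}\psi_j=1$ on $\mathbb{R}^n$. Let $\Delta_j f=(\psi_j\hat f)^\vee$ for $f\in\mathscr{S}'$. Then $F^{s,r}_{p,q}$ is the space of $f\in\mathscr{S}'$ with $$\|f\|_{F^{s,r}_{p,q}}=\Big\|\,\big\|\{2^{js}\Delta_jf\}_{j\ge0}\big\|_{l^r}\Big\|_{L^{p,q}}<\infty .$$ *)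

(* Defs.v *)
From HB Require Import structures.
From mathcomp Require Import all_boot all_order all_algebra.
From mathcomp Require Export complex.
From mathcomp Require Import all_classical all_reals all_analysis.

Set Implicit Arguments.
Unset Strict Implicit.
Unset Printing Implicit Defensive.
Import Order.TTheory GRing.Theory Num.Theory.
Import numFieldNormedType.Exports.
Import Normc.

Local Open Scope classical_set_scope.
Local Open Scope ring_scope.


Section measurable_rV.
Context {R : realType} {n : nat}.

Let coor (i : 'I_n) (x : 'rV[R]_n) : measurableTypeR R := x ord0 i.

Let rV_set0 : g_sigma_preimage coor set0.
Proof. exact: sigma_algebra0. Qed.

Let rV_setC A : g_sigma_preimage coor A -> g_sigma_preimage coor (~` A).
Proof. exact: sigma_algebraC. Qed.

Let rV_bigcup (F : (set 'rV[R]_n)^nat) :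
  (forall i, g_sigma_preimage coor (F i)) ->
  g_sigma_preimage coor (\bigcup_i F i).
Proof. exact: sigma_algebra_bigcup. Qed.

(* The product (equivalently, Borel) sigma-algebra on R^n. *)
HB.instance Definition _ := @isMeasurable.Build default_measure_display
  'rV[R]_n (g_sigma_preimage coor) rV_set0 rV_setC rV_bigcup.

Lemma measurable_coor (i : 'I_n) :
  measurable_fun [set: 'rV[R]_n] (fun x => x ord0 i : measurableTypeR R).
Proof.
move=> _ Y mY; rewrite setTI; apply: sub_sigma_algebra => /=.
rewrite -bigcup_seq/=; exists i => /=; first by rewrite mem_index_enum.
by exists Y => //; rewrite setTI.
Qed.

Lemma measurable_fun_rVP d (T : measurableType d) (f : T -> 'rV[R]_n) :
  (forall i, measurable_fun [set: T] (fun t => f t ord0 i : measurableTypeR R)) ->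
  measurable_fun [set: T] f.
Proof.
move=> mf _ Y mY; rewrite setTI.
suff: g_sigma_preimage coor `<=` [set B | measurable (f @^-1` B)] by apply.
apply: smallest_sub.
  split => /=; first by rewrite preimage_set0.
    by move=> B mB; rewrite setTD preimage_setC; exact: measurableC.
  by move=> F mF; rewrite preimage_bigcup; exact: bigcup_measurable.
rewrite -bigcup_seq/=; apply: bigcup_sub => i _ _ [B mB <-] /=.
by rewrite setTI -comp_preimage -[X in measurable X]setTI; exact: mf.
Qed.

End measurable_rV.

Section cons_measure.
Context {R : realType} {n : nat}.

Definition rV_cons (p : measurableTypeR R * 'rV[R]_n) : 'rV[R]_n.+1 :=
  row_mx p.1%:M p.2 : 'rV[R]_(1 + n).

Lemma measurable_rV_cons : measurable_fun setT rV_cons.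
Proof.
apply: measurable_fun_rVP => i.
case: (splitP (i : 'I_(1 + n))) => j ij.
  rewrite (_ : (fun _ => _) = fst); first exact: measurable_fst.
  apply/funext => p; rewrite /rV_cons mxE.
  case: splitP => k ik; first by rewrite mxE !ord1.
  by have := ltn_ord j; rewrite -ij ik.
rewrite (_ : (fun _ => _) = (fun x : 'rV[R]_n => x ord0 j) \o snd).
  exact: measurableT_comp (measurable_coor j) measurable_snd.
apply/funext => p; rewrite /rV_cons mxE /=.
case: splitP => k ik; first by have := ltn_ord k; rewrite -ik ij.
by congr (p.2 _ _); apply/val_inj/eqP; rewrite -(eqn_add2l 1) -ik ij.
Qed.

Variable m : {sigma_finite_measure set 'rV[R]_n -> \bar R}.

Definition cons_measure : set 'rV[R]_n.+1 -> \bar R :=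
  pushforward (@lebesgue_measure R \x m)%E rV_cons.


Let M : {measure set 'rV[R]_n.+1 -> \bar R} :=
  measure_function_pushforward__canonical__measure_function_Measure
    (@lebesgue_measure R \x m)%E measurable_rV_cons.

HB.instance Definition _ := isMeasure.Build _ _ _ cons_measure
  (measure0 M) (measure_ge0 M) (@measure_semi_sigma_additive _ _ _ M).

Let cons_measure_sigma_finite : sigma_finite setT cons_measure.
Proof.
have /sigma_finiteP[F [TF ndF Fm]] := sigma_finiteT (@lebesgue_measure R).
have /sigma_finiteP[G [TG ndG Gm]] := sigma_finiteT m.
pose h (x : 'rV[R]_(1 + n)) : measurableTypeR R * 'rV[R]_n :=
  (x ord0 ord0, rsubmx x).
have mh : measurable_fun [set: 'rV[R]_n.+1] h.
  apply/measurable_fun_pairP; split => /=; first exact: measurable_coor.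
  apply: measurable_fun_rVP => i /=.
  rewrite (_ : (fun _ => _) = (fun x : 'rV[R]_n.+1 =>
    x ord0 (rshift 1 i : 'I_n.+1))).
    exact: measurable_coor.
  by apply/funext => x; rewrite mxE.
have hK p : h (rV_cons p) = p.
  rewrite /h /rV_cons row_mxKr; case: p => a b /=; congr pair.
  by rewrite -[ord0 in X in _ _ X = _](_ : lshift n ord0 = _ :> 'I_(1 + n))
    ?row_mxEl ?mxE//; exact: val_inj.
exists (fun k => h @^-1` (F k `*` G k)).
  rewrite -preimage_bigcup [X in _ @^-1` X](_ : _ = setT) ?preimage_setT//.
  rewrite -subTset => -[x y] _.
  have [i _ Fix] : (\bigcup_i F i) x by rewrite -TF.
  have [j _ Gjy] : (\bigcup_i G i) y by rewrite -TG.
  exists (maxn i j) => //; split.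
    by move: x Fix; exact/subsetPset/ndF/leq_maxl.
  by move: y Gjy; exact/subsetPset/ndG/leq_maxr.
move=> k; have [mF Foo] := Fm k; have [mG Goo] := Gm k; split.
  by rewrite -[X in measurable X]setTI; apply: mh => //; exact: measurableX.
rewrite /cons_measure /pushforward -comp_preimage.
rewrite (_ : h \o rV_cons = id); last by apply/funext => p /=; rewrite hK.
by rewrite preimage_id product_measure1E// lte_mul_pinfty// ge0_fin_numE.
Qed.

HB.instance Definition _ := Measure_isSigmaFinite.Build _ _ _ cons_measure
  cons_measure_sigma_finite.

End cons_measure.

(* Lebesgue measure on R^n, as the n-fold product of the one on R. *)
Fixpoint lebesgue_rV (R : realType) (n : nat) :
    {sigma_finite_measure set 'rV[R]_n -> \bar R} :=
  if n is n'.+1 return {sigma_finite_measure set 'rV[R]_n -> \bar R}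
  then cons_measure (lebesgue_rV R n') else \d_(0 : 'rV[R]_0).

Arguments lebesgue_rV {R n}.

Section calculus.
Context {R : realType} {n : nat}.
Implicit Types (f : 'rV[R]_n -> R) (g h : 'rV[R]_n -> R[i]).

(* The norm `|x| of the library on 'rV[R]_n is the sup norm. *)
Definition euclid (x : 'rV[R]_n) : R := Num.sqrt (\sum_i x ord0 i ^+ 2).

Definition dotp (x y : 'rV[R]_n) : R := \sum_i x ord0 i * y ord0 i.

Definition partial (i : 'I_n) f : 'rV[R]_n -> R :=
  fun x => 'D_(delta_mx ord0 i) f x.

(* All iterated partial derivatives, in any order, exist and are continuous. *)
Definition smooth f : Prop := forall l : seq 'I_n,
  continuous (foldr partial f l) /\
  forall i x, derivable (foldr partial f l) x (delta_mx ord0 i).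

Definition multiindex := {ffun 'I_n -> nat}.

Definition msize (a : multiindex) : nat := (\sum_i a i)%N.

Definition mpow (x : 'rV[R]_n) (a : multiindex) : R :=
  \prod_i x ord0 i ^+ a i.

Definition mderive (a : multiindex) f : 'rV[R]_n -> R :=
  foldr (fun i => iter (a i) (partial i)) f (enum 'I_n).

(* Complex-valued functions are differentiated, integrated, and tested for
   continuity through their real and imaginary parts. *)
Definition ccontinuous g : Prop :=
  continuous (fun x => complex.Re (g x)) /\
  continuous (fun x => complex.Im (g x)).

Definition csmooth g : Prop :=
  smooth (fun x => complex.Re (g x)) /\ smooth (fun x => complex.Im (g x)).

Definition cmderive (a : multiindex) g : 'rV[R]_n -> R[i] := fun x =>
  Complex (mderive a (fun y => complex.Re (g y)) x)
          (mderive a (fun y => complex.Im (g y)) x).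

Definition cintegrable g : Prop :=
  lebesgue_rV.-integrable setT (fun x => (complex.Re (g x))%:E) /\
  lebesgue_rV.-integrable setT (fun x => (complex.Im (g x))%:E).

Definition cintegral g : R[i] :=
  Complex (\int[lebesgue_rV]_x complex.Re (g x))
          (\int[lebesgue_rV]_x complex.Im (g x)).

Definition csupp g : set 'rV[R]_n := closure [set x | g x != 0].

Definition Ccinfty g : Prop := csmooth g /\ compact (csupp g).

Definition schwartz g : Prop := csmooth g /\
  forall a b : multiindex, exists M : R, forall x,
    normc ((mpow x a)%:C%C * cmderive b g x) <= M.

(* exp(2 pi i t) *)
Definition cis2pi (t : R) : R[i] :=
  Complex (cos (2 * pi * t)) (sin (2 * pi * t)).

Definition fourier g : 'rV[R]_n -> R[i] :=
  fun xi => cintegral (fun x => g x * cis2pi (- dotp x xi)).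

Definition inv_fourier g : 'rV[R]_n -> R[i] :=
  fun x => cintegral (fun xi => g xi * cis2pi (dotp x xi)).

End calculus.
Arguments multiindex : clear implicits.

Section tempered_distributions.
Context {R : realType} {n : nat}.
Implicit Types (phi g : 'rV[R]_n -> R[i]).

(* A tempered distribution is given by a total function on 'rV[R]_n -> R[i]
   of which only the values at Schwartz functions are ever used. *)
Definition functional := ('rV[R]_n -> R[i]) -> R[i].
Implicit Types u : functional.

(* Linearity on the Schwartz class, and continuity for the topology defined by
   the seminorms sup_x |x^a D^b phi(x)|. *)
Definition tempered u : Prop :=
  (forall (c : R[i]) phi1 phi2, schwartz phi1 -> schwartz phi2 ->
     u (fun x => c * phi1 x + phi2 x) = c * u phi1 + u phi2) /\
  (forall phi0 (e : R), schwartz phi0 -> 0 < e ->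
     exists (N : nat) (d : R), 0 < d /\
       forall phi, schwartz phi ->
         (forall a b : multiindex n, (msize a <= N)%N -> (msize b <= N)%N ->
            forall x, normc ((mpow x a)%:C%C *
              cmderive b (fun y => phi y - phi0 y) x) <= d) ->
         normc (u phi - u phi0) <= e).

Definition dfourier u : functional := fun phi => u (fourier phi).

Definition dinv_fourier u : functional := fun phi => u (inv_fourier phi).

Definition dmul g u : functional := fun phi => u (fun x => g x * phi x).

Definition represents g u : Prop := forall phi, schwartz phi ->
  cintegrable (fun x => g x * phi x) /\
  u phi = cintegral (fun x => g x * phi x).

(* The distribution (psi_j u^)^v has compactly supported Fourier transform, so
   it is a (unique) continuous function; LPblock is that function. *)
Definition LPblock (psi : nat -> 'rV[R]_n -> R[i]) (j : nat) u :
    'rV[R]_n -> R[i] :=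
  xget (fun=> 0) [set g | ccontinuous g /\
    represents g (dinv_fourier (dmul (psi j) (dfourier u)))].

Definition LP_partition (psi : nat -> 'rV[R]_n -> R[i]) : Prop :=
  [/\ forall j, Ccinfty (psi j),
      csupp (psi 0%N) `<=` [set xi | euclid xi <= 2],
      forall j, (0 < j)%N -> csupp (psi j) `<=`
        [set xi | 2 ^+ j.-1 <= euclid xi <= 2 ^+ j.+1],
      forall a : multiindex n, exists M : R, forall j xi,
        2 ^+ (j * msize a) * normc (cmderive a (psi j) xi) <= M &
      forall xi,
        series (fun j => complex.Re (psi j xi)) @ \oo --> (1 : R) /\
        series (fun j => complex.Im (psi j xi)) @ \oo --> (0 : R)].

End tempered_distributions.
Arguments functional : clear implicits.

Section function_space_norms.
Context {R : realType} {n : nat}.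
Local Open Scope ereal_scope.

Definition distribution_fun (f : 'rV[R]_n -> \bar R) (a : R) : \bar R :=
  lebesgue_rV [set x | a%:E < `|f x|].

Definition lorentz_norm (p : R) (q : \bar R) (f : 'rV[R]_n -> \bar R) :
    \bar R :=
  match q with
  | q'%:E => (p%:E * \int[lebesgue_measure]_(a in `]0%R, +oo[)
      ((a%:E * distribution_fun f a `^ p^-1) `^ q' * (a^-1)%:E)) `^ q'^-1
  | +oo => ereal_sup [set a%:E * distribution_fun f a `^ p^-1 |
      a in `]0%R, +oo[%classic]
  | -oo => 0
  end.

Definition TLL_norm (psi : nat -> 'rV[R]_n -> R[i]) (s : R) (r : \bar R)
    (p : R) (q : \bar R) (u : functional R n) : \bar R :=
  lorentz_norm p q (fun x =>
    Lnorm counting r (fun j : nat =>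
      (2 `^ (j%:R * s) * normc (LPblock psi j u x))%:E)).

Definition TLL_space (psi : nat -> 'rV[R]_n -> R[i]) (s : R) (r : \bar R)
    (p : R) (q : \bar R) : set (functional R n) :=
  [set u | tempered u /\ TLL_norm psi s r p q u < +oo].

End function_space_norms.

(* Main.v *)
Require Import Defs.
From HB Require Import structures.
From mathcomp Require Import all_boot all_order all_algebra complex.
From mathcomp Require Import all_classical all_reals all_analysis.
From mathcomp Require Import measurable_realfun.
From mathcomp Require Import ring lra zify.
Set Implicit Arguments.
Unset Strict Implicit.
Unset Printing Implicit Defensive.
Import Order.TTheory GRing.Theory Num.Theory.
Import numFieldNormedType.Exports.
Import Normc.
Local Open Scope classical_set_scope.
Local Open Scope ring_scope.

(** The inequality is tested on superpositions of wave packets,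

      f = sum_(i < N) b_i lam_i^(-3n) packet (lam_i) (eta_i),

    whose i-th term has height comparable to b_i, is concentrated on
    |x| <= 1 / lam_i, and has its frequencies in a box of radius 3 lam_i about
    eta_i. Two geometries suffice. Either eta_i sits in the middle of a dyadic
    shell 2^j_i < |xi| < 2^(j_i + 1) of its own (shell_separated): then exactly
    the blocks j_i and j_i + 1 see the i-th packet and they add up to it, so the
    l^oo norm over the blocks is governed by the largest term and the l^1 norm
    by the sum (high_upper, high_lower, high_lacunary). Or all eta_i vanish and
    the lam_i are small: then block 0 carries all of f (low_upper, low_lacunary).

    The weak Lorentz norms on the right are bounded by exhibiting a majorant
    B |x|^(-n/p) of every weighted block, whose level sets lie in boxes. The
    L^(p,1) norm on the left is bounded below by bands of heights: if f exceeds
    A_i on a box of radius r_i and the A_i grow at least geometrically, the sum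
    of the r_i^(n/p) A_i counts (lorentz_strong_ge), so N packets of equal size
    in weak L^p have an L^(p,1) norm of order at least N.

    Comparing the two sides gives the five necessary conditions from which the
    theorem follows by elementary case analysis. Let p', s' be the interpolated
    exponents.
    - One packet at frequency 0 with lam -> 0: n/p <= n/p' (low_scaling).
    - One packet with lam proportional to 2^j, j -> oo: s - n/p <= s' - n/p'
      (high_scaling).
    - If p1 = p2 = p, a lacunary sum of low-frequency packets with
      b_i = lam_i^(n/p) keeps the right side bounded while the left side grows
      like N (low_critical).
    - If s1 = s2 = s, N packets of fixed bandwidth in N shells, with
      b_i = 2^(-j_i s), do the same, now through the l^1 sum (high_stacked).
    - If s_k - n/p_k = s - n/p for k = 1, 2, packets with lam_i proportional to
      2^j_i and b_i = 2^(-j_i (s - n/p)) do the same (high_critical).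

    To compute blocks without an inversion theorem, a packet is a Fejer kernel
    times the inverse Fourier transform of a bump; its Fourier transform is then
    a convolution by Fubini's theorem (fourier_packet). For an integrable f with
    known transform, the multiplication formula used twice identifies the k-th
    block with an inverse Fourier integral (LPblock_distr). Such integrals decay
    like (lam |x|)^(-n) because their amplitude has n differences bounded at
    scale lam (block_decay), and are bounded below near the origin because the
    amplitude is nonnegative (packet_lower). *)

(** * Measurable sets, boxes and translations in R^n *)

Lemma le_of_eq d (T : porderType d) (x y : T) : x = y -> (x <= y)%O.
Proof. by move=> ->. Qed.

Section measurability.
Context {R : realType} {n : nat}.
Implicit Types x y : 'rV[R]_n.

Definition rat_box (q : {ffun 'I_n -> rat * rat}) : set 'rV[R]_n :=
  \bigcap_(i in [set: 'I_n]) [set x | ratr (q i).1 < x ord0 i < ratr (q i).2].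

Lemma measurable_rat_box q : measurable (rat_box q).
Proof.
apply: fin_bigcap_measurable; first exact: finite_finset.
move=> i _.
rewrite (_ : (fun _ => _) = (fun x : 'rV[R]_n => x ord0 i) @^-1`
  `]ratr (q i).1, ratr (q i).2[%classic); last first.
  by apply/seteqP; split=> x /=; rewrite in_itv.
rewrite -[X in measurable X]setTI.
exact: (measurable_coor (R := R) (n := n) i).
Qed.

(** The rational boxes form a countable base of the topology. *)
Lemma measurable_open_rV (U : set 'rV[R]_n) : open U -> measurable U.
Proof.
move=> oU.
have -> : U = \bigcup_(q in [set q | rat_box q `<=` U]) rat_box q.
  apply/seteqP; split=> [x Ux|x [q /= qU]]; last exact: qU.
  have /nbhs_ballP[e/= e0 xeU] : nbhs x U by exact: open_nbhs_nbhs.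
  have P i : exists q : rat * rat, x ord0 i - e < ratr q.1 < x ord0 i /\
      x ord0 i < ratr q.2 < x ord0 i + e.
    have xe1 : x ord0 i - e < x ord0 i by lra.
    have xe2 : x ord0 i < x ord0 i + e by lra.
    have [q1 h1] := rat_in_itvoo xe1; have [q2 h2] := rat_in_itvoo xe2.
    by exists (q1, q2); move: h1 h2; rewrite !in_itv.
  have [q qP] := choice P.
  exists [ffun i => q i] => /=.
    move=> y qy; apply: xeU; split=> // i j; rewrite ord1.
    have := qy j I; rewrite /= ffunE => /andP[a b].
    have [/andP[c1 c2] /andP[d1 d2]] := qP j.
    by rewrite /ball/= ltr_distl; lra.
  move=> i _ /=; rewrite ffunE.
  have [/andP[c1 c2] /andP[d1 d2]] := qP i; lra.
rewrite bigcup_mkcond; apply: countable_bigcupT_measurable => // q.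
by case: ifPn => // _; exact: measurable_rat_box.
Qed.

Lemma continuous_measurable_rV (f : 'rV[R]_n -> R) :
  continuous f -> measurable_fun [set: 'rV[R]_n] (f : _ -> measurableTypeR R).
Proof.
move=> /continuousP cf.
apply: (measurability _ (RGenOpens.measurableE R)) => _ [_ [a [b ->] <-]].
rewrite setTI; apply: measurable_open_rV; apply: cf; exact: interval_open.
Qed.

End measurability.

Section tonelli.
Context {R : realType} {n : nat}.
Local Open Scope ereal_scope.

Lemma measurable_comp_rV_cons d (T : measurableType d) (f : 'rV[R]_n.+1 -> T) :
  measurable_fun setT f ->
  measurable_fun setT (fun z : measurableTypeR R * 'rV[R]_n => f (rV_cons z)).
Proof.
by move=> mf; exact: (measurableT_comp mf (@measurable_rV_cons R n)).
Qed.

Lemma ge0_integral_rV_cons (f : 'rV[R]_n.+1 -> \bar R) :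
  measurable_fun setT f -> (forall x, 0 <= f x) ->
  \int[lebesgue_rV]_x f x =
  \int[lebesgue_measure]_t \int[lebesgue_rV]_y f (rV_cons (t, y)).
Proof.
move=> mf f0.
have -> : \int[lebesgue_rV]_x f x =
   \int[pushforward (@lebesgue_measure R \x lebesgue_rV)%E (@rV_cons R n)]_x f x.
  by [].
rewrite ge0_integral_pushforward//; last exact: measurable_rV_cons.
rewrite preimage_setT fubini_tonelli1//; last by move=> z; exact: f0.
exact: measurable_comp_rV_cons.
Qed.

Lemma rV_cons0 (t : R) (y : 'rV[R]_n) : (rV_cons (t, y)) ord0 ord0 = t.
Proof.
rewrite /rV_cons mxE; case: splitP => j /= ij; last by case: j ij.
by rewrite mxE !ord1.
Qed.

Lemma rV_consS (t : R) (y : 'rV[R]_n) i :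
  (rV_cons (t, y)) ord0 (lift ord0 i) = y ord0 i.
Proof.
rewrite /rV_cons mxE; case: splitP => j /= ij; first by case: j ij => -[].
by congr (y _ _); apply/val_inj; move: ij => /= [].
Qed.

Lemma measurable_rV_cons_l (t : R) :
  measurable_fun [set: 'rV[R]_n] (fun y => rV_cons (t, y)).
Proof. by apply: measurableT_comp (measurable_rV_cons) _. Qed.

End tonelli.

Section box_measure.
Context {R : realType}.
Local Open Scope ereal_scope.

Definition box n (x : 'rV[R]_n) (r : R) : set 'rV[R]_n :=
  [set y | forall i, `|y ord0 i - x ord0 i|%R <= r]%R.

Lemma measurable_box n (x : 'rV[R]_n) r : measurable (box x r).
Proof.
rewrite (_ : box x r = \bigcap_(i in [set: 'I_n]) [set y | `|y ord0 i - x ord0 i| <= r]%R).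
  apply: fin_bigcap_measurable; first exact: finite_finset.
  move=> i _.
  rewrite (_ : (fun _ => _) = (fun y : 'rV[R]_n => y ord0 i) @^-1`
    `[(x ord0 i - r)%R, (x ord0 i + r)%R]%classic); last first.
    by apply/seteqP; split=> y /=; rewrite in_itv/= ler_distl.
  rewrite -[X in measurable X]setTI.
  exact: (measurable_coor (R := R) (n := n) i).
by apply/seteqP; split=> y /= h i; move: (h i) => // /(_ I).
Qed.

Lemma lebesgue_rV_box n (x : 'rV[R]_n) r : (0 <= r)%R ->
  lebesgue_rV (box x r) = ((2 * r) ^+ n)%:E.
Proof.
move=> r0; elim: n x => [|n IH] x.
  by rewrite /= diracE mem_set// => i; case: i.
rewrite -[LHS]mul1e -integral_cst; last exact: measurable_box.
rewrite integral_mkcond ge0_integral_rV_cons; last 2 first.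
- apply/(measurable_restrictT _ _).1 => //; first exact: measurable_box.
- by move=> y; apply: erestrict_ge0.
pose x' : 'rV[R]_n := \row_i x ord0 (lift ord0 i).
rewrite (eq_integral (fun t : measurableTypeR R => ((2 * r) ^+ n)%:E * (\1_(`[(x ord0 ord0 - r)%R, (x ord0 ord0 + r)%R]%classic) t)%:E)).
  rewrite integralZl//; last exact: integrable_indic_itv.
  have E : lebesgue_measure `[(x ord0 ord0 - r)%R, (x ord0 ord0 + r)%R]%classic =
      (2 * r)%:E :> \bar R.
    rewrite lebesgue_measure_itv/= lte_fin.
    case: ifPn => [_|]; first by rewrite -EFinB; congr EFin; lra.
    by rewrite -leNgt => h; congr EFin; lra.
  by rewrite integral_indic// setIT [X in _ * X]E -EFinM exprSr.
move=> t _; rewrite indicE.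
case: (boolP (t \in _)) => ht /=.
  rewrite mule1 -(IH x') -[RHS]mul1e -integral_cst; last exact: measurable_box.
  rewrite [RHS]integral_mkcond; apply: eq_integral => y _.
  rewrite !patchE; congr (if _ then _ else _).
  apply/idP/idP; rewrite !inE /= => h i.
    by have := h (lift ord0 i); rewrite rV_consS mxE.
  case: (unliftP ord0 i) => [j|] ->; first by rewrite rV_consS; have := h j; rewrite mxE.
  by rewrite rV_cons0; move: ht; rewrite inE/= in_itv/= ler_distl.
rewrite mule0; apply: integral0_eq => y _.
rewrite patchE memNset// => h; move: ht; rewrite notin_setE/= in_itv/=.
by have := h ord0; rewrite rV_cons0 ler_distl => ->.
Qed.

End box_measure.

Section translation.
Context {R : realType}.
Local Open Scope ereal_scope.

Definition shift_coord n (i : 'I_n) (h : R) (x : 'rV[R]_n) : 'rV[R]_n :=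
  (x + h *: delta_mx ord0 i)%R.

Lemma shift_coordE n (i : 'I_n) h x j :
  shift_coord i h x ord0 j = (x ord0 j + h * (j == i)%:R)%R.
Proof. by rewrite !mxE eqxx. Qed.

Lemma measurable_shift_coord n (i : 'I_n) h :
  measurable_fun setT (@shift_coord n i h).
Proof.
apply: measurable_fun_rVP => j.
rewrite (_ : (fun _ => _) = (fun x : 'rV[R]_n => x ord0 j + h * (j == i)%:R)%R).
  by apply: measurable_funD => //; exact: measurable_coor.
by apply/funext => x; rewrite shift_coordE.
Qed.

Lemma ge0_integral_shift1 (f : R -> \bar R) (h : R) :
  measurable_fun setT f -> (forall x, 0 <= f x) ->
  \int[lebesgue_measure]_t f (t + h)%R = \int[lebesgue_measure]_t f t.
Proof.
move=> mf f0.
have mh : measurable_fun setT (fun t : measurableTypeR R => (t + h)%R : measurableTypeR R).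
  by apply: measurable_funD.
transitivity (\int[pushforward (@lebesgue_measure R) (fun t : measurableTypeR R => (t + h)%R : measurableTypeR R)]_t f t).
  by rewrite ge0_integral_pushforward.
apply: eq_measure_integral => A mA _.
apply/esym/lebesgue_measure_unique => //= _ [[a b]] _ <-.
rewrite /pushforward (_ : _ @^-1` _ = `](a - h)%R, (b - h)%R]%classic); last first.
  by apply/seteqP; split=> t /=; rewrite !in_itv/=; lra.
rewrite /= !lebesgue_measure_itv/= !lte_fin ltrD2r.
by case: ifPn => // _; rewrite -!EFinB; congr EFin; ring.
Qed.

Lemma ge0_integral_shift n (i : 'I_n) (h : R) (f : 'rV[R]_n -> \bar R) :
  measurable_fun setT f -> (forall x, 0 <= f x) ->
  \int[lebesgue_rV]_x f (shift_coord i h x) = \int[lebesgue_rV]_x f x.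
Proof.
elim: n i f => [[]//|n IH] i f mf f0.
have ms := measurable_shift_coord i h.
rewrite [LHS](ge0_integral_rV_cons (measurableT_comp mf ms) (fun x => f0 _)).
rewrite [RHS](ge0_integral_rV_cons mf f0).
have mfc : measurable_fun setT (fun z : measurableTypeR R * 'rV[R]_n => f (rV_cons z)).
  exact: measurable_comp_rV_cons.
case: (unliftP ord0 i) => [j|] ->; last first.
  rewrite -[RHS](@ge0_integral_shift1 _ h); last 2 first.
  - exact: (measurable_fun_fubini_tonelli_F (fun z => f (rV_cons z))).
  - by move=> t; exact: integral_ge0.
  apply: eq_integral => t _; apply: eq_integral => y _; congr f.
  apply/rowP => k; rewrite shift_coordE.
  case: (unliftP ord0 k) => [l|] ->; last by rewrite !rV_cons0 eqxx mulr1.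
  by rewrite !rV_consS -(inj_eq val_inj)/= mulr0 addr0.
apply: eq_integral => t _; rewrite -[RHS](IH j)//; last first.
  by apply: measurableT_comp => //; exact: measurable_rV_cons_l.
apply: eq_integral => y _; congr f.
apply/rowP => k; rewrite shift_coordE.
case: (unliftP ord0 k) => [l|] ->.
  by rewrite !rV_consS shift_coordE (inj_eq lift_inj).
by rewrite !rV_cons0 -(inj_eq val_inj)/= mulr0 addr0.
Qed.

End translation.

(** * Integrals of complex functions *)

Section norm1.
Context {R : realType}.
Implicit Types z w : R[i].

(** The l^1 norm of the pair (Re z, Im z): equivalent to the modulus, and its
    integrability is that of both parts. *)
Definition norm1 z : R := `|complex.Re z| + `|complex.Im z|.

Lemma cReM z w : complex.Re (z * w) =
  complex.Re z * complex.Re w - complex.Im z * complex.Im w.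
Proof. by case: z; case: w. Qed.

Lemma cImM z w : complex.Im (z * w) =
  complex.Re z * complex.Im w + complex.Im z * complex.Re w.
Proof. by case: z; case: w. Qed.

Lemma cReD z w : complex.Re (z + w) = complex.Re z + complex.Re w.
Proof. by case: z; case: w. Qed.

Lemma cImD z w : complex.Im (z + w) = complex.Im z + complex.Im w.
Proof. by case: z; case: w. Qed.

Lemma cReB z w : complex.Re (z - w) = complex.Re z - complex.Re w.
Proof. by case: z; case: w. Qed.

Lemma cImB z w : complex.Im (z - w) = complex.Im z - complex.Im w.
Proof. by case: z; case: w. Qed.

Lemma complexP z w : complex.Re z = complex.Re w -> complex.Im z = complex.Im w ->
  z = w.
Proof. by case: z; case: w => a b c d /= -> ->. Qed.

Lemma norm1_ge0 z : 0 <= norm1 z.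
Proof. by rewrite addr_ge0. Qed.

Lemma norm1M z w : norm1 (z * w) <= norm1 z * norm1 w.
Proof.
rewrite /norm1 cReM cImM; case: z w => [a b] [c d] /=.
have h1 : `|a * c - b * d| <= `|a| * `|c| + `|b| * `|d|.
  by rewrite -!normrM; exact: ler_normB.
have h2 : `|a * d + b * c| <= `|a| * `|d| + `|b| * `|c|.
  by rewrite -!normrM; exact: ler_normD.
lra.
Qed.

Lemma norm1D z w : norm1 (z + w) <= norm1 z + norm1 w.
Proof.
rewrite /norm1 cReD cImD; case: z w => [a b] [c d] /=.
have h1 := ler_normD a c; have h2 := ler_normD b d; lra.
Qed.

Lemma norm1_0 : norm1 0 = 0.
Proof. by rewrite /norm1 /= normr0 addr0. Qed.

Lemma norm1_Re z : `|complex.Re z| <= norm1 z.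
Proof. by rewrite lerDl. Qed.

Lemma norm1_Im z : `|complex.Im z| <= norm1 z.
Proof. by rewrite lerDr. Qed.

Lemma normc_sqrtE z : normc z = Num.sqrt (complex.Re z ^+ 2 + complex.Im z ^+ 2).
Proof. by case: z. Qed.

Lemma normc_le_norm1 z : normc z <= norm1 z.
Proof.
rewrite normc_sqrtE -(ger0_norm (norm1_ge0 z)) -sqrtr_sqr ler_wsqrtr// /norm1.
rewrite sqrrD !real_normK ?num_real//.
by have := mulr_ge0 (normr_ge0 (complex.Re z)) (normr_ge0 (complex.Im z)); lra.
Qed.

Lemma Re_le_normc z : `|complex.Re z| <= normc z.
Proof. by rewrite normc_sqrtE -sqrtr_sqr ler_wsqrtr// lerDl sqr_ge0. Qed.

Lemma Im_le_normc z : `|complex.Im z| <= normc z.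
Proof. by rewrite normc_sqrtE -sqrtr_sqr ler_wsqrtr// lerDr sqr_ge0. Qed.

Lemma norm1_le_normc z : norm1 z <= 2 * normc z.
Proof.
by have := Re_le_normc z; have := Im_le_normc z; rewrite /norm1; lra.
Qed.

Lemma normc_nneg z : 0 <= normc z.
Proof. by rewrite normc_sqrtE sqrtr_ge0. Qed.

Lemma cis2piD (s t : R) : cis2pi (s + t) = cis2pi s * cis2pi t.
Proof.
apply: complexP; rewrite ?cReM ?cImM /=.
  by rewrite mulrDr cosD.
by rewrite mulrDr sinD addrC mulrC [X in _ = X + _]mulrC addrC mulrC; ring.
Qed.

Lemma norm1_cis2pi (t : R) : norm1 (cis2pi t) <= 2.
Proof.
rewrite /norm1 /=.
have := cos_geN1 (2 * pi * t); have := cos_le1 (2 * pi * t).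
have := sin_geN1 (2 * pi * t); have := sin_le1 (2 * pi * t).
move=> a b c d; apply: (@le_trans _ _ (1 + 1)); last lra.
by apply: lerD; rewrite ler_norml; apply/andP; split.
Qed.

Lemma normc_cis2pi (t : R) : normc (cis2pi t) = 1.
Proof. by rewrite normc_sqrtE /= cos2Dsin2 sqrtr1. Qed.

End norm1.

Section complex_integral.
Context d (T : measurableType d) {R : realType}.
Variable mu : {measure set T -> \bar R}.
Implicit Types f g : T -> R[i].

Definition cmeasurable f : Prop :=
  measurable_fun [set: T] (fun x => complex.Re (f x)) /\
  measurable_fun [set: T] (fun x => complex.Im (f x)).

Definition integrableC f : Prop :=
  mu.-integrable setT (fun x => (complex.Re (f x))%:E) /\
  mu.-integrable setT (fun x => (complex.Im (f x))%:E).

Definition integralC f : R[i] :=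
  Complex (\int[mu]_x complex.Re (f x)) (\int[mu]_x complex.Im (f x)).

Lemma cmeasurableM f g : cmeasurable f -> cmeasurable g ->
  cmeasurable (fun x => f x * g x).
Proof.
move=> [a b] [c e]; split.
  under eq_fun do rewrite cReM.
  by apply: measurable_funB; apply: measurable_funM.
under eq_fun do rewrite cImM.
by apply: measurable_funD; apply: measurable_funM.
Qed.

Lemma cmeasurable_cst z : cmeasurable (fun=> z).
Proof. by split; exact: measurable_cst. Qed.

Lemma integrableC_measurable f : integrableC f -> cmeasurable f.
Proof.
by move=> [/measurable_int/measurable_EFinP ? /measurable_int/measurable_EFinP].
Qed.

Lemma integrableC_norm1 f : integrableC f ->
  mu.-integrable setT (fun x => (norm1 (f x))%:E).
Proof.
move=> [a b]; under eq_fun do rewrite EFinD.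
by apply: integrableD => //; exact: integrable_norm.
Qed.

Lemma le_integrableC f (B : T -> R) : cmeasurable f ->
  mu.-integrable setT (EFin \o B) -> (forall x, norm1 (f x) <= B x) ->
  integrableC f.
Proof.
move=> [mr mi] iB fB; split.
  apply: le_integrable iB => //; first exact/measurable_EFinP.
  move=> x _ /=; rewrite lee_fin.
  by rewrite (le_trans (norm1_Re _))// (le_trans (fB x))// ler_norm.
apply: le_integrable iB => //; first exact/measurable_EFinP.
move=> x _ /=; rewrite lee_fin.
by rewrite (le_trans (norm1_Im _))// (le_trans (fB x))// ler_norm.
Qed.

Lemma integrableC_bounded f g (M : R) : integrableC f -> cmeasurable g ->
  (forall x, norm1 (g x) <= M) -> integrableC (fun x => f x * g x).
Proof.
move=> fi mg gM; apply: (@le_integrableC _ (fun x => M * norm1 (f x))).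
- by apply: cmeasurableM => //; exact: integrableC_measurable.
- apply: (@integrableZl _ _ _ mu _ _ M (fun x => (norm1 (f x))%:E)) => //.
  exact: integrableC_norm1.
- move=> x; rewrite (le_trans (norm1M _ _))// mulrC.
  by rewrite ler_wpM2r// norm1_ge0.
Qed.

Lemma integrableCZ c f : integrableC f -> integrableC (fun x => c * f x).
Proof.
move=> fi; under eq_fun do rewrite mulrC.
exact: (integrableC_bounded fi (cmeasurable_cst c) (fun=> lexx _)).
Qed.

Lemma integrableCD f g : integrableC f -> integrableC g ->
  integrableC (fun x => f x + g x).
Proof.
move=> [a b] [c e]; split.
  by under eq_fun do rewrite cReD EFinD; exact: integrableD.
by under eq_fun do rewrite cImD EFinD; exact: integrableD.
Qed.

Lemma integralCD f g : integrableC f -> integrableC g ->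
  integralC (fun x => f x + g x) = integralC f + integralC g.
Proof.
move=> [a b] [c e]; apply: complexP; rewrite ?cReD ?cImD /=.
  by under eq_Rintegral do rewrite cReD; rewrite RintegralD.
by under eq_Rintegral do rewrite cImD; rewrite RintegralD.
Qed.

Lemma integralCZ c f : integrableC f ->
  integralC (fun x => c * f x) = c * integralC f.
Proof.
move=> [a b]; apply: complexP; rewrite ?cReM ?cImM /=.
  under eq_Rintegral do rewrite cReM.
  rewrite RintegralB//; try exact: (@integrableZl _ _ _ mu _ _ _ (fun x => (_ (f x))%:E)).
  by rewrite !RintegralZl.
under eq_Rintegral do rewrite cImM.
rewrite RintegralD//; try exact: (@integrableZl _ _ _ mu _ _ _ (fun x => (_ (f x))%:E)).
by rewrite !RintegralZl.
Qed.

Lemma integralCZr c f : integrableC f ->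
  integralC (fun x => f x * c) = integralC f * c.
Proof.
by move=> fi; under [in LHS]eq_fun do rewrite mulrC; rewrite integralCZ// mulrC.
Qed.

Lemma integrableC0 : integrableC (fun=> 0).
Proof. by split; exact: integrable0. Qed.

Lemma integralC0 : integralC (fun=> 0) = 0.
Proof. by apply: complexP => /=; rewrite Rintegral_cst// mul0r. Qed.

Lemma integrableC_sum (I : Type) (r : seq I) (F : I -> T -> R[i]) :
  (forall i, integrableC (F i)) -> integrableC (fun x => \sum_(i <- r) F i x).
Proof.
move=> Fi; elim: r => [|i r IH].
  by under eq_fun do rewrite big_nil; exact: integrableC0.
by under eq_fun do rewrite big_cons; exact: integrableCD.
Qed.

Lemma integralC_sum (I : Type) (r : seq I) (F : I -> T -> R[i]) :
  (forall i, integrableC (F i)) ->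
  integralC (fun x => \sum_(i <- r) F i x) = \sum_(i <- r) integralC (F i).
Proof.
move=> Fi; elim: r => [|i r IH].
  by under eq_fun do rewrite big_nil; rewrite big_nil integralC0.
under [in LHS]eq_fun do rewrite big_cons.
by rewrite big_cons integralCD ?IH//; exact: integrableC_sum.
Qed.

Lemma norm1_integralC f : integrableC f ->
  norm1 (integralC f) <= \int[mu]_x norm1 (f x).
Proof.
move=> [a b]; rewrite /norm1 RintegralD//; try exact: integrable_norm.
by apply: lerD; exact: le_normr_Rintegral.
Qed.

End complex_integral.

Section complex_fubini.
Context d1 d2 (T1 : measurableType d1) (T2 : measurableType d2) {R : realType}.
Variables (m1 : {sigma_finite_measure set T1 -> \bar R}).
Variables (m2 : {sigma_finite_measure set T2 -> \bar R}).

Section real.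
Variables (k : T1 * T2 -> R) (A : T1 -> R) (B : T2 -> R).
Hypothesis mk : measurable_fun setT k.
Hypothesis iA : m1.-integrable setT (EFin \o A).
Hypothesis iB : m2.-integrable setT (EFin \o B).
Hypothesis kAB : forall x y, `|k (x, y)| <= A x * B y.

Lemma integrable_prod_dominated :
  (m1 \x m2)%E.-integrable setT (EFin \o k).
Proof.
apply/integrable12ltyP; first exact/measurable_EFinP.
have mA : measurable_fun setT A by exact/measurable_EFinP/(measurable_int _ iA).
have mB : measurable_fun setT B by exact/measurable_EFinP/(measurable_int _ iB).
have [_ ioA] := integrableP _ _ _ iA; have [_ ioB] := integrableP _ _ _ iB.
apply: (@le_lt_trans _ _ (\int[m1]_x (`|A x|%:E * \int[m2]_y `|(B y)%:E|))%E).
  apply: ge0_le_integral => //=.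
  - by move=> x _; exact: integral_ge0.
  - apply: (measurable_fun_fubini_tonelli_F (fun z => `|(k z)%:E|%E)) => //.
    by apply: measurableT_comp => //; exact/measurable_EFinP.
  - apply: emeasurable_funM => //.
    by apply/measurable_EFinP; apply: measurableT_comp.
  - move=> x _; rewrite -ge0_integralZl//; last first.
      by apply/measurable_EFinP; exact: measurableT_comp.
    apply: ge0_le_integral => //=.
    + apply/measurable_EFinP; apply: measurableT_comp => //.
      exact: (measurableT_comp mk).
    + apply: emeasurable_funM => //.
      by apply/measurable_EFinP; exact: measurableT_comp.
    + by move=> y _; rewrite lee_fin -normrM (le_trans (kAB _ _))// ler_norm.
rewrite ge0_integralZr//; last 2 first.
- by apply/measurable_EFinP; apply: measurableT_comp.
- exact: integral_ge0.
by rewrite lte_mul_pinfty// ?ge0_fin_numE//; exact: integral_ge0.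
Qed.

Lemma integrable_slice1 x : m2.-integrable setT (fun y => (k (x, y))%:E).
Proof.
apply: (@le_integrable _ _ _ _ _ measurableT _ (fun y => (A x)%:E * (B y)%:E)%E).
- by apply/measurable_EFinP; exact: (measurableT_comp mk).
- by move=> y _ /=; rewrite lee_fin (le_trans (kAB _ _))// ler_norm.
- exact: integrableZl.
Qed.

Lemma EFin_slice1 x :
  (\int[m2]_y k (x, y))%R%:E = (\int[m2]_y (k (x, y))%:E)%E.
Proof. by rewrite fineK//; apply: integrable_fin_num => //; exact: integrable_slice1. Qed.

Lemma real_fubini : m1.-integrable setT (fun x => (\int[m2]_y k (x, y))%R%:E) /\
  (\int[m1]_x (\int[m2]_y k (x, y))%R%:E = \int[m1 \x m2]_z (k z)%:E)%E.
Proof.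
have ik := integrable_prod_dominated.
have E : (fun x => (\int[m2]_y k (x, y))%R%:E) = fubini_F m2 (EFin \o k).
  by apply/funext => x; rewrite EFin_slice1.
by rewrite E; split; [exact: integrable_fubini_F|exact: integral12_prod_meas1].
Qed.

End real.
End complex_fubini.

Section complex_fubini.
Context d1 d2 (T1 : measurableType d1) (T2 : measurableType d2) {R : realType}.
Variables (m1 : {sigma_finite_measure set T1 -> \bar R}).
Variables (m2 : {sigma_finite_measure set T2 -> \bar R}).

Lemma real_fubini_swap (k : T1 * T2 -> R) (A : T1 -> R) (B : T2 -> R) :
  measurable_fun setT k ->
  m1.-integrable setT (EFin \o A) -> m2.-integrable setT (EFin \o B) ->
  (forall x y, `|k (x, y)| <= A x * B y) ->
  [/\ m1.-integrable setT (fun x => (\int[m2]_y k (x, y))%R%:E),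
  m2.-integrable setT (fun y => (\int[m1]_x k (x, y))%R%:E) &
  \int[m1]_x (\int[m2]_y k (x, y)) = \int[m2]_y (\int[m1]_x k (x, y))].
Proof.
move=> mk iA iB kAB.
have [h1 e1] := real_fubini mk iA iB kAB.
have kBA y x : `|(k \o unstable.swap) (y, x)| <= B y * A x by rewrite mulrC; exact: kAB.
have mk' := measurableT_comp mk (@measurable_swap _ _ T2 T1).
have [h2 e2] := real_fubini mk' iB iA kBA.
split => //; rewrite /Rintegral; congr fine.
rewrite e1 e2 -integral21_prod_meas1; last exact: integrable_prod_dominated mk iA iB kAB.
by rewrite -integral12_prod_meas1//; exact: integrable_prod_dominated mk' iB iA kBA.
Qed.

(** Fubini's theorem for a kernel dominated by a tensor product, so that every
    slice (and not merely almost every one) is integrable. *)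
Lemma complex_fubini (K : T1 -> T2 -> R[i]) (A : T1 -> R) (B : T2 -> R) :
  cmeasurable (fun z : T1 * T2 => K z.1 z.2) ->
  m1.-integrable setT (EFin \o A) -> m2.-integrable setT (EFin \o B) ->
  (forall x y, norm1 (K x y) <= A x * B y) ->
  [/\ integrableC m1 (fun x => integralC m2 (K x)),
      integrableC m2 (fun y => integralC m1 (K ^~ y)) &
      integralC m1 (fun x => integralC m2 (K x)) =
      integralC m2 (fun y => integralC m1 (K ^~ y))].
Proof.
move=> [mr mi] iA iB KAB.
have [r1 r2 r3] := real_fubini_swap mr iA iB
  (fun x y => le_trans (norm1_Re _) (KAB x y)).
have [i1 i2 i3] := real_fubini_swap mi iA iB
  (fun x y => le_trans (norm1_Im _) (KAB x y)).
by split; [split|split|rewrite /integralC /= r3 i3].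
Qed.

End complex_fubini.

(** * Tensor products and the multiplication formula *)

Section integral_rV.
Context {R : realType}.

Lemma measurable_comp_shift n (i : 'I_n) (h : R) d (T : measurableType d)
  (g : 'rV[R]_n -> T) :
  measurable_fun setT g -> measurable_fun setT (fun x => g (shift_coord i h x)).
Proof. by move=> mg; exact: (measurableT_comp mg (measurable_shift_coord i h)). Qed.

Lemma Rintegral_shift n (i : 'I_n) (h : R) (g : 'rV[R]_n -> R) :
  measurable_fun setT g ->
  \int[lebesgue_rV]_x g (shift_coord i h x) = \int[lebesgue_rV]_x g x.
Proof.
move=> mg; rewrite /Rintegral; congr fine.
have mg' : measurable_fun setT (EFin \o g) by exact/measurable_EFinP.
rewrite [LHS]integralE [RHS]integralE; congr (_ - _)%E.
- rewrite -[RHS](@ge0_integral_shift _ _ i h)//; last exact: measurable_funepos.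
  by apply: eq_integral => x _; rewrite !funeposE.
- rewrite -[RHS](@ge0_integral_shift _ _ i h)//; last exact: measurable_funeneg.
  by apply: eq_integral => x _; rewrite !funenegE.
Qed.

Lemma Rintegral_rV_cons n (f : 'rV[R]_n.+1 -> R) (A : R -> R) (B : 'rV[R]_n -> R) :
  measurable_fun setT f ->
  (@lebesgue_measure R).-integrable setT (EFin \o A) ->
  lebesgue_rV.-integrable setT (EFin \o B) ->
  (forall t y, `|f (rV_cons (t, y))| <= A t * B y) ->
  lebesgue_rV.-integrable setT (EFin \o f) /\
  \int[lebesgue_rV]_x f x =
  \int[lebesgue_measure]_t (\int[lebesgue_rV]_y f (rV_cons (t, y))).
Proof.
move=> mf iA iB fAB.
have mfc := measurable_comp_rV_cons mf.
have ip := integrable_prod_dominated mfc iA iB fAB.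
have mfE : measurable_fun setT (EFin \o f) by exact/measurable_EFinP.
split.
  exact: (integrable_pushforward (@measurable_rV_cons R n) mfE).
have [_ e] := real_fubini mfc iA iB fAB.
rewrite /Rintegral e; congr fine.
exact: (integral_pushforward (@measurable_rV_cons R n) mfE).
Qed.

Lemma integralC_rV_cons n (f : 'rV[R]_n.+1 -> R[i]) (A : R -> R) (B : 'rV[R]_n -> R) :
  cmeasurable f ->
  (@lebesgue_measure R).-integrable setT (EFin \o A) ->
  lebesgue_rV.-integrable setT (EFin \o B) ->
  (forall t y, norm1 (f (rV_cons (t, y))) <= A t * B y) ->
  integrableC lebesgue_rV f /\
  integralC lebesgue_rV f =
  integralC lebesgue_measure (fun t => integralC lebesgue_rV (fun y => f (rV_cons (t, y)))).
Proof.
move=> [mr mi] iA iB fAB.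
have [r1 r2] := Rintegral_rV_cons mr iA iB (fun x y => le_trans (norm1_Re _) (fAB x y)).
have [i1 i2] := Rintegral_rV_cons mi iA iB (fun x y => le_trans (norm1_Im _) (fAB x y)).
by split; [split|rewrite /integralC r2 i2].
Qed.

Lemma cmeasurable_coor n (i : 'I_n) (a : R -> R[i]) :
  cmeasurable (a : measurableTypeR R -> _) -> cmeasurable (fun x : 'rV[R]_n => a (x ord0 i)).
Proof.
by move=> [ar ai]; split; [exact: (measurableT_comp ar (measurable_coor i))|
  exact: (measurableT_comp ai (measurable_coor i))].
Qed.

Lemma cmeasurable_prod d (T : measurableType d) (I : Type) (r : seq I) (F : I -> T -> R[i]) :
  (forall i, cmeasurable (F i)) -> cmeasurable (fun x => \prod_(i <- r) F i x).
Proof.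
move=> Fi; elim: r => [|i r IH].
  by under eq_fun do rewrite big_nil; exact: cmeasurable_cst.
by under eq_fun do rewrite big_cons; exact: cmeasurableM.
Qed.

(** By induction on the dimension, splitting off the first coordinate. *)
Lemma integralC_tensor n (a : 'I_n -> R -> R[i]) :
  (forall i, integrableC (@lebesgue_measure R) (a i)) ->
  integrableC lebesgue_rV (fun x : 'rV[R]_n => \prod_i a i (x ord0 i)) /\
  integralC lebesgue_rV (fun x : 'rV[R]_n => \prod_i a i (x ord0 i)) =
    \prod_i integralC (@lebesgue_measure R) (a i).
Proof.
elim: n a => [|n IH] a ia.
  rewrite big_ord0; under eq_fun do rewrite big_ord0.
  have i1 : (\d_(0 : 'rV[R]_0)).-integrable setT (cst (1%:E : \bar R)).
    by apply/integrableP; split => //; rewrite integral_dirac// diracT /= normr1 mul1e ltry.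
  split; first by split => //; exact: integrable0.
  by apply: complexP => /=; rewrite /Rintegral integral_dirac// diracT mul1e.
have [iP eP] := IH (fun i => a (lift ord0 i)) (fun i => ia _).
pose P (y : 'rV[R]_n) := \prod_i a (lift ord0 i) (y ord0 i).
have E t y : \prod_i a i ((rV_cons (t, y)) ord0 i) = a ord0 t * P y.
  rewrite big_ord_recl rV_cons0; congr (_ * _).
  by apply: eq_bigr => i _; rewrite rV_consS.
have mf : cmeasurable (fun x : 'rV[R]_n.+1 => \prod_i a i (x ord0 i)).
  apply: cmeasurable_prod => i; apply: cmeasurable_coor.
  exact: integrableC_measurable (ia i).
have [i1 e1] := integralC_rV_cons mf (integrableC_norm1 (ia ord0))
  (integrableC_norm1 iP) (fun t y => eq_ind_r (fun z => norm1 z <= _) (norm1M _ _) (E t y)).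
split => //; rewrite e1 big_ord_recl -eP -integralCZr//.
congr integralC; apply/funext => t.
by under eq_fun do rewrite E; rewrite integralCZ.
Qed.

Lemma integrable_tensor n (a : 'I_n -> R -> R) :
  (forall i, (@lebesgue_measure R).-integrable setT (EFin \o a i)) ->
  lebesgue_rV.-integrable setT (fun x : 'rV[R]_n => (\prod_i a i (x ord0 i))%:E).
Proof.
move=> ia.
have iaC i : integrableC (@lebesgue_measure R) (fun t => (a i t)%:C%C).
  by split; [exact: ia|exact: integrable0].
have [[+ _] _] := integralC_tensor iaC.
apply: eq_integrable => // x _ /=.
by rewrite -rmorph_prod.
Qed.

Section cis.
Context {n : nat}.
Implicit Types x y : 'rV[R]_n.

Lemma measurable_cos : measurable_fun [set: R] (@cos R).
Proof. exact: continuous_measurable_fun (@continuous_cos R). Qed.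

Lemma measurable_sin : measurable_fun [set: R] (@sin R).
Proof. exact: continuous_measurable_fun (@continuous_sin R). Qed.

Lemma cmeasurable_cis d (T : measurableType d) (f : T -> R) :
  measurable_fun setT f -> cmeasurable (fun t => cis2pi (f t)).
Proof.
move=> mf; split => /=.
  by apply: (measurableT_comp measurable_cos); exact: measurable_funM.
by apply: (measurableT_comp measurable_sin); exact: measurable_funM.
Qed.

Lemma measurable_dotp2 :
  measurable_fun setT (fun z : 'rV[R]_n * 'rV[R]_n => dotp z.1 z.2).
Proof.
rewrite /dotp; apply: measurable_sum => i; apply: measurable_funM.
  exact: (measurableT_comp (measurable_coor i) measurable_fst).
exact: (measurableT_comp (measurable_coor i) measurable_snd).
Qed.

Lemma measurable_dotp x : measurable_fun setT (dotp x).
Proof.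
rewrite /dotp; apply: measurable_sum => i; apply: measurable_funM => //.
exact: measurable_coor.
Qed.

Lemma dotpC x y : dotp x y = dotp y x.
Proof. by apply: eq_bigr => i _; rewrite mulrC. Qed.

Lemma measurable_dotpl x : measurable_fun setT (dotp^~ x).
Proof. by under eq_fun do rewrite dotpC; exact: measurable_dotp. Qed.

Lemma integrableC_cis (b : 'rV[R]_n -> R[i]) (f : 'rV[R]_n -> R) :
  integrableC lebesgue_rV b -> measurable_fun setT f ->
  integrableC lebesgue_rV (fun y => b y * cis2pi (f y)).
Proof.
move=> ib mf; apply: (integrableC_bounded ib (cmeasurable_cis mf)).
by move=> y; exact: norm1_cis2pi.
Qed.

(** The multiplication formula: the (inverse) Fourier transform is self-adjoint
    for the bilinear pairing of integrable functions. The sign e serves both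
    the transform and its inverse. *)
Lemma multiplication_formula (a b : 'rV[R]_n -> R[i]) (e : R) :
  integrableC lebesgue_rV a -> integrableC lebesgue_rV b ->
  [/\ integrableC lebesgue_rV
        (fun x => a x * integralC lebesgue_rV (fun y => b y * cis2pi (e * dotp x y))),
      integrableC lebesgue_rV
        (fun y => b y * integralC lebesgue_rV (fun x => a x * cis2pi (e * dotp x y))) &
      integralC lebesgue_rV
        (fun x => a x * integralC lebesgue_rV (fun y => b y * cis2pi (e * dotp x y))) =
      integralC lebesgue_rV
        (fun y => b y * integralC lebesgue_rV (fun x => a x * cis2pi (e * dotp x y)))].
Proof.
move=> ia ib.
have ibx x : integrableC lebesgue_rV (fun y => b y * cis2pi (e * dotp x y)).
  exact: integrableC_cis ib (measurable_funM (measurable_cst e) (measurable_dotp x)).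
have iay y : integrableC lebesgue_rV (fun x => a x * cis2pi (e * dotp x y)).
  exact: integrableC_cis ia (measurable_funM (measurable_cst e) (measurable_dotpl y)).
pose K x y := a x * (b y * cis2pi (e * dotp x y)).
have mK : cmeasurable (fun z : 'rV[R]_n * 'rV[R]_n => K z.1 z.2).
  have [ar ai] := integrableC_measurable ia; have [br bi] := integrableC_measurable ib.
  apply: cmeasurableM.
    by split; [exact: (measurableT_comp ar measurable_fst)|exact: (measurableT_comp ai measurable_fst)].
  apply: cmeasurableM.
    by split; [exact: (measurableT_comp br measurable_snd)|exact: (measurableT_comp bi measurable_snd)].
  by apply: cmeasurable_cis; apply: measurable_funM => //; exact: measurable_dotp2.
have i2b : lebesgue_rV.-integrable setT (EFin \o (fun y => 2 * norm1 (b y))).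
  apply: (@integrableZl _ _ _ lebesgue_rV _ _ 2 (fun y => (norm1 (b y))%:E)) => //.
  exact: integrableC_norm1.
have KAB x y : norm1 (K x y) <= norm1 (a x) * (2 * norm1 (b y)).
  rewrite (le_trans (norm1M _ _))// ler_wpM2l ?norm1_ge0//.
  rewrite (le_trans (norm1M _ _))// mulrC.
  by rewrite ler_wpM2r ?norm1_ge0// norm1_cis2pi.
have [h1 h2 h3] := complex_fubini mK (integrableC_norm1 ia) i2b KAB.
have E1 : (fun x => integralC lebesgue_rV (K x)) =
    (fun x => a x * integralC lebesgue_rV (fun y => b y * cis2pi (e * dotp x y))).
  by apply/funext => x; exact: (integralCZ (a x) (ibx x)).
have E2 : (fun y => integralC lebesgue_rV (K^~ y)) =
    (fun y => b y * integralC lebesgue_rV (fun x => a x * cis2pi (e * dotp x y))).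
  apply/funext => y; rewrite -(integralCZ (b y) (iay y)).
  by congr integralC; apply/funext => x; rewrite /K mulrCA.
by split; [rewrite -E1|rewrite -E2|rewrite -E1 -E2].
Qed.

End cis.

Lemma integrable_invDsqr :
  (@lebesgue_measure R).-integrable setT (fun t : R => ((1 + t ^+ 2)^-1)%:E).
Proof.
have p0 t : 0 <= (1 + t ^+ 2)^-1 :> R by rewrite invr_ge0 addr_ge0// sqr_ge0.
have mf : measurable_fun [set: R] (fun t : R => (1 + t ^+ 2)^-1).
  by apply: continuous_measurable_fun; exact: continuous_oneDsqrV.
have E : (\int[lebesgue_measure]_(t in `[0%R, +oo[) ((1 + t ^+ 2)^-1)%:E = (pi / 2)%:E :> \bar R)%E.
  rewrite (@ge0_continuous_FTC2y _ _ (@atan R) _ (pi / 2)).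
  - by rewrite atan0 sube0.
  - by [].
  - apply: continuous_subspaceT; exact: continuous_oneDsqrV.
  - exact: cvgy_atan.
  - by move=> x _; exact: derivable_atan.
  - by apply: cvg_at_right_filter; exact: continuous_atan.
  - by move=> x _; rewrite derive1_atan.
apply/integrableP; split; first exact/measurable_EFinP.
under eq_integral do rewrite gee0_abs ?lee_fin//.
rewrite -(setUv `[0%R, +oo[%classic) ge0_integral_setU//=; last 4 first.
- exact: measurableC.
- by rewrite setUv; exact/measurable_EFinP.
- by move=> x _; rewrite lee_fin.
- by rewrite disj_set2E setICr.
rewrite E setCitvr; apply: lte_add_pinfty; first exact: ltry.
apply: (@le_lt_trans _ _ (pi / 2)%:E); last exact: ltry.
rewrite -E ge0_integration_by_substitution0//; last exact/measurable_EFinP.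
under [leRHS]eq_integral do rewrite sqrrN.
apply: ge0_subset_integral => //=.
- by apply: measurable_funTS; exact/measurable_EFinP.
- by move=> x _; rewrite lee_fin.
- by move=> x /=; rewrite !in_itv/= => /ltW.
Qed.

(** An integrable majorant of Schwartz functions that is a tensor product, so
    that its integral reduces to that of 1 / (1 + t^2) on the line. *)
Definition weight n (x : 'rV[R]_n) : R := \prod_i (1 + x ord0 i ^+ 2)^-1.

Lemma integrable_weight n : lebesgue_rV.-integrable setT (EFin \o @weight n).
Proof. exact: (@integrable_tensor n (fun=> fun t => (1 + t ^+ 2)^-1) (fun=> integrable_invDsqr)). Qed.

End integral_rV.

(** * Smooth functions *)

Section lines.
Context {R : realType} {n : nat}.
Implicit Types (f : 'rV[R]_n -> R) (a v : 'rV[R]_n).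

Lemma line_quotient f a v (t : R) :
  (fun h : R => h^-1 *: (((fun s : R => f (s *: v + a)) \o shift t) (h *: (1 : R)) - f (t *: v + a))) =
  (fun h : R => h^-1 *: ((f \o shift (t *: v + a)) (h *: v) - f (t *: v + a))).
Proof.
apply/funext => h /=; congr (_ *: (f _ - _)).
by rewrite /shift/= scalerDl addrA [h *: 1]mulr1.
Qed.

(** Brings the mean value theorem and the chain rule on the line to bear on
    directional derivatives. *)
Lemma derivable_line f a v (t : R) :
  derivable f (t *: v + a) v <-> derivable (fun s : R => f (s *: v + a)) t 1.
Proof. by rewrite /derivable line_quotient. Qed.

Lemma derive_line f a v (t : R) :
  'D_1 (fun s : R => f (s *: v + a)) t = 'D_v f (t *: v + a).
Proof. by rewrite /derive line_quotient. Qed.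

Lemma is_derive_line f a v (t : R) : derivable f (t *: v + a) v ->
  is_derive t 1 (fun s : R => f (s *: v + a)) ('D_v f (t *: v + a)).
Proof.
move=> d; rewrite -derive_line; apply: derivableP; exact/derivable_line.
Qed.

Lemma is_derive_affine f a v x (m : R) : derivable f (m *: (x - a)) v ->
  is_derive x v (fun y => f (m *: (y - a))) (m * 'D_v f (m *: (x - a))).
Proof.
move=> d.
have d1 : is_derive (m * 0) 1 (fun s : R => f (s *: v + m *: (x - a))) ('D_v f (m *: (x - a))).
  have := @is_derive_line f (m *: (x - a)) v 0.
  by rewrite scale0r add0r mulr0; apply.
have d2 : is_derive (0 : R) 1 (fun s : R => m * s) m.
  have -> : (fun s : R => m * s) = m \*: (@id R) by [].
  by apply: is_derive_eq; rewrite /GRing.scale/= mulr1.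
have d3 := is_derive1_comp d1 d2.
have E : (fun s : R => f (s *: v + m *: (x - a))) \o (fun s : R => m * s) =
         (fun s : R => (fun y => f (m *: (y - a))) (s *: v + x)).
  by apply/funext => s /=; congr f; rewrite -(addrA (s *: v)) [in RHS]scalerDr scalerA.
rewrite E in d3; have [h1 h2] := d3.
have := derivable_line (fun y => f (m *: (y - a))) x v 0.
have := derive_line (fun y => f (m *: (y - a))) x v 0.
rewrite scale0r add0r h2 => e1 e2.
by apply: (@DeriveDef _ _ _ _ _ _ _ (e2.2 h1)); rewrite -e1 mulrC.
Qed.

End lines.

Section smooth_functions.
Context {R : realType} {n : nat}.
Implicit Types (f g : 'rV[R]_n -> R).
Local Notation e_ i := (delta_mx ord0 i : 'rV[R]_n).

(** Classes of functions of finite smoothness: unlike the definition of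
    smoothness by all iterated partials, they are set up so that closure
    properties follow by induction on the order. *)
Fixpoint Ck (m : nat) f : Prop :=
  [/\ continuous f, forall i x, derivable f x (e_ i) &
      if m is m'.+1 then forall i, Ck m' (partial i f) else True].

Lemma smooth_partial i f : smooth f -> smooth (partial i f).
Proof. by move=> sf l; rewrite -foldr_rcons; exact: sf. Qed.

Lemma smooth_Ck m f : smooth f -> Ck m f.
Proof.
elim: m f => [|m IH] f sf /=; (split; [exact: (sf [::]).1|exact: (sf [::]).2|]) => // i.
by apply: IH; exact: smooth_partial.
Qed.

Lemma Ck_smooth f : (forall m, Ck m f) -> smooth f.
Proof.
move=> cf l.
suff: forall f, Ck (size l) f -> continuous (foldr partial f l) /\
    forall i x, derivable (foldr partial f l) x (e_ i) by apply.
elim/last_ind: l => [|l i IH] {cf}f /=; first by case.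
by rewrite size_rcons foldr_rcons => -[_ _ /(_ i)]; exact: IH.
Qed.

Lemma Ck_continuous m f : Ck m f -> continuous f.
Proof. by case: m => [|m] []. Qed.

Lemma Ck_derivable m f i x : Ck m f -> derivable f x (e_ i).
Proof. by case: m => [|m] []. Qed.

Lemma CkW m f : Ck m.+1 f -> Ck m f.
Proof.
elim: m f => [|m IH] f [a b c]; split => // i.
by apply: IH; exact: c.
Qed.

Lemma CkD m f g : Ck m f -> Ck m g -> Ck m (fun x => f x + g x).
Proof.
elim: m f g => [|m IH] f g cf cg /=; split.
- by move=> x; apply: continuousD; [exact: (Ck_continuous cf)|exact: (Ck_continuous cg)].
- by move=> i x; apply: derivableD; [exact: Ck_derivable cf|exact: Ck_derivable cg].
- by [].
- by move=> x; apply: continuousD; [exact: (Ck_continuous cf)|exact: (Ck_continuous cg)].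
- by move=> i x; apply: derivableD; [exact: Ck_derivable cf|exact: Ck_derivable cg].
move=> i; rewrite (_ : partial i _ = fun x => partial i f x + partial i g x).
  by apply: IH; [case: cf => _ _; apply|case: cg => _ _; apply].
by apply/funext => x; apply: deriveD; [exact: Ck_derivable cf|exact: Ck_derivable cg].
Qed.

Lemma partialM m i f g : Ck m f -> Ck m g ->
  partial i (fun x => f x * g x) = fun x => f x * partial i g x + partial i f x * g x.
Proof.
move=> cf cg; apply/funext => x.
have := @deriveM _ _ f g x (e_ i) (@Ck_derivable m f i x cf) (@Ck_derivable m g i x cg).
by rewrite /partial => ->; rewrite /GRing.scale/=; congr (_ + _); rewrite mulrC.
Qed.

Lemma CkM m f g : Ck m f -> Ck m g -> Ck m (fun x => f x * g x).
Proof.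
elim: m f g => [|m IH] f g cf cg /=; split.
- by move=> x; apply: continuousM; [exact: (Ck_continuous cf)|exact: (Ck_continuous cg)].
- by move=> i x; apply: derivableM; [exact: Ck_derivable cf|exact: Ck_derivable cg].
- by [].
- by move=> x; apply: continuousM; [exact: (Ck_continuous cf)|exact: (Ck_continuous cg)].
- by move=> i x; apply: derivableM; [exact: Ck_derivable cf|exact: Ck_derivable cg].
move=> i; rewrite (partialM _ cf cg).
by apply: CkD; apply: IH; [exact: CkW|case: cg => _ _; apply|case: cf => _ _; apply|exact: CkW].
Qed.

Lemma Ck_cst m (c : R) : Ck m (fun=> c).
Proof.
elim: m c => [|m IH] c /=; split => //; try (by move=> ?; exact: cst_continuous).
move=> i; rewrite (_ : partial i _ = fun=> 0) //.
by apply/funext => x; exact: derive_cst.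
Qed.

Lemma continuous_affine (a : 'rV[R]_n) (c : R) f : continuous f ->
  continuous (fun x : 'rV[R]_n => f (c *: (x - a))).
Proof.
move=> cf x.
apply: (@continuous_comp _ _ _ (fun x : 'rV[R]_n => c *: (x - a)) f); last exact: cf.
have h : (fun y : 'rV[R]_n => y - a) @ x --> x - a.
  by apply: continuousB => //; exact: cst_continuous.
exact: (@cvgZl_tmp _ _ _ _ _ c _ _ h).
Qed.

Lemma partial_affine i (a : 'rV[R]_n) (c : R) f : (forall x, derivable f x (e_ i)) ->
  partial i (fun x : 'rV[R]_n => f (c *: (x - a))) = fun x : 'rV[R]_n => c * partial i f (c *: (x - a)).
Proof.
by move=> df; apply/funext => x; rewrite /partial; have [_ ->] := is_derive_affine (df (c *: (x - a))).
Qed.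

Lemma Ck_affine m (a : 'rV[R]_n) (c : R) f : Ck m f -> Ck m (fun x : 'rV[R]_n => f (c *: (x - a))).
Proof.
elim: m f => [|m IH] f cf /=; split.
- by apply: continuous_affine; exact: Ck_continuous cf.
- by move=> i x; have [] := is_derive_affine (@Ck_derivable _ _ i (c *: (x - a)) cf).
- by [].
- by apply: continuous_affine; exact: Ck_continuous cf.
- by move=> i x; have [] := is_derive_affine (@Ck_derivable _ _ i (c *: (x - a)) cf).
move=> i; rewrite partial_affine; last by move=> x; exact: Ck_derivable cf.
apply: CkM; first exact: Ck_cst.
by apply: IH; case: cf => _ _; apply.
Qed.

Lemma mderive_foldr (b : multiindex n) : exists l : seq 'I_n,
  forall f, mderive b f = foldr partial f l.
Proof.
rewrite /mderive; elim: (enum 'I_n) => [|i s [l IH]]; first by exists [::].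
exists (nseq (b i) i ++ l) => f /=; rewrite IH foldr_cat.
by elim: (b i) => //= k ->.
Qed.

Lemma mderive0 (b : multiindex n) : mderive b (fun=> 0 : R) = fun=> 0.
Proof.
have [l ->] := mderive_foldr b; elim: l => //= i l ->.
by apply/funext => x; exact: derive_cst.
Qed.

Lemma mderive_cmderive0 (f : 'rV[R]_n -> R[i]) x : cmderive (finfun (fun=> 0%N)) f x = f x.
Proof.
have E g : mderive (finfun (fun=> 0%N) : multiindex n) g = g.
  by rewrite /mderive; elim: (enum 'I_n) => //= i l ->; rewrite ffunE.
by rewrite /cmderive !E; case: (f x).
Qed.

Lemma mpow0 (x : 'rV[R]_n) : mpow x (finfun (fun=> 0%N)) = 1.
Proof. by rewrite /mpow big1// => i _; rewrite ffunE expr0. Qed.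

Lemma msize0 : msize (finfun (fun=> 0%N) : multiindex n) = 0%N.
Proof. by rewrite /msize big1// => i _; rewrite ffunE. Qed.

End smooth_functions.

Section compact_support.
Context {R : realType} {n : nat}.
Implicit Types (f g : 'rV[R]_n -> R) (x y : 'rV[R]_n).

Lemma boxE x r : box x r = [set y | forall i, `[x ord0 i - r, x ord0 i + r]%classic (y ord0 i)].
Proof.
by apply/seteqP; split=> y /= h i; have := h i; rewrite in_itv/= ler_distl.
Qed.

Lemma box_compact x r : compact (box x r).
Proof. rewrite boxE.
exact: (@rV_compact R n (fun i => `[x ord0 i - r, x ord0 i + r]%classic) (fun i => @segment_compact R _ _)). Qed.

Lemma box_closed x r : closed (box x r).
Proof. by apply: compact_closed; [exact: norm_hausdorff|exact: box_compact]. Qed.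

Lemma box_center (x : 'rV[R]_n) r : 0 <= r -> box x r x.
Proof. by move=> r0 i; rewrite subrr normr0. Qed.

Lemma compact_support_bounded f x r : continuous f ->
  (forall y, ~ box x r y -> f y = 0) -> exists M, forall y, `|f y| <= M.
Proof.
move=> cf f0; have [r0|r0] := leP 0 r; last first.
  have [i0|n0] := pselect (exists i : 'I_n, True); last first.
    exists `|f x| => y; rewrite (_ : y = x)//; apply/rowP => i.
    by exfalso; apply: n0; exists i.
  exists 0 => y; rewrite f0 ?normr0// => h; case: i0 => i _.
  by have := le_trans (normr_ge0 _) (h i); rewrite leNgt r0.
have cnf : continuous (fun y => `|f y|).
  by move=> y; apply: (@continuous_comp _ _ _ f (fun t : R => `|t|)); [exact: cf|exact: norm_continuous].
have [c _ cM] := @EVT_max_rV R n (fun y => `|f y|) (box x r)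
  (ex_intro _ x (box_center x r0)) (@box_compact x r) (continuous_subspaceT cnf).
exists `|f c| => y; have [yb|yb] := pselect (box x r y).
  by apply: cM; rewrite inE.
by rewrite f0// normr0.
Qed.

Lemma partial_support i f x r : (forall y, ~ box x r y -> f y = 0) ->
  forall y, ~ box x r y -> partial i f y = 0.
Proof.
move=> f0 y yb; rewrite /partial (@near_eq_derive _ _ _ f (cst 0)) ?derive_cst//.
have : nbhs y (~` box x r).
  by apply: open_nbhs_nbhs; split => //; exact/closed_openC/box_closed.
by apply: filterS => z; exact: f0.
Qed.

Lemma mpow_continuous (a : multiindex n) : continuous (fun x => mpow x a).
Proof.
rewrite /mpow; elim: (index_enum _) => [|i s IH].
  by under eq_fun do rewrite big_nil; move=> x; exact: cst_continuous.
under eq_fun do rewrite big_cons; move=> x.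
apply: (@continuousM _ _ (fun x : 'rV[R]_n => x ord0 i ^+ a i)
  (fun x : 'rV[R]_n => \prod_(j <- s) x ord0 j ^+ a j) x); last exact: IH.
apply: (@continuous_comp _ _ _ (fun x : 'rV[R]_n => x ord0 i) (fun t => t ^+ a i)).
  exact: coord_continuous.
exact: exprn_continuous.
Qed.

Lemma smooth_compact_schwartz f x r : smooth f ->
  (forall y, ~ box x r y -> f y = 0) -> schwartz (fun y => (f y)%:C%C).
Proof.
move=> sf f0; split.
  by split => //=; apply: Ck_smooth => m; exact: Ck_cst.
move=> a b; have [l lE] := @mderive_foldr R n b.
have l0 y : ~ box x r y -> foldr partial f l y = 0.
  move: y; elim: l {lE} => //= i l IH y; exact: partial_support.
have [||M MP] := @compact_support_bounded (fun y => mpow y a * mderive b f y) x r.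
- move=> y; apply: continuousM; first exact: mpow_continuous.
  by rewrite lE; exact: (sf l).1.
- by move=> y yb; rewrite lE l0// mulr0.
exists M => y; rewrite /cmderive/= mderive0; apply: le_trans (MP y).
by rewrite /= !mul0r !mulr0 subr0 addr0 expr0n addr0 sqrtr_sqr.
Qed.

End compact_support.

(** * The dyadic partition and Schwartz functions *)

Section euclid.
Context {R : realType} {n : nat}.
Implicit Types x : 'rV[R]_n.

Lemma coord_le_euclid x i : `|x ord0 i| <= euclid x.
Proof.
rewrite /euclid -sqrtr_sqr ler_wsqrtr// (bigD1 i)//= lerDl.
by apply: sumr_ge0 => j _; exact: sqr_ge0.
Qed.

Lemma euclid_box x r : 0 <= r -> box 0 r x -> euclid x <= n%:R * r.
Proof.
move=> r0 xr; rewrite /euclid -(@ger0_norm _ (n%:R * r)) ?mulr_ge0//.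
rewrite -sqrtr_sqr ler_wsqrtr//.
apply: (@le_trans _ _ (\sum_(i < n) r ^+ 2)).
  apply: ler_sum => i _; rewrite -(real_normK (num_real _)).
  by rewrite ler_sqr ?nnegrE//; have := xr i; rewrite mxE subr0.
have -> : \sum_(i < n) r ^+ 2 = n%:R * r ^+ 2 by rewrite sumr_const card_ord mulr_natl.
rewrite exprMn ler_wpM2r ?sqr_ge0//.
by rewrite -natrX ler_nat; case: n => // m; rewrite expnS expn1 leq_pmulr.
Qed.

End euclid.

Section partition.
Context {R : realType} {n : nat} (psi : nat -> 'rV[R]_n -> R[i]).
Hypothesis psiP : LP_partition psi.
Implicit Types xi x y : 'rV[R]_n.

Lemma LP_zero0 xi : 2 < euclid xi -> psi 0%N xi = 0.
Proof.
case: psiP => _ h _ _ _ xi2; apply/eqP/negP => /negP z.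
have := h _ (@subset_closure _ [set x | psi 0%N x != 0] _ z); rewrite /= leNgt xi2//.
Qed.

Lemma LP_zero j xi : (0 < j)%N -> euclid xi < 2 ^+ j.-1 \/ 2 ^+ j.+1 < euclid xi ->
  psi j xi = 0.
Proof.
case: psiP => _ _ h _ _ j0 xij; apply/eqP/negP => /negP z.
have := h _ j0 _ (@subset_closure _ [set x | psi j x != 0] _ z); rewrite /= => /andP[a b].
by case: xij; rewrite ltNge ?a ?b.
Qed.

Lemma LP_zero_large k xi : 2 ^+ k.+1 < euclid xi -> psi k xi = 0.
Proof.
case: k => [|k] h; first by apply: LP_zero0; rewrite -[2]expr1.
by apply: LP_zero => //; right.
Qed.

Lemma LP_sum K xi : (forall k, (K <= k)%N -> psi k xi = 0) ->
  \sum_(k < K) psi k xi = 1.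
Proof.
case: psiP => _ _ _ _ /(_ xi) [hr hi] z.
have P (F : R[i] -> R) (l : R) : F 0 = 0 ->
    series (fun j => F (psi j xi)) @ \oo --> l -> \sum_(k < K) F (psi k xi) = l.
  move=> F0 h; apply/esym/(cvg_unique _ h) => //.
  apply: cvg_near_cst; exists K => // m /= Km.
  rewrite /series/= -(subnKC Km) /index_iota subn0 -(big_mkord xpredT (fun k => F (psi k xi))).
  rewrite /index_iota subn0 iotaD big_cat/= [X in _ + X]big1_seq ?addr0//.
  by move=> k /andP[_]; rewrite mem_iota add0n => /andP[Kk _]; rewrite z.
apply: complexP => /=.
  rewrite -[RHS](P (@complex.Re R) 1)//.
  by rewrite raddf_sum.
rewrite -[RHS](P (@complex.Im R) 0)//.
by rewrite raddf_sum.
Qed.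

Lemma LP_low xi : euclid xi < 1 -> psi 0%N xi = 1 /\ forall k, (0 < k)%N -> psi k xi = 0.
Proof.
move=> xi1; have z k : (0 < k)%N -> psi k xi = 0.
  move=> k0; apply: LP_zero => //; left; apply: lt_le_trans xi1 _.
  by apply: exprn_ege1; rewrite ler1n.
by split => //; have := LP_sum z; rewrite big_ord1.
Qed.

(** Only the shells j and j + 1 meet this annulus, and the partition sums to 1. *)
Lemma LP_high j xi : (0 < j)%N -> 2 ^+ j < euclid xi < 2 ^+ j.+1 ->
  (forall k, k != j -> k != j.+1 -> psi k xi = 0) /\ psi j xi + psi j.+1 xi = 1.
Proof.
move=> j0 /andP[h1 h2].
have z k : k != j -> k != j.+1 -> psi k xi = 0.
  move=> kj kj1; have [jk|kj2] := ltnP j k; last first.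
    apply: LP_zero_large; apply: le_lt_trans h1.
    by rewrite ler_eXn2l ?ltr1n// ltn_neqAle kj.
  have jk1 : (j.+1 < k)%N by rewrite ltn_neqAle eq_sym kj1.
  apply: LP_zero; first exact: leq_ltn_trans jk.
  left; apply: lt_le_trans h2 _.
  by rewrite ler_eXn2l ?ltr1n//; case: k jk1 {kj kj1 jk}.
split => //; rewrite -[RHS](@LP_sum j.+2 xi); last first.
  by move=> k jk; apply: z; rewrite gtn_eqF// (ltn_trans _ jk).
rewrite !big_ord_recr/= big1 ?add0r// => k _.
by apply: z; rewrite ltn_eqF// ltnS ltnW.
Qed.

Lemma LP_support k xi : ~ box 0 (2 ^+ k.+1) xi -> psi k xi = 0.
Proof.
move=> h; apply: LP_zero_large; apply: contrapT => /negP; rewrite -leNgt => h'.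
by apply: h => i; rewrite mxE subr0 (le_trans (coord_le_euclid _ _)).
Qed.

Lemma LP_smooth k : smooth (fun x => complex.Re (psi k x)) /\
  smooth (fun x => complex.Im (psi k x)).
Proof. by case: psiP => /(_ k) []. Qed.

Lemma LP_continuous k : continuous (fun x => complex.Re (psi k x)) /\
  continuous (fun x => complex.Im (psi k x)).
Proof. by have [h1 h2] := LP_smooth k; split; [exact: (h1 [::]).1|exact: (h2 [::]).1]. Qed.

Lemma LP_cmeasurable k : cmeasurable (psi k).
Proof.
by have [h1 h2] := LP_continuous k; split; exact: continuous_measurable_rV.
Qed.

Lemma LP_bounded : exists M, forall k xi, norm1 (psi k xi) <= M.
Proof.
case: psiP => _ _ _ /(_ (finfun (fun=> 0%N))) [M MP] _.
exists (2 * M) => k xi; have := MP k xi.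
rewrite msize0 muln0 expr0 mul1r mderive_cmderive0 => h.
by apply: le_trans (norm1_le_normc _) _; rewrite ler_pM2l.
Qed.

(** The partition supplies its own smooth bumps: |psi_0|^2, centred at a and
    shrunk by the factor m, is nonnegative, and is 1 near a because psi_0 is 1
    on the open unit ball. *)
Definition lp_bump (a : 'rV[R]_n) (m : R) (x : 'rV[R]_n) : R :=
  let y := m *: (x - a) in
  complex.Re (psi 0%N y) * complex.Re (psi 0%N y) +
  complex.Im (psi 0%N y) * complex.Im (psi 0%N y).

Lemma lp_bump_smooth a m : smooth (lp_bump a m).
Proof.
have [h1 h2] := LP_smooth 0; apply: Ck_smooth => k.
have k1 := @Ck_affine _ _ k a m _ (@smooth_Ck _ _ k _ h1).
have k2 := @Ck_affine _ _ k a m _ (@smooth_Ck _ _ k _ h2).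
exact: CkD (CkM k1 k1) (CkM k2 k2).
Qed.

Lemma lp_bump_ge0 a m x : 0 <= lp_bump a m x.
Proof. by rewrite addr_ge0// -expr2 sqr_ge0. Qed.

Lemma lp_bump_support a m x : 0 < m -> ~ box a (2 / m) x -> lp_bump a m x = 0.
Proof.
move=> m0 h; rewrite /lp_bump /= (_ : psi 0%N _ = 0) ?mulr0 ?addr0//.
apply: LP_support => h'; apply: h => i; have := h' i.
rewrite !mxE subr0 normrM gtr0_norm// expr1 => h2.
by rewrite ler_pdivlMr// mulrC.
Qed.

Lemma lp_bump1 a m x : 0 < m -> box a (m^-1 / n.+1%:R) x -> lp_bump a m x = 1.
Proof.
move=> m0 h; rewrite /lp_bump /= (LP_low _).1 /= ?mulr0 ?mulr1 ?addr0//.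
apply: (@le_lt_trans _ _ (n%:R * n.+1%:R^-1)).
  apply: euclid_box; first by rewrite invr_ge0.
  move=> i; have := h i; rewrite !mxE subr0 normrM gtr0_norm// => h2.
  by rewrite mulrC -ler_pdivlMr// mulrC.
by rewrite ltr_pdivrMr// mul1r ltr_nat.
Qed.

Lemma lp_bump_bounded : exists2 M, 0 < M & forall a m x, lp_bump a m x <= M.
Proof.
have [M MP] := LP_bounded; exists (2 * M ^+ 2 + 1).
  by rewrite ltr_wpDl// mulr_ge0// sqr_ge0.
move=> a m x; rewrite /lp_bump/=; set z := psi _ _.
have h : norm1 z <= M by exact: MP.
have M0 : 0 <= M by apply: le_trans h; exact: norm1_ge0.
have P t : `|t| <= M -> t * t <= M ^+ 2.
  by move=> tM; rewrite -expr2 -(real_normK (num_real t)) ler_sqr ?nnegrE.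
have := P _ (le_trans (norm1_Re _) h); have := P _ (le_trans (norm1_Im _) h); lra.
Qed.

End partition.

Section compactly_supported_integrals.
Context {R : realType} {n : nat}.
Implicit Types x y : 'rV[R]_n.

Lemma integrable_box_cst x (r M : R) : 0 <= r ->
  lebesgue_rV.-integrable setT (fun y => (M * \1_(box x r) y)%:E).
Proof.
move=> r0; under eq_fun do rewrite EFinM.
apply: (@integrableZl _ _ _ lebesgue_rV _ _ M (fun y => (\1_(box x r) y)%:E)) => //.
apply/integrableP; split.
  by apply/measurable_EFinP; apply: measurable_indic; exact: measurable_box.
under eq_integral do rewrite gee0_abs ?lee_fin//.
rewrite integral_indic//; last exact: measurable_box.
by rewrite setIT [X in (X < _)%E](lebesgue_rV_box x r0) ltry.
Qed.

Lemma Rintegral_box_cst x (r M : R) : 0 <= r ->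
  \int[lebesgue_rV]_y (M * \1_(box x r) y) = M * (2 * r) ^+ n.
Proof.
move=> r0; rewrite RintegralZl//; last first.
  have := integrable_box_cst x 1 r0.
  by apply: eq_integrable => // y _; rewrite mul1r.
rewrite /Rintegral integral_indic//; last exact: measurable_box.
by rewrite setIT [X in fine X](lebesgue_rV_box x r0).
Qed.

Lemma integrable_box_bounded (g : 'rV[R]_n -> R) x (r M : R) : 0 <= r ->
  measurable_fun setT g -> (forall y, `|g y| <= M) ->
  (forall y, ~ box x r y -> g y = 0) -> lebesgue_rV.-integrable setT (EFin \o g).
Proof.
move=> r0 mg gM g0; apply: le_integrable (integrable_box_cst x M r0) => //.
  exact/measurable_EFinP.
move=> y _ /=; rewrite lee_fin indicE.
have M0 : 0 <= M by apply: le_trans (gM y).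
case: (boolP (y \in box x r)) => h; first by rewrite mulr1 (ger0_norm M0) gM.
by rewrite g0 ?normr0//; move: h; rewrite notin_setE.
Qed.

Lemma Rintegral_box_le (g : 'rV[R]_n -> R) x (r M : R) : 0 <= r ->
  measurable_fun setT g -> (forall y, `|g y| <= M) ->
  (forall y, ~ box x r y -> g y = 0) ->
  `|\int[lebesgue_rV]_y g y| <= M * (2 * r) ^+ n.
Proof.
move=> r0 mg gM g0; have ig := integrable_box_bounded r0 mg gM g0.
apply: le_trans (le_normr_Rintegral measurableT ig) _.
rewrite -(Rintegral_box_cst x M r0); apply: le_Rintegral => //.
- exact: integrable_norm.
- exact: integrable_box_cst.
move=> y _; rewrite indicE.
case: (boolP (y \in box x r)) => h; first by rewrite mulr1.
by rewrite g0 ?normr0 ?mulr0//; move: h; rewrite notin_setE.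
Qed.

Lemma integrableC_box_bounded (g : 'rV[R]_n -> R[i]) x (r M : R) : 0 <= r ->
  cmeasurable g -> (forall y, norm1 (g y) <= M) ->
  (forall y, ~ box x r y -> g y = 0) -> integrableC lebesgue_rV g.
Proof.
move=> r0 [mr mi] gM g0; split.
  apply: (@integrable_box_bounded _ x r M r0 mr (fun y => le_trans (norm1_Re _) (gM y))).
  by move=> y yb; rewrite g0.
apply: (@integrable_box_bounded _ x r M r0 mi (fun y => le_trans (norm1_Im _) (gM y))).
by move=> y yb; rewrite g0.
Qed.

End compactly_supported_integrals.

Section schwartz_class.
Context {R : realType} {n : nat}.
Implicit Types (phi : 'rV[R]_n -> R[i]) (x : 'rV[R]_n).

Lemma normc_real (t : R) : normc t%:C%C = `|t|.
Proof. by rewrite normc_sqrtE /= expr0n addr0 sqrtr_sqr. Qed.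

Lemma schwartz_cmeasurable phi : schwartz phi -> cmeasurable phi.
Proof.
by case=> -[h1 h2] _; split; apply: continuous_measurable_rV; [exact: (h1 [::]).1|exact: (h2 [::]).1].
Qed.

(** Expanding the product of the 1 + x_i^2 into monomials bounds it by finitely
    many Schwartz seminorms. *)
Lemma schwartz_weight phi : schwartz phi ->
  exists M, forall x, norm1 (phi x) <= M * weight x.
Proof.
move=> [_ sp].
pose a (f : {ffun 'I_n -> bool}) : multiindex n := [ffun i => (2 * f i)%N].
have /choice[M MP] f := sp (a f) (finfun (fun=> 0%N)).
exists (2 * \sum_f M f) => x.
pose P := \prod_i (1 + x ord0 i ^+ 2).
have P0 : 0 < P by apply: prodr_gt0 => i _; rewrite ltr_pwDl// sqr_ge0.
have WE : weight x = P^-1 by rewrite /weight prodfV.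
apply: le_trans (norm1_le_normc _) _.
rewrite WE -mulrA ler_pM2l// ler_pdivlMr//.
have PE : P = \sum_(f : {ffun 'I_n -> bool}) mpow x (a f).
  rewrite /P (eq_bigr (fun i => \sum_(b : bool) x ord0 i ^+ (2 * b))).
    rewrite bigA_distr_bigA; apply: eq_bigr => f _.
    by apply: eq_bigr => i _; rewrite ffunE.
  by move=> i _; rewrite big_bool /= muln1 muln0 expr0 addrC.
rewrite PE mulr_sumr; apply: ler_sum => f _.
have := MP f x; rewrite mderive_cmderive0 normcM normc_real mulrC; apply: le_trans.
by rewrite ler_wpM2l ?normc_nneg// ler_norm.
Qed.

Lemma weight_le1 x : weight x <= 1.
Proof.
rewrite -(@expr1n R #|'I_n|) -prodr_const; apply: ler_prod => i _.
by rewrite invr_ge0 invf_le1 ?addr_ge0 ?sqr_ge0 ?ltr_pwDl ?lerDl ?sqr_ge0.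
Qed.

Lemma schwartz_integrableC phi : schwartz phi -> integrableC lebesgue_rV phi.
Proof.
move=> sp; have [M MP] := schwartz_weight sp.
apply: (le_integrableC (schwartz_cmeasurable sp) _ MP).
apply: (@integrableZl _ _ _ lebesgue_rV _ _ M (fun y => (weight y)%:E)) => //.
exact: integrable_weight.
Qed.

Lemma schwartz_bounded phi : schwartz phi -> exists M, forall x, norm1 (phi x) <= M.
Proof.
move=> sp; have [M MP] := schwartz_weight sp; exists M => x.
apply: le_trans (MP x) _; rewrite -[leRHS]mulr1.
have M0 : 0 <= M.
  have w0 : 0 < weight x.
    by apply: prodr_gt0 => i _; rewrite invr_gt0 ltr_pwDl// sqr_ge0.
  by rewrite -(pmulr_lge0 _ w0) (le_trans _ (MP x))// norm1_ge0.
by rewrite ler_wpM2l// weight_le1.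
Qed.

End schwartz_class.

(** * Littlewood-Paley blocks of integrable functions *)

Section lipschitz.
Context {R : realType}.

Lemma lipschitz_of_derive (f df : R -> R) :
  (forall x, is_derive x (1 : R) f (df x)) -> (forall x, `|df x| <= 1) ->
  forall s t, `|f s - f t| <= `|s - t|.
Proof.
move=> fd df1.
have H s t : s < t -> `|f s - f t| <= `|s - t|.
  move=> st; have cf : {within `[s, t], continuous f}.
    apply: continuous_subspaceT => x.
    by apply/differentiable_continuous/derivable1_diffP; case: (fd x).
  have [c _ e] := MVT st (fun x _ => fd x) cf.
  by rewrite distrC e normrM [leRHS]distrC ler_piMl.
move=> s t; have [st|ts|->] := ltgtP s t; first exact: H.
  by rewrite distrC [leRHS]distrC; exact: H.
by rewrite !subrr.
Qed.

Lemma cos_lipschitz (s t : R) : `|cos s - cos t| <= `|s - t|.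
Proof.
apply: (@lipschitz_of_derive cos (fun x => - sin x)) => x.
by rewrite normrN ler_norml sin_geN1 sin_le1.
Qed.

Lemma sin_lipschitz (s t : R) : `|sin s - sin t| <= `|s - t|.
Proof.
apply: (@lipschitz_of_derive sin (@cos R)) => x.
by rewrite ler_norml cos_geN1 cos_le1.
Qed.

Lemma cis2pi_lipschitz (s t : R) :
  norm1 (cis2pi s - cis2pi t) <= 4 * pi * `|s - t|.
Proof.
rewrite /norm1 cReB cImB /=.
have h := cos_lipschitz (2 * pi * s) (2 * pi * t).
have h' := sin_lipschitz (2 * pi * s) (2 * pi * t).
have E : `|2 * pi * s - 2 * pi * t| = 2 * pi * `|s - t|.
  by rewrite -mulrBr normrM gtr0_norm// mulr_gt0// pi_gt0.
by rewrite E in h h'; lra.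
Qed.

Lemma continuous_of_lipschitz (V : normedModType R) (F : V -> R) (L : R) :
  (forall x y, `|F x - F y| <= L * `|x - y|) -> continuous F.
Proof.
move=> FL x; apply/cvgrPdist_lt => e e0.
have L0 : 0 < `|L| + 1 by rewrite ltr_wpDl.
near=> y.
apply: (@le_lt_trans _ _ ((`|L| + 1) * `|x - y|)).
  by rewrite (le_trans (FL x y))// ler_wpM2r// (le_trans (ler_norm L))// lerDl.
rewrite mulrC -ltr_pdivlMr//; near: y.
by apply/nbhs_normP; exists (e / (`|L| + 1)); [exact: divr_gt0|].
Unshelve. all: end_near. Qed.

Lemma mx_norm_coord n (x : 'rV[R]_n) i : `|x ord0 i| <= `|x|.
Proof.
rewrite [leRHS]/Num.Def.normr/= mx_normrE.
by apply: (le_bigmax _ (fun ij : 'I_1 * 'I_n => `|x ij.1 ij.2|) (ord0, i)).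
Qed.

Lemma mx_norm_box n (x : 'rV[R]_n) (r : R) : 0 <= r -> (`|x| <= r) = `[< box 0 r x >].
Proof.
move=> r0; apply/idP/asboolP => [xr i|xr].
  by rewrite mxE subr0 (le_trans (mx_norm_coord _ _)).
rewrite [leLHS]/Num.Def.normr/= mx_normrE; apply: bigmax_le => //= -[i j] _ /=.
by rewrite ord1; have := xr j; rewrite mxE subr0.
Qed.

Lemma dotp_le n (x y : 'rV[R]_n) (r : R) : box 0 r y ->
  `|dotp x y| <= n%:R * r * `|x|.
Proof.
move=> yr; rewrite /dotp (le_trans (ler_norm_sum _ _ _))//.
have -> : n%:R * r * `|x| = \sum_(i < n) r * `|x|.
  by rewrite sumr_const card_ord -[RHS]mulr_natl mulrA.
apply: ler_sum => i _; rewrite normrM mulrC ler_pM//; last exact: mx_norm_coord.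
by have := yr i; rewrite mxE subr0.
Qed.

Lemma dotpBl n (x x' y : 'rV[R]_n) : dotp (x - x') y = dotp x y - dotp x' y.
Proof.
rewrite /dotp -sumrB; apply: eq_bigr => i _; by rewrite !mxE mulrBl.
Qed.

End lipschitz.

Lemma ccontinuousZ {R : realType} n (c : R[i]) (h : 'rV[R]_n -> R[i]) :
  ccontinuous h -> ccontinuous (fun x => c * h x).
Proof.
move=> [hr hi]; split.
  rewrite (_ : (fun x => complex.Re (c * h x)) =
    (fun x => complex.Re c * complex.Re (h x) - complex.Im c * complex.Im (h x))).
    move=> x; apply: (@continuousB _ _ _ (fun x : 'rV[R]_n => complex.Re c * complex.Re (h x))
      (fun x => complex.Im c * complex.Im (h x)) x).
      by apply: (@continuousM _ _ (fun=> complex.Re c) _ x); [exact: cst_continuous|exact: hr].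
    by apply: (@continuousM _ _ (fun=> complex.Im c) _ x); [exact: cst_continuous|exact: hi].
  by apply/funext => x; rewrite cReM.
rewrite (_ : (fun x => complex.Im (c * h x)) =
  (fun x => complex.Re c * complex.Im (h x) + complex.Im c * complex.Re (h x))).
  move=> x; apply: (@continuousD _ _ _ (fun x : 'rV[R]_n => complex.Re c * complex.Im (h x))
    (fun x => complex.Im c * complex.Re (h x)) x).
    by apply: (@continuousM _ _ (fun=> complex.Re c) _ x); [exact: cst_continuous|exact: hi].
  by apply: (@continuousM _ _ (fun=> complex.Im c) _ x); [exact: cst_continuous|exact: hr].
by apply/funext => x; rewrite cImM.
Qed.

Section fourier_integrals.
Context {R : realType} {n : nat}.
Implicit Types (g : 'rV[R]_n -> R[i]) (x y xi : 'rV[R]_n).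

(** Lipschitz, because the frequencies are bounded. *)
Lemma inv_fourier_continuous g (r : R) : integrableC lebesgue_rV g ->
  (forall y, ~ box 0 r y -> g y = 0) -> ccontinuous (inv_fourier g).
Proof.
move=> ig g0.
pose I := \int[lebesgue_rV]_y norm1 (g y).
have in1 : lebesgue_rV.-integrable setT (EFin \o (fun y => norm1 (g y))).
  exact: integrableC_norm1.
have igc x : integrableC lebesgue_rV (fun y => g y * cis2pi (dotp x y)).
  exact: integrableC_cis ig (measurable_dotp x).
have key x x' : norm1 (inv_fourier g x - inv_fourier g x') <= I * (4 * pi * (n%:R * r)) * `|x - x'|.
  have -> : inv_fourier g x - inv_fourier g x' =
      integralC lebesgue_rV (fun y => g y * (cis2pi (dotp x y) - cis2pi (dotp x' y))).
    have -> : (fun y => g y * (cis2pi (dotp x y) - cis2pi (dotp x' y))) =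
       (fun y => g y * cis2pi (dotp x y) + (-1) * (g y * cis2pi (dotp x' y))).
      by apply/funext => y; rewrite mulrBr mulN1r.
    rewrite (integralCD (igc x) (integrableCZ (-1) (igc x'))).
    by rewrite (integralCZ (-1) (igc x')) mulN1r.
  have id : integrableC lebesgue_rV (fun y => g y * (cis2pi (dotp x y) - cis2pi (dotp x' y))).
    apply: (integrableC_bounded ig (M := 4)).
      have [a b] := cmeasurable_cis (measurable_dotp x).
      have [c d] := cmeasurable_cis (measurable_dotp x').
      split.
        by under eq_fun do rewrite cReB; exact: measurable_funB.
      by under eq_fun do rewrite cImB; exact: measurable_funB.
    move=> y; rewrite /norm1 cReB cImB.
    have := norm1_cis2pi (dotp x y); have := norm1_cis2pi (dotp x' y).
    rewrite /norm1 => h1 h2.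
    have := ler_normB (complex.Re (cis2pi (dotp x y))) (complex.Re (cis2pi (dotp x' y))).
    have := ler_normB (complex.Im (cis2pi (dotp x y))) (complex.Im (cis2pi (dotp x' y))).
    lra.
  apply: le_trans (norm1_integralC id) _.
  have -> : I * (4 * pi * (n%:R * r)) * `|x - x'| =
      \int[lebesgue_rV]_y ((4 * pi * (n%:R * r) * `|x - x'|) * norm1 (g y)).
    by rewrite RintegralZl// -/I; ring.
  apply: le_Rintegral => //.
  - exact: integrableC_norm1 id.
  - exact: (@integrableZl _ _ _ lebesgue_rV _ measurableT _ (fun y => (norm1 (g y))%:E) in1).
  move=> y _; have [yb|yb] := pselect (box 0 r y); last first.
    by rewrite g0// mul0r norm1_0 mulr0.
  rewrite (le_trans (norm1M _ _))// mulrC ler_wpM2r ?norm1_ge0//.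
  rewrite (le_trans (cis2pi_lipschitz _ _))// -dotpBl -!mulrA ler_pM2l//.
  by rewrite ler_wpM2l ?pi_ge0// mulrA dotp_le.
split; apply: continuous_of_lipschitz => x x'.
  by rewrite -cReB; exact: le_trans (norm1_Re _) (key x x').
by rewrite -cImB; exact: le_trans (norm1_Im _) (key x x').
Qed.

Definition distr_of (f : 'rV[R]_n -> R[i]) : functional R n :=
  fun phi => cintegral (fun x => f x * phi x).

Lemma distr_integrable (f phi : 'rV[R]_n -> R[i]) :
  integrableC lebesgue_rV f -> schwartz phi ->
  integrableC lebesgue_rV (fun x => f x * phi x).
Proof.
move=> fi sp; have [M MP] := schwartz_bounded sp.
exact: integrableC_bounded fi (schwartz_cmeasurable sp) MP.
Qed.

Lemma distr_tempered (f : 'rV[R]_n -> R[i]) : integrableC lebesgue_rV f ->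
  tempered (distr_of f).
Proof.
move=> fi; split.
  move=> c p1 p2 s1 s2; rewrite /distr_of.
  have i1 := distr_integrable fi s1; have i2 := distr_integrable fi s2.
  rewrite -[LHS]/(integralC lebesgue_rV _).
  have -> : (fun x => f x * (c * p1 x + p2 x)) = (fun x => c * (f x * p1 x) + f x * p2 x).
    by apply/funext => x; rewrite mulrDr mulrCA.
  by rewrite (integralCD (integrableCZ c i1) i2) (integralCZ c i1).
move=> phi0 e s0 e0; pose I := \int[lebesgue_rV]_y norm1 (f y).
have I0 : 0 <= I by apply: Rintegral_ge0 => y _; exact: norm1_ge0.
have in1 : lebesgue_rV.-integrable setT (EFin \o (fun y => norm1 (f y))).
  exact: integrableC_norm1.
exists 0%N, (e / (2 * (I + 1))); split.
  by rewrite divr_gt0// mulr_gt0// ltr_wpDl.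
move=> phi sp /(_ (finfun (fun=> 0%N)) (finfun (fun=> 0%N))).
rewrite msize0 => /(_ isT isT) H.
have {}H x : norm1 (phi x - phi0 x) <= 2 * (e / (2 * (I + 1))).
  apply: le_trans (norm1_le_normc _) _; rewrite ler_pM2l//.
  by have := H x; rewrite mpow0 mul1r mderive_cmderive0.
have i1 := distr_integrable fi sp; have i2 := distr_integrable fi s0.
have i3 : integrableC lebesgue_rV (fun x => f x * (phi x - phi0 x)).
  have -> : (fun x => f x * (phi x - phi0 x)) = (fun x => f x * phi x + (-1) * (f x * phi0 x)).
    by apply/funext => x; rewrite mulrBr mulN1r.
  exact: integrableCD i1 (integrableCZ (-1) i2).
have -> : distr_of f phi - distr_of f phi0 =
    integralC lebesgue_rV (fun x => f x * (phi x - phi0 x)).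
  have -> : (fun x => f x * (phi x - phi0 x)) = (fun x => f x * phi x + (-1) * (f x * phi0 x)).
    by apply/funext => x; rewrite mulrBr mulN1r.
  by rewrite (integralCD i1 (integrableCZ (-1) i2)) (integralCZ (-1) i2) mulN1r.
apply: le_trans (normc_le_norm1 _) _; apply: le_trans (norm1_integralC i3) _.
apply: (@le_trans _ _ (\int[lebesgue_rV]_y (e / (I + 1) * norm1 (f y)))).
  apply: le_Rintegral => //.
  - exact: integrableC_norm1 i3.
  - exact: (@integrableZl _ _ _ lebesgue_rV _ measurableT _ (fun y => (norm1 (f y))%:E) in1).
  move=> y _; rewrite (le_trans (norm1M _ _))// mulrC ler_wpM2r ?norm1_ge0//.
  apply: le_trans (H y) _; apply: le_of_eq.
  by field; rewrite gt_eqF// ltr_wpDl.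
rewrite RintegralZl// -/I -mulrA ler_piMr ?ltW//.
by rewrite mulrC ltr_pdivrMr ?mul1r ?ltrDl// ltr_wpDl.
Qed.

End fourier_integrals.

Section uniqueness.
Context {R : realType} {n : nat} (psi : nat -> 'rV[R]_n -> R[i]).
Hypothesis psiP : LP_partition psi.

(** Near a point where d is positive, a small enough bump sees only positive
    values of d. *)
Lemma continuous_eq0 (d : 'rV[R]_n -> R) : continuous d ->
  (forall a m, 0 < m ->
    lebesgue_rV.-integrable setT (fun x => (d x * lp_bump psi a m x)%:E) /\
    \int[lebesgue_rV]_x (d x * lp_bump psi a m x) = 0) ->
  forall x, d x = 0.
Proof.
have H (f : 'rV[R]_n -> R) (y : 'rV[R]_n) : continuous f -> (forall a m, 0 < m ->
    lebesgue_rV.-integrable setT (fun x => (f x * lp_bump psi a m x)%:E) /\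
    \int[lebesgue_rV]_x (f x * lp_bump psi a m x) = 0) -> ~ 0 < f y.
  move=> cf fi fy0.
  have /nbhs_ballP[e /= e0 he] : nbhs y [set z | f y / 2 < f z].
    have : nbhs (f y) [set t | f y / 2 < t].
      apply: open_nbhs_nbhs; split; first exact: open_gt.
      by rewrite /= ltr_pdivrMr// mulr2n mulrDr mulr1 ltrDl.
    exact: cf.
  pose m := 4 / e; have m0 : 0 < m by rewrite divr_gt0.
  have sm : 2 / m = e / 2 by rewrite /m; field; rewrite gt_eqF.
  pose r := m^-1 / n.+1%:R; have r0 : 0 < r by rewrite divr_gt0// invr_gt0.
  have [i1 e1] := fi y m m0.
  have big x : box y (2 / m) x -> f y / 2 < f x.
    move=> xb; apply: he; split => // i j; rewrite ord1.
    have := xb j; rewrite sm /ball/= distrC => h.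
    by apply: le_lt_trans h _; rewrite ltr_pdivrMr// mulr2n mulrDr mulr1 ltrDl.
  have : \int[lebesgue_rV]_x (f y / 2 * \1_(box y r) x) <= 0.
    rewrite -e1; apply: le_Rintegral => //.
      exact: integrable_box_cst (ltW r0).
    move=> x _; rewrite indicE; case: (boolP (x \in box y r)) => h.
      rewrite (lp_bump1 psiP m0) ?mulr1; last by rewrite inE in h.
      apply/ltW/big => i; move: h; rewrite inE => /(_ i) h; apply: le_trans h _.
      rewrite /r [leLHS]mulrC ler_pM2r ?invr_gt0//.
      by rewrite (@le_trans _ _ 1)// ?invf_le1 ?ltr0n// ler1n.
    rewrite mulr0; have [hb|hb] := pselect (box y (2 / m) x).
      by rewrite mulr_ge0 ?lp_bump_ge0// ltW// (lt_trans _ (big _ hb))// divr_gt0.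
    by rewrite (lp_bump_support psiP m0 hb) mulr0.
  rewrite (Rintegral_box_cst _ _ (ltW r0)) leNgt.
  by rewrite mulr_gt0 ?divr_gt0// exprn_gt0// mulr_gt0.
move=> cd di x; apply/eqP; rewrite eq_le; apply/andP; split.
  by rewrite leNgt; apply/negP; exact: H cd di.
rewrite leNgt; apply/negP => dx.
apply: (H (fun z => - d z) x); last by rewrite oppr_gt0.
  by move=> z; apply: continuousN; exact: cd.
move=> a m m0; have [i1 e1] := di a m m0.
have E : (fun z => - d z * lp_bump psi a m z) = (fun z => (-1) * (d z * lp_bump psi a m z)).
  by apply/funext => z; ring.
split.
  rewrite -[X in _.-integrable _ X]/(EFin \o (fun z => - d z * lp_bump psi a m z)) E.
  exact: (@integrableZl _ _ _ lebesgue_rV _ measurableT _ (fun y => (d y * lp_bump psi a m y)%:E) i1).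
by rewrite E RintegralZl// e1 mulr0.
Qed.

(** Identifies the function that LPblock selects. *)
Lemma represents_unique (u : functional R n) g g' :
  ccontinuous g -> ccontinuous g' -> represents g u -> represents g' u -> g = g'.
Proof.
move=> [gr gi] [gr' gi'] hg hg'.
have key (F : R[i] -> R) : (forall z w, F (z - w) = F z - F w) ->
    continuous (F \o g) -> continuous (F \o g') ->
    (forall a m, 0 < m ->
      [/\ lebesgue_rV.-integrable setT (fun x => (F (g x) * lp_bump psi a m x)%:E),
          lebesgue_rV.-integrable setT (fun x => (F (g' x) * lp_bump psi a m x)%:E) &
          \int[lebesgue_rV]_x (F (g x) * lp_bump psi a m x) =
          \int[lebesgue_rV]_x (F (g' x) * lp_bump psi a m x)]) ->
    forall x, F (g x) = F (g' x).
  move=> FB c c' h x; apply/eqP; rewrite -subr_eq0; apply/eqP.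
  apply: (@continuous_eq0 (fun x => F (g x) - F (g' x))).
    by move=> z; apply: (@continuousB _ _ _ (F \o g) (F \o g') z); [exact: c|exact: c'].
  move=> a m m0; have [i1 i2 e] := h a m m0.
  have E : (fun x => (F (g x) - F (g' x)) * lp_bump psi a m x) =
    (fun x => F (g x) * lp_bump psi a m x - F (g' x) * lp_bump psi a m x).
    by apply/funext => z; rewrite mulrBl.
  split.
    rewrite -[X in _.-integrable _ X]/(EFin \o (fun x => (F (g x) - F (g' x)) * lp_bump psi a m x)) E.
    exact: (integrableB measurableT i1 i2).
  by rewrite E RintegralB// e subrr.
have sb a m : 0 < m -> schwartz (fun x => (lp_bump psi a m x)%:C%C).
  move=> m0; apply: (smooth_compact_schwartz (lp_bump_smooth psiP a m)) => y.
  exact: (lp_bump_support psiP m0).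
have ReE z (t : R) : complex.Re (z * t%:C%C) = complex.Re z * t.
  by rewrite cReM /= mulr0 subr0.
have ImE z (t : R) : complex.Im (z * t%:C%C) = complex.Im z * t.
  by rewrite cImM /= mulr0 add0r.
have rw (h : 'rV[R]_n -> R[i]) (a : 'rV[R]_n) (m : R) :
   (fun x => complex.Re (h x * (lp_bump psi a m x)%:C%C)) = (fun x => complex.Re (h x) * lp_bump psi a m x).
  by apply/funext => x; rewrite ReE.
have iw (h : 'rV[R]_n -> R[i]) (a : 'rV[R]_n) (m : R) :
   (fun x => complex.Im (h x * (lp_bump psi a m x)%:C%C)) = (fun x => complex.Im (h x) * lp_bump psi a m x).
  by apply/funext => x; rewrite ImE.
apply/funext => x; apply: complexP.
  apply: (key (@complex.Re R)) => //; first exact: cReB.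
  move=> a m m0; have [[i1 _] e1] := hg _ (sb a m m0); have [[i2 _] e2] := hg' _ (sb a m m0).
  rewrite -[X in _.-integrable _ X]/(EFin \o (fun y => complex.Re (g y * (lp_bump psi a m y)%:C%C))) rw in i1.
  rewrite -[X in _.-integrable _ X]/(EFin \o (fun y => complex.Re (g' y * (lp_bump psi a m y)%:C%C))) rw in i2.
  split => //; move: (etrans (esym e1) e2) => /(congr1 (@complex.Re R)) /=.
  by rewrite rw rw.
apply: (key (@complex.Im R)) => //; first exact: cImB.
move=> a m m0; have [[_ i1] e1] := hg _ (sb a m m0); have [[_ i2] e2] := hg' _ (sb a m m0).
rewrite -[X in _.-integrable _ X]/(EFin \o (fun y => complex.Im (g y * (lp_bump psi a m y)%:C%C))) iw in i1.
rewrite -[X in _.-integrable _ X]/(EFin \o (fun y => complex.Im (g' y * (lp_bump psi a m y)%:C%C))) iw in i2.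
split => //; move: (etrans (esym e1) e2) => /(congr1 (@complex.Im R)) /=.
by rewrite iw iw.
Qed.

(** Littlewood-Paley blocks of an integrable function whose Fourier transform
    is known: two applications of the multiplication formula bring the
    multiplier onto that transform, without any inversion theorem. *)
Lemma LPblock_distr (f G : 'rV[R]_n -> R[i]) (c : R[i]) (M : R) k :
  integrableC lebesgue_rV f -> cmeasurable G -> (forall x, norm1 (G x) <= M) ->
  (forall xi, fourier f xi = c * G xi) ->
  LPblock psi k (distr_of f) = fun x => c * inv_fourier (fun xi => psi k xi * G xi) x.
Proof.
move=> fi mG GM fE.
have [N NP] := LP_bounded psiP.
have rk : 0 <= 2 ^+ k.+1 :> R by rewrite exprn_ge0.
have ipsi : integrableC lebesgue_rV (psi k).
  exact: integrableC_box_bounded rk (LP_cmeasurable psiP k) (NP k) (LP_support psiP (k:=k)).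
have ipG : integrableC lebesgue_rV (fun xi => psi k xi * G xi).
  exact: integrableC_bounded ipsi mG GM.
pose g x := c * inv_fourier (fun xi => psi k xi * G xi) x.
have cg : ccontinuous g.
  have [|c1 c2] := inv_fourier_continuous ipG (r := 2 ^+ k.+1).
    by move=> y yb; rewrite (LP_support psiP yb) mul0r.
  exact: ccontinuousZ (conj c1 c2).
have rg : represents g (dinv_fourier (dmul (psi k) (dfourier (distr_of f)))).
  move=> phi sp; have ip := schwartz_integrableC sp.
  have cis1 (h : 'rV[R]_n -> R[i]) x : inv_fourier h x =
      integralC lebesgue_rV (fun y => h y * cis2pi (1 * dotp x y)).
    by rewrite /inv_fourier -[LHS]/(integralC lebesgue_rV _); under eq_fun do rewrite -[dotp _ _]mul1r.
  have cisN (h : 'rV[R]_n -> R[i]) x : fourier h x =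
      integralC lebesgue_rV (fun y => h y * cis2pi (-1 * dotp x y)).
    rewrite /fourier -[LHS]/(integralC lebesgue_rV _); congr integralC.
    by apply/funext => y; rewrite mulN1r dotpC.
  have cisN' (h : 'rV[R]_n -> R[i]) x : fourier h x =
      integralC lebesgue_rV (fun y => h y * cis2pi (-1 * dotp y x)).
    by rewrite cisN; congr integralC; apply/funext => y; rewrite dotpC.
  have cis1' (h : 'rV[R]_n -> R[i]) x : inv_fourier h x =
      integralC lebesgue_rV (fun y => h y * cis2pi (1 * dotp y x)).
    by rewrite cis1; congr integralC; apply/funext => y; rewrite dotpC.
  pose H xi := psi k xi * inv_fourier phi xi.
  have [_ iH _] := multiplication_formula 1 ip ipsi.
  have {}iH : integrableC lebesgue_rV H.
    have EH : H = (fun y => psi k y * integralC lebesgue_rV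
        (fun x => phi x * cis2pi (1 * dotp x y))).
      by apply/funext => y; rewrite /H cis1'.
    by rewrite EH.
  have [_ _ e1] := multiplication_formula (-1) fi iH.
  have [i2 _ e2] := multiplication_formula 1 ip ipG.
  have E1 : (fun x => g x * phi x) = (fun x => c * (phi x *
       integralC lebesgue_rV (fun y => psi k y * G y * cis2pi (1 * dotp x y)))).
    by apply/funext => x; rewrite /g cis1; ring.
  split; first by rewrite E1; exact: (integrableCZ c i2).
  rewrite E1 -[RHS]/(integralC lebesgue_rV _) (integralCZ c i2) e2.
  rewrite -[LHS]/(integralC lebesgue_rV (fun x => f x * fourier H x)).
  have -> : (fun x => f x * fourier H x) = (fun x => f x *
      integralC lebesgue_rV (fun y => H y * cis2pi (-1 * dotp x y))).
    by apply/funext => x; rewrite cisN.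
  rewrite e1.
  have -> : (fun y => H y * integralC lebesgue_rV (fun x => f x * cis2pi (-1 * dotp x y))) =
    (fun y => c * (psi k y * G y * integralC lebesgue_rV (fun x => phi x * cis2pi (1 * dotp x y)))).
    by apply/funext => y; rewrite -cisN' fE /H cis1'; ring.
  have [_ i2' _] := multiplication_formula 1 ip ipG.
  exact: (integralCZ c i2').
have [h1 h2] := @xgetI _ (fun=> 0) [set g | ccontinuous g /\
    represents g (dinv_fourier (dmul (psi k) (dfourier (distr_of f))))] g (conj cg rg).
exact: represents_unique h1 cg h2 rg.
Qed.

End uniqueness.

(** * The Fejer kernel *)

Section line_integrals.
Context {R : realType}.
Local Notation mu := (@lebesgue_measure R).

Lemma ge0_integral_scale (f : R -> \bar R) (a : R) : 0 < a ->
  measurable_fun setT f -> (forall x, 0 <= f x)%E ->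
  (\int[mu]_x f (a * x)%R = (a^-1)%:E * \int[mu]_x f x)%E.
Proof.
move=> a0 mf f0.
have ma : measurable_fun setT (fun t : measurableTypeR R => (a * t)%R : measurableTypeR R).
  exact: measurable_funM.
have a0' : 0 <= a by exact: ltW.
have key : (\int[mu]_x f x = a%:E * \int[mu]_x f (a * x)%R)%E.
  pose M : {measure set (measurableTypeR R) -> \bar R} :=
    measure_function_pushforward__canonical__measure_function_Measure mu ma.
  transitivity (\int[mscale (NngNum a0') M]_x f x)%E.
    apply: eq_measure_integral => A mA _.
    apply: lebesgue_measure_unique => //= _ [[b c]] _ <-.
    rewrite /mscale/= /M /= /pushforward (_ : _ @^-1` _ = `](b / a), (c / a)]%classic); last first.
      apply/seteqP; split=> t /=; rewrite !in_itv/= ltr_pdivrMr// ler_pdivlMr//.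
        by rewrite mulrC.
      by rewrite mulrC.
    rewrite /= !lebesgue_measure_itv/= !lte_fin ltr_pM2r ?invr_gt0//.
    case: ifPn => _; last by rewrite mule0.
    by rewrite -!EFinB -EFinM; congr EFin; field; rewrite gt_eqF.
  rewrite ge0_integral_mscale//; congr (_ * _)%E.
  by rewrite ge0_integral_pushforward.
by rewrite key muleA -EFinM mulVf ?gt_eqF// mul1e.
Qed.

Lemma ge0_integral_opp (f : R -> \bar R) :
  measurable_fun setT f -> (forall x, 0 <= f x)%E ->
  (\int[mu]_x f (- x)%R = \int[mu]_x f x)%E.
Proof.
move=> mf f0.
transitivity (\int[pushforward mu (-%R : measurableTypeR R -> measurableTypeR R)]_t f t)%E.
  rewrite ge0_integral_pushforward//; exact: measurable_oppr.
by apply: eq_measure_integral => A mA _; exact: lebesgue_measureN.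
Qed.

Lemma Rintegral_opp (g : R -> R) : measurable_fun setT g ->
  \int[mu]_x g (- x) = \int[mu]_x g x.
Proof.
move=> mg; rewrite /Rintegral; congr fine.
have mg' : measurable_fun setT (EFin \o g) by exact/measurable_EFinP.
rewrite [LHS]integralE [RHS]integralE; congr (_ - _)%E.
- rewrite -[RHS]ge0_integral_opp//; last exact: measurable_funepos.
  by apply: eq_integral => x _; rewrite !funeposE.
- rewrite -[RHS]ge0_integral_opp//; last exact: measurable_funeneg.
  by apply: eq_integral => x _; rewrite !funenegE.
Qed.

Lemma Rintegral_odd (g : R -> R) : measurable_fun setT g ->
  mu.-integrable setT (EFin \o g) -> (forall x, g (- x) = - g x) -> \int[mu]_x g x = 0.
Proof.
move=> mg ig og; have := Rintegral_opp mg.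
have -> : \int[mu]_x g (- x) = - \int[mu]_x g x.
  rewrite (@eq_Rintegral _ _ _ mu setT (fun x => (-1) * g x)); last by move=> x _; rewrite og mulN1r.
  by rewrite RintegralZl// mulN1r.
by move=> h; lra.
Qed.

(** The Fejer kernel, up to normalisation: its Fourier transform is a triangle. *)
Definition fejer (a x : R) : R := (1 - cos (2 * pi * (a * x))) / x ^+ 2.

Lemma fejer_ge0 a x : 0 <= fejer a x.
Proof. by rewrite divr_ge0 ?sqr_ge0// subr_ge0 cos_le1. Qed.

Lemma one_minus_cos_le (y : R) : 1 - cos y <= y ^+ 2 / 2.
Proof.
have -> : y = (y / 2) *+ 2 by rewrite -mulr_natr; field.
set z := y / 2; rewrite cos_mulr2n cos2sin2.
have h : `|sin z| <= `|z| by have := sin_lipschitz z 0; rewrite sin0 !subr0.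
have : sin z ^+ 2 <= z ^+ 2.
  by rewrite -(real_normK (num_real (sin z))) -(real_normK (num_real z)) ler_sqr ?nnegrE.
have -> : 1 - ((1 - sin z ^+ 2) *+ 2 - 1) = 2 * sin z ^+ 2 by ring.
have -> : (z *+ 2) ^+ 2 / 2 = 2 * z ^+ 2 by field.
by move=> h2; rewrite ler_pM2l.
Qed.

Lemma fejer_le a x : fejer a x <= (2 + 2 * pi ^+ 2 * a ^+ 2) * (1 + x ^+ 2)^-1.
Proof.
have p : 0 < 1 + x ^+ 2 by rewrite ltr_pwDl// sqr_ge0.
rewrite ler_pdivlMr// /fejer; have [->|x0] := eqVneq x 0.
  by rewrite expr0n invr0 mulr0 mul0r addr_ge0// mulr_ge0 ?sqr_ge0// mulr_ge0 ?sqr_ge0.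
have x2 : 0 < x ^+ 2 by rewrite lt0r sqrf_eq0 x0 sqr_ge0.
rewrite mulrAC ler_pdivrMr// mulrDr mulr1 [leRHS]mulrDl addrC lerD//.
  rewrite mulrC mulrC ler_wpM2r ?sqr_ge0//.
  by have := cos_geN1 (2 * pi * (a * x)); lra.
apply: le_trans (one_minus_cos_le _) _.
by apply: le_of_eq; field.
Qed.

Lemma measurable_invr : measurable_fun [set: R] (fun x : R => x^-1).
Proof.
have m0 : measurable [set (0 : R)] by exact: measurable_set1.
rewrite -(setvU [set (0 : R)]); apply/measurable_funU => //; first exact: measurableC.
split; last exact: measurable_fun_set1.
apply: open_continuous_measurable_fun.
  by rewrite (_ : [set~ 0] = [set x | x != 0]); [exact: open_neq|apply/seteqP; split => x /= /eqP].
by move=> x; rewrite inE/= => /eqP x0; exact: inv_continuous.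
Qed.

Lemma measurable_fejer a : measurable_fun setT (fejer a).
Proof.
have c : measurable_fun [set: R] (fun x : R => 1 - cos (2 * pi * (a * x))).
  apply: measurable_funB => //; apply: (measurableT_comp (@measurable_cos R)).
  by apply: measurable_funM => //; exact: measurable_funM.
apply: measurable_funM => //; apply: (measurableT_comp measurable_invr).
exact: exprn_measurable.
Qed.

Lemma integrable_fejer a : mu.-integrable setT (EFin \o fejer a).
Proof.
apply: (@le_integrable _ _ _ mu _ measurableT _
  (fun x => (2 + 2 * pi ^+ 2 * a ^+ 2)%:E * ((1 + x ^+ 2)^-1)%:E)%E).
- by apply/measurable_EFinP; exact: measurable_fejer.
- move=> x _ /=; rewrite lee_fin ger0_norm ?fejer_ge0// (le_trans (fejer_le a x))//.
  exact: ler_norm.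
- by apply: integrableZl => //; exact: integrable_invDsqr.
Qed.

Definition fejer_mass : R := \int[mu]_x fejer 1 x.

Lemma Rintegral_fejer (a : R) : \int[mu]_x fejer a x = fejer_mass * `|a|.
Proof.
have [->|a0] := eqVneq a 0.
  rewrite normr0 mulr0 (@eq_Rintegral _ _ _ mu setT (fun=> 0)); last first.
    by move=> x _; rewrite /fejer mul0r mulr0 cos0 subrr mul0r.
  by rewrite Rintegral_cst// mul0r.
pose b := `|a|; have b0 : 0 < b by rewrite normr_gt0.
have E x : fejer a x = b ^+ 2 * fejer 1 (b * x).
  rewrite /fejer mul1r exprMn; have -> : cos (2 * pi * (a * x)) = cos (2 * pi * (b * x)).
    rewrite /b; have [h|h] := leP 0 a; first by rewrite ger0_norm.
    by rewrite ltr0_norm// mulNr mulrN cosN.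
  have [->|x0] := eqVneq x 0; first by rewrite expr0n !mulr0 invr0 !mulr0.
  by field; rewrite x0 gt_eqF.
rewrite (@eq_Rintegral _ _ _ mu setT (fun x => b ^+ 2 * fejer 1 (b * x))); last by move=> x _; rewrite E.
rewrite /Rintegral /fejer_mass /Rintegral -/b.
under eq_integral do rewrite EFinM.
have m1 : measurable_fun [set: R] (EFin \o fejer 1) by apply/measurable_EFinP; exact: measurable_fejer.
rewrite ge0_integralZl//; last 3 first.
- apply/measurable_EFinP; apply: (measurableT_comp (measurable_fejer 1)).
  exact: measurable_funM.
- by move=> x _; rewrite lee_fin fejer_ge0.
- by rewrite lee_fin sqr_ge0.
rewrite (@ge0_integral_scale (EFin \o fejer 1) b b0 m1); last first.
  by move=> x; rewrite lee_fin fejer_ge0.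
have /fineK <- : (\int[mu]_x (EFin \o fejer 1) x)%E \is a fin_num.
  by apply: integrable_fin_num => //; exact: integrable_fejer.
by rewrite -!EFinM /= mulrA mulrC; congr (_ * _); field; rewrite gt_eqF.
Qed.

(** On [1/4, 3/4] the cosine is nonpositive, so the kernel is at least 1. *)
Lemma fejer_mass_gt0 : 0 < fejer_mass.
Proof.
have : \int[mu]_x \1_(`[4^-1, 3 / 4]%classic) x <= fejer_mass.
  apply: le_Rintegral => //.
  - exact: integrable_indic_itv.
  - exact: integrable_fejer.
  move=> x _; rewrite indicE; case: (boolP (x \in _)) => h; last exact: fejer_ge0.
  move: h; rewrite inE/= in_itv/= => /andP[h1 h2].
  have x0 : 0 < x by lra.
  rewrite /fejer mul1r ler_pdivlMr ?exprn_gt0// mul1r.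
  have : 0 <= cos (2 * pi * x - pi).
    have pi0 := pi_gt0 R.
    apply: cos_ge0_pihalf; apply/andP; split; nra.
  have := cosDpi (2 * pi * x - pi); rewrite subrK => -> h.
  have x1 : x ^+ 2 <= 1 by rewrite expr2; nra.
  lra.
apply: lt_le_trans; rewrite /Rintegral integral_indic// setIT.
by rewrite [X in fine X]lebesgue_measure_itv/= lte_fin ifT -?EFinB/=; lra.
Qed.

(** The positive part of a - |xi|, written as the combination of absolute
    values in which it arises as a Fourier transform. *)
Definition triangle (a xi : R) : R := `|a + xi| / 2 + `|a - xi| / 2 - `|xi|.

Lemma triangle_ge0 a xi : 0 <= triangle a xi.
Proof.
rewrite /triangle.
have : `|(a + xi) - (a - xi)| <= `|a + xi| + `|a - xi| by exact: ler_normB.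
have -> : a + xi - (a - xi) = 2 * xi by ring.
rewrite normrM gtr0_norm//; lra.
Qed.

Lemma triangle_le a xi : 0 <= a -> triangle a xi <= a.
Proof.
move=> a0; rewrite /triangle.
have := ler_normD a xi; have := ler_normB a xi; rewrite (ger0_norm a0); lra.
Qed.

Lemma triangle_out a xi : 0 <= a -> a <= `|xi| -> triangle a xi = 0.
Proof.
move=> a0; rewrite /triangle; have [h|h] := leP 0 xi.
  rewrite (ger0_norm h) => ax.
  by rewrite ger0_norm ?addr_ge0// ler0_norm ?subr_le0//; lra.
rewrite (ltr0_norm h) => ax.
by rewrite ler0_norm ?ger0_norm; lra.
Qed.

Lemma triangle_in a xi : `|xi| <= a / 2 -> a / 2 <= triangle a xi.
Proof.
move=> h; rewrite /triangle.
have := ler_norm (a + xi); have := ler_norm (a - xi); lra.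
Qed.

Lemma measurable_triangle a : measurable_fun setT (triangle a).
Proof.
apply: measurable_funB; last exact: normr_measurable.
apply: measurable_funD; apply: measurable_funM => //; apply: measurableT_comp => //.
  exact: measurable_funD.
exact: measurable_funB.
Qed.

(** Products of cosines are sums of cosines, so the Fourier transform of a
    Fejer kernel is a combination of three masses of rescaled kernels. *)
Lemma fourier_fejer a xi :
  integralC mu (fun x => (fejer a x)%:C%C * cis2pi (- (x * xi))) =
  (fejer_mass * triangle a xi)%:C%C.
Proof.
apply: complexP => /=.
  rewrite (@eq_Rintegral _ _ _ mu setT (fun x => 2^-1 * fejer (a + xi) x + 2^-1 * fejer (a - xi) x + (-1) * fejer xi x)).
    rewrite RintegralD//=; last 2 first.
    - apply: (@integrableD _ _ _ mu _ measurableT (fun x => (2^-1 * fejer (a + xi) x)%:E) (fun x => (2^-1 * fejer (a - xi) x)%:E)).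
      + exact: (@integrableZl _ _ _ mu _ measurableT 2^-1 (fun x => (fejer (a + xi) x)%:E) (integrable_fejer _)).
      + exact: (@integrableZl _ _ _ mu _ measurableT 2^-1 (fun x => (fejer (a - xi) x)%:E) (integrable_fejer _)).
    - exact: (@integrableZl _ _ _ mu _ measurableT (-1) (fun x => (fejer xi x)%:E) (integrable_fejer _)).
    rewrite RintegralD//=; last 2 first.
    - exact: (@integrableZl _ _ _ mu _ measurableT 2^-1 (fun x => (fejer (a + xi) x)%:E) (integrable_fejer _)).
    - exact: (@integrableZl _ _ _ mu _ measurableT 2^-1 (fun x => (fejer (a - xi) x)%:E) (integrable_fejer _)).
    rewrite !RintegralZl//; try exact: integrable_fejer.
    by rewrite !Rintegral_fejer /triangle; lra.
  move=> x _; rewrite mul0r subr0 mulrN cosN /fejer.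
  set A := 2 * pi * (a * x); set B := 2 * pi * (xi * x).
  have -> : 2 * pi * ((a + xi) * x) = A + B by rewrite /A /B; ring.
  have -> : 2 * pi * ((a - xi) * x) = A - B by rewrite /A /B; ring.
  have -> : 2 * pi * (x * xi) = B by rewrite /B; ring.
  by rewrite cosD cosB; set v := (x ^+ 2)^-1; field.
rewrite (@eq_Rintegral _ _ _ mu setT (fun x => fejer a x * sin (2 * pi * - (x * xi)))); last first.
  by move=> x _; rewrite mul0r addr0.
have ms : measurable_fun [set: R] (fun x : R => sin (2 * pi * - (x * xi))).
  apply: (measurableT_comp (@measurable_sin R)); apply: measurable_funM => //.
  by apply: measurable_funN; exact: measurable_funM.
apply: Rintegral_odd.
- by apply: measurable_funM => //; exact: measurable_fejer.
- apply: (@le_integrable _ _ _ mu _ measurableT _ _ _ _ (integrable_fejer a)).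
    by apply/measurable_EFinP; apply: measurable_funM => //; exact: measurable_fejer.
  move=> x _ /=; rewrite lee_fin normrM ler_piMr//.
  by rewrite ler_norml sin_geN1 sin_le1.
- move=> x; have -> : fejer a (- x) = fejer a x.
    by rewrite /fejer sqrrN mulrN mulrN cosN.
  by rewrite mulNr opprK mulrN sinN mulrN opprK.
Qed.

End line_integrals.

Section fejer_rV.
Context {R : realType} {n : nat}.
Implicit Types x xi : 'rV[R]_n.

Definition fejer_rV (a : R) x : R[i] := (\prod_i fejer a (x ord0 i))%:C%C.

Definition triangle_rV (a : R) xi : R := \prod_i triangle a (xi ord0 i).

Lemma cis2pi_sum (I : Type) (r : seq I) (f : I -> R) :
  cis2pi (\sum_(i <- r) f i) = \prod_(i <- r) cis2pi (f i).
Proof.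
elim: r => [|i r IH]; last by rewrite !big_cons cis2piD IH.
by rewrite !big_nil /cis2pi mulr0 cos0 sin0.
Qed.

Lemma integrableC_fejer_rV a : integrableC lebesgue_rV (fejer_rV a).
Proof.
split; last exact: integrable0.
exact: (@integrable_tensor _ _ (fun=> fejer a) (fun=> integrable_fejer a)).
Qed.

Lemma fourier_fejer_rV a xi :
  integralC lebesgue_rV (fun x => fejer_rV a x * cis2pi (- dotp x xi)) =
  ((@fejer_mass R) ^+ n * triangle_rV a xi)%:C%C.
Proof.
pose b (i : 'I_n) t := (fejer a t)%:C%C * cis2pi (- (t * xi ord0 i)).
have ib i : integrableC (@lebesgue_measure R) (b i).
  apply: (@integrableC_bounded _ _ _ _ _ _ 2).
  - by split; [exact: integrable_fejer|exact: integrable0].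
  - by apply: cmeasurable_cis; apply: measurable_funN; exact: measurable_funM.
  - by move=> t; exact: norm1_cis2pi.
have [_ e] := integralC_tensor ib.
transitivity (integralC lebesgue_rV (fun x : 'rV[R]_n => \prod_i b i (x ord0 i))).
  congr integralC; apply/funext => x; rewrite /b big_split/=; congr (_ * _).
    by rewrite /fejer_rV rmorph_prod.
  by rewrite -cis2pi_sum /dotp sumrN.
rewrite e (eq_bigr (fun i => (@fejer_mass R * triangle a (xi ord0 i))%:C%C)).
  by rewrite -rmorph_prod; congr (_%:C%C); rewrite big_split/= prodr_const card_ord.
by move=> i _; exact: fourier_fejer.
Qed.

End fejer_rV.

(** * Finite differences and oscillating integrals *)

Section differences.
Context {R : realType} {n : nat}.
Implicit Types (f g : 'rV[R]_n -> R) (x y : 'rV[R]_n) (i : 'I_n) (h : R).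

Definition diffop i h f : 'rV[R]_n -> R := fun x => f (shift_coord i h x) - f x.

Lemma iter_diffop_shift i h b f x :
  iter b (diffop i h) (fun y => f (shift_coord i h y)) x =
  iter b (diffop i h) f (shift_coord i h x).
Proof. by elim: b x => //= b IH x; rewrite /diffop !IH. Qed.

Lemma iter_diffopD i h b f g x :
  iter b (diffop i h) (fun y => f y + g y) x =
  iter b (diffop i h) f x + iter b (diffop i h) g x.
Proof. by elim: b x => //= b IH x; rewrite /diffop !IH; ring. Qed.

Lemma iter_diffop_affine i h b f x (a : 'rV[R]_n) (m : R) :
  iter b (diffop i h) (fun y => f (m *: (y - a))) x =
  iter b (diffop i (m * h)) f (m *: (x - a)).
Proof.
elim: b x => //= b IH x; rewrite /diffop !IH.
have -> // : m *: (shift_coord i h x - a) = shift_coord i (m * h) (m *: (x - a)).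
by rewrite /shift_coord -scalerA -scalerDr addrAC.
Qed.

Lemma measurable_iter_diffop i h b f : measurable_fun setT f ->
  measurable_fun setT (iter b (diffop i h) f).
Proof.
move=> mf; elim: b => //= b IH; apply: measurable_funB => //.
exact: measurable_comp_shift.
Qed.

Lemma shift_support i h f x (r : R) : 0 <= h ->
  (forall y, ~ box x r y -> f y = 0) ->
  forall y, ~ box x (r + h) y -> f (shift_coord i h y) = 0.
Proof.
move=> h0 f0 y yb; apply: f0 => yb'; apply: yb => j.
have := yb' j; rewrite shift_coordE => h1.
have -> : y ord0 j - x ord0 j = (y ord0 j + h * (j == i)%:R - x ord0 j) - h * (j == i)%:R by ring.
apply: le_trans (ler_normB _ _) _; rewrite lerD// normrM ger0_norm//.
by case: (j == i); rewrite ?normr1 ?normr0 ?mulr1 ?mulr0.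
Qed.

Lemma iter_diffop_support i h b f x (r : R) : 0 <= h ->
  (forall y, ~ box x r y -> f y = 0) ->
  forall y, ~ box x (r + b%:R * h) y -> iter b (diffop i h) f y = 0.
Proof.
move=> h0 f0; elim: b => [|b IH] y /=; first by rewrite mul0r addr0; exact: f0.
rewrite -natr1 mulrDl mul1r addrA => yb.
rewrite /diffop (shift_support i h0 IH yb) IH ?subr0// => yb'; apply: yb => j.
by apply: le_trans (yb' j) _; rewrite lerDl.
Qed.

(** For rho = h / lam these are the bounds satisfied by a function that varies
    at length scale lam. They are stated for differences, and not derivatives,
    since differences pass through convolutions and integrals by translation
    invariance alone. *)
Definition dbound i h (a : nat) (D rho : R) f : Prop :=
  forall b, (b <= a)%N -> forall x, `|iter b (diffop i h) f x| <= D * rho ^+ b.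

Lemma dbound_diffop i h a D rho f : dbound i h a.+1 D rho f ->
  dbound i h a (D * rho) rho (diffop i h f).
Proof.
move=> H b ba x; have := H b.+1 ba x.
by rewrite iterSr exprS mulrA.
Qed.

Lemma dboundW i h a D rho f : dbound i h a.+1 D rho f -> dbound i h a D rho f.
Proof. by move=> H b ba; apply: H; exact: leqW. Qed.

Lemma dbound_shift i h a D rho f : dbound i h a D rho f ->
  dbound i h a D rho (fun y => f (shift_coord i h y)).
Proof. by move=> H b ba x; rewrite iter_diffop_shift; exact: H. Qed.

Lemma dboundD i h a D E rho f g : dbound i h a D rho f -> dbound i h a E rho g ->
  dbound i h a (D + E) rho (fun y => f y + g y).
Proof.
move=> Hf Hg b ba x; rewrite iter_diffopD mulrDl.
by apply: le_trans (ler_normD _ _) _; rewrite lerD ?Hf ?Hg.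
Qed.

Lemma diffopM i h f g : diffop i h (fun y => f y * g y) =
  fun y => diffop i h f y * g (shift_coord i h y) + f y * diffop i h g y.
Proof. by apply/funext => x; rewrite /diffop; ring. Qed.

(** By induction on the order, from the discrete Leibniz rule. *)
Lemma dboundM i h a D E rho f g : 0 <= rho -> dbound i h a D rho f -> dbound i h a E rho g ->
  dbound i h a (2 ^+ a * (D * E)) rho (fun y => f y * g y).
Proof.
move=> r0 Hf Hg.
have D0 : 0 <= D.
  by have := Hf 0%N isT 0; rewrite expr0 mulr1; apply: le_trans.
have E0 : 0 <= E.
  by have := Hg 0%N isT 0; rewrite expr0 mulr1; apply: le_trans.
have key b : (b <= a)%N -> forall D E f g, dbound i h b D rho f -> dbound i h b E rho g ->
    forall x, `|iter b (diffop i h) (fun y => f y * g y) x| <= 2 ^+ b * (D * E) * rho ^+ b.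
  elim: b {D E D0 E0 f g Hf Hg} => [|b IH] ba D E f g Hf Hg x.
    rewrite !expr0 mul1r mulr1 /= normrM.
    by have := Hf 0%N isT x; have := Hg 0%N isT x; rewrite expr0 !mulr1 => ? ?; exact: ler_pM.
  rewrite iterSr diffopM iter_diffopD.
  apply: le_trans (ler_normD _ _) _.
  have h1 := IH (ltnW ba) _ _ _ _ (dbound_diffop Hf) (dbound_shift (dboundW Hg)) x.
  have h2 := IH (ltnW ba) _ _ _ _ (dboundW Hf) (dbound_diffop Hg) x.
  apply: le_trans (lerD h1 h2) _.
  apply: le_of_eq; rewrite !exprS; ring.
move=> b ba x; have Hf' : dbound i h b D rho f by move=> c cb; apply: Hf; exact: leq_trans ba.
have Hg' : dbound i h b E rho g by move=> c cb; apply: Hg; exact: leq_trans ba.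
apply: le_trans (key b ba _ _ _ _ Hf' Hg' x) _.
by rewrite ler_wpM2r ?exprn_ge0// ler_wpM2r ?mulr_ge0// ler_weXn2l// ler1n.
Qed.

Lemma derivable_shift_coord i h f : (forall x, derivable f x (delta_mx ord0 i)) ->
  (forall x, derivable (diffop i h f) x (delta_mx ord0 i)) /\
  partial i (diffop i h f) = diffop i h (partial i f).
Proof.
move=> df; pose a : 'rV[R]_n := - (h *: delta_mx ord0 i).
have E : (fun y => f (shift_coord i h y)) = (fun y : 'rV[R]_n => f (1 *: (y - a))).
  by apply/funext => y; rewrite scale1r /a opprK.
have H x := is_derive_affine (df (1 *: (x - a))).
have d1 x : derivable (fun y => f (shift_coord i h y)) x (delta_mx ord0 i).
  by rewrite E; have [] := H x.
split => [x|]; first by apply: derivableB; [exact: d1|exact: df].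
apply/funext => x; rewrite /partial.
rewrite (@deriveB _ _ _ (fun y => f (shift_coord i h y)) f x _ (d1 x) (df x)).
congr (_ - _); rewrite E; have [_ ->] := H x.
by rewrite mul1r scale1r /a opprK.
Qed.

Lemma iter_diffop_derivable i h b f : (forall x, derivable f x (delta_mx ord0 i)) ->
  (forall x, derivable (iter b (diffop i h) f) x (delta_mx ord0 i)) /\
  partial i (iter b (diffop i h) f) = iter b (diffop i h) (partial i f).
Proof.
move=> df; elim: b => //= b [IH1 IH2].
have [h1 h2] := @derivable_shift_coord i h _ IH1.
by split => //; rewrite h2 IH2.
Qed.

(** The mean value theorem, once for each order: differences commute with
    partial derivatives. *)
Lemma iter_diffop_le i h (a : nat) f (M : R) : 0 <= h -> smooth f ->
  (forall x, `|iter a (partial i) f x| <= M) ->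
  forall x, `|iter a (diffop i h) f x| <= M * h ^+ a.
Proof.
move=> h0; elim: a f => [|a IH] f sf fM x; first by rewrite expr0 mulr1; exact: fM.
have df y : derivable f y (delta_mx ord0 i) by exact: (sf [::]).2.
have [d1 e1] := iter_diffop_derivable h a df.
set F := iter a _ _ in d1 e1.
have FM y : `|partial i F y| <= M * h ^+ a.
  by rewrite e1; apply: IH; [exact: smooth_partial|move=> z; rewrite -iterSr; exact: fM].
move: h0; rewrite le_eqVlt => /predU1P[<-|h0].
  rewrite /= /diffop /shift_coord scale0r addr0 subrr normr0.
  by rewrite exprS mul0r mulr0.
rewrite /= -/F /diffop.
have dl t := is_derive_line (d1 (t *: delta_mx ord0 i + x)).
have cf : {within `[0, h], continuous (fun s : R => F (s *: delta_mx ord0 i + x))}.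
  apply: continuous_subspaceT => t.
  by apply/differentiable_continuous/derivable1_diffP; case: (dl t).
have [c _] := MVT h0 (fun t _ => dl t) cf.
have -> : h *: delta_mx ord0 i + x = shift_coord i h x by rewrite addrC.
have -> : 0 *: delta_mx ord0 i + x = x by rewrite scale0r add0r.
rewrite subr0 => ->.
by rewrite normrM (gtr0_norm h0) exprSr mulrA ler_wpM2r ?(ltW h0)// -/(partial i F _).
Qed.

End differences.

Section oscillation.
Context {R : realType} {n : nat}.
Implicit Types (g : 'rV[R]_n -> R) (x xi : 'rV[R]_n) (k : R -> R).

Lemma dotp_shift x i h xi : dotp x (shift_coord i h xi) = dotp x xi + h * x ord0 i.
Proof.
rewrite /dotp (eq_bigr (fun j => x ord0 j * xi ord0 j + h * (x ord0 j * (j == i)%:R))).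
  rewrite big_split/= -mulr_sumr; congr (_ + _ * _).
  rewrite (bigD1 i)//= eqxx mulr1 big1 ?addr0// => j /negbTE ->; exact: mulr0.
by move=> j _; rewrite shift_coordE; ring.
Qed.

(** A half-period shift reverses the sign of the oscillating factor, so that
    each difference taken on the amplitude gains a factor -2. *)
Lemma oscillation_diffop g k x i h eta (r M : R) : 0 <= r -> 0 <= h ->
  measurable_fun setT k -> (forall t, `|k t| <= 1) ->
  (forall t, k (t + h * x ord0 i) = - k t) ->
  measurable_fun setT g -> (forall xi, `|g xi| <= M) ->
  (forall xi, ~ box eta r xi -> g xi = 0) ->
  \int[lebesgue_rV]_xi (diffop i h g xi * k (dotp x xi)) =
  -2 * \int[lebesgue_rV]_xi (g xi * k (dotp x xi)).
Proof.
move=> r0 h0 mk k1 kh mg gM g0.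
have mkx : measurable_fun setT (fun xi => k (dotp x xi)).
  exact: (measurableT_comp mk (measurable_dotp x)).
have i1 : lebesgue_rV.-integrable setT (EFin \o (fun xi => g xi * k (dotp x xi))).
  apply: (@integrable_box_bounded _ _ _ eta r M r0).
  - exact: measurable_funM.
  - by move=> xi; rewrite normrM -[leRHS]mulr1 ler_pM.
  - by move=> xi xb; rewrite g0// mul0r.
have i2 : lebesgue_rV.-integrable setT (EFin \o (fun xi => g (shift_coord i h xi) * k (dotp x xi))).
  apply: (@integrable_box_bounded _ _ _ eta (r + h) M (addr_ge0 r0 h0)).
  - apply: measurable_funM => //; exact: measurable_comp_shift.
  - by move=> xi; rewrite normrM -[leRHS]mulr1 ler_pM.
  - by move=> xi xb; rewrite (shift_support i h0 g0 xb) mul0r.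
have e2 : \int[lebesgue_rV]_xi (g (shift_coord i h xi) * k (dotp x xi)) =
    - \int[lebesgue_rV]_xi (g xi * k (dotp x xi)).
  rewrite -(@Rintegral_shift _ _ i h (fun xi => g xi * k (dotp x xi))); last exact: measurable_funM.
  rewrite -mulN1r -RintegralZl//.
    by apply: eq_Rintegral => xi _; rewrite dotp_shift kh; ring.
  apply: (@integrable_box_bounded _ _ _ eta (r + h) M (addr_ge0 r0 h0)).
  - exact: (measurable_comp_shift i h (measurable_funM mg mkx)).
  - by move=> xi; rewrite normrM -[leRHS]mulr1 ler_pM.
  - by move=> xi xb; rewrite (shift_support i h0 g0 xb) mul0r.
rewrite (@eq_Rintegral _ _ _ lebesgue_rV setT
  (fun xi => g (shift_coord i h xi) * k (dotp x xi) - g xi * k (dotp x xi))).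
  by rewrite RintegralB// e2; lra.
by move=> xi _; rewrite /diffop mulrBl.
Qed.

Lemma oscillation_iter g k x i h eta (r D rho : R) (a : nat) : 0 <= r -> 0 <= h ->
  measurable_fun setT k -> (forall t, `|k t| <= 1) ->
  (forall t, k (t + h * x ord0 i) = - k t) ->
  measurable_fun setT g -> dbound i h a D rho g ->
  (forall xi, ~ box eta r xi -> g xi = 0) ->
  \int[lebesgue_rV]_xi (iter a (diffop i h) g xi * k (dotp x xi)) =
  (-2) ^+ a * \int[lebesgue_rV]_xi (g xi * k (dotp x xi)).
Proof.
move=> r0 h0 mk k1 kh mg; elim: a => [|a IH] dg g0; first by rewrite expr0 mul1r.
rewrite exprS -mulrA -IH//; last exact: dboundW.
apply: (@oscillation_diffop _ k x i h eta (r + a%:R * h) (D * rho ^+ a)) => //.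
- by rewrite addr_ge0// mulr_ge0.
- exact: measurable_iter_diffop.
- by move=> xi; exact: dg.
- exact: iter_diffop_support.
Qed.

Lemma mx_norm_attained x : (0 < n)%N -> exists i, `|x| = `|x ord0 i|.
Proof.
move=> n0; have [x0|x0] := eqVneq `|x| 0.
  by exists (Ordinal n0); move/normr0_eq0 : (x0) => ->; rewrite mxE !normr0.
have := @mx_norm_neq0 _ _ _ x; rewrite -[mx_norm x]/(`|x|) x0 => /(_ isT)[[i j] /= e].
by exists j; rewrite e ord1.
Qed.

(** Take n differences of step h = 1 / (2 |x|), half a period of the oscillation
    in the direction of the largest coordinate of x: each of them costs a factor
    h / lam, that is 1 / (lam |x|) up to a constant. *)
Lemma oscillation_decay g k x eta (lam r D : R) : (0 < n)%N -> 0 < lam -> 0 <= r -> 0 <= D ->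
  measurable_fun setT k -> (forall t, `|k t| <= 1) ->
  (forall t, k (t + 2^-1) = - k t) ->
  measurable_fun setT g ->
  (forall i h, 0 <= h -> dbound i h n D (h / lam) g) ->
  (forall xi, ~ box eta (r * lam) xi -> g xi = 0) ->
  let I := `|\int[lebesgue_rV]_xi (g xi * k (dotp x xi))| in
  I <= D * (2 * (r + n%:R)) ^+ n * lam ^+ n /\
  I * (lam * `|x|) ^+ n <= D * (2 * (r + n%:R)) ^+ n * lam ^+ n.
Proof.
move=> n0 l0 r0 D0 mk k1 kh mg dg g0 I.
have mkx : measurable_fun setT (fun xi => k (dotp x xi)).
  exact: (measurableT_comp mk (measurable_dotp x)).
have rl0 : 0 <= r * lam by rewrite mulr_ge0 ?(ltW l0).
have I1 : I <= D * (2 * (r + n%:R)) ^+ n * lam ^+ n.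
  apply: (@le_trans _ _ (D * (2 * (r * lam)) ^+ n)).
    apply: (@Rintegral_box_le _ _ _ eta (r * lam) D rl0).
    - exact: measurable_funM.
    - move=> xi; rewrite normrM -[leRHS]mulr1 ler_pM//.
      by have := dg (Ordinal n0) 0 (lexx _) 0%N isT xi; rewrite expr0 mulr1.
    - by move=> xi xb; rewrite g0// mul0r.
  rewrite -mulrA ler_wpM2l// -exprMn lerXn2r ?nnegrE ?mulr_ge0 ?addr_ge0 ?(ltW l0)//.
  by rewrite mulrA ler_pM2r// ler_pM2l// lerDl.
split => //; have [i xi] := mx_norm_attained x n0.
have I0 : 0 <= I by exact: normr_ge0.
(* For |x| <= 1 / (2 lam) the first bound implies the second. *)
have [small|big] := leP (2 * (lam * `|x|)) 1.
  apply: le_trans I1; rewrite ler_piMr// exprn_ile1 ?mulr_ge0 ?(ltW l0)//.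
  by have := mulr_ge0 (ltW l0) (normr_ge0 x); lra.
have x0 : 0 < `|x|.
  rewrite lt0r normr_ge0 andbT; apply/eqP => x0.
  by move: big; rewrite x0 !mulr0 ltNge ler01.
pose h := (2 * `|x|)^-1; have h0 : 0 < h by rewrite invr_gt0 mulr_gt0.
have khx t : k (t + h * x ord0 i) = - k t.
  have [s|s] := leP 0 (x ord0 i).
    have -> : h * x ord0 i = 2^-1.
      by rewrite /h xi ger0_norm//; field; move: x0; rewrite xi ger0_norm// => /gt_eqF ->.
    exact: kh.
  have -> : h * x ord0 i = - 2^-1.
    by rewrite /h xi ltr0_norm//; field; rewrite lt_eqF.
  by have := kh (t - 2^-1); rewrite subrK => ->; rewrite opprK.
have dgi := dg i h (ltW h0).
have e := oscillation_iter rl0 (ltW h0) mk k1 khx mg dgi g0.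
have hl : h <= lam.
  by rewrite /h -(@ler_pM2r _ `|x|) // invfM -mulrA mulVf ?gt_eqF// mulr1; lra.
have : `|\int[lebesgue_rV]_xi (iter n (diffop i h) g xi * k (dotp x xi))| <=
    D * (h / lam) ^+ n * (2 * (r * lam + n%:R * h)) ^+ n.
  apply: (@Rintegral_box_le _ _ _ eta).
  - by rewrite addr_ge0// mulr_ge0// ltW.
  - by apply: measurable_funM => //; exact: measurable_iter_diffop.
  - by move=> z; rewrite normrM -[leRHS]mulr1 ler_pM//; exact: dgi.
  - move=> z zb; rewrite (@iter_diffop_support _ _ _ _ _ _ eta (r * lam))// ?mul0r//.
    exact: ltW.
rewrite e normrM normrX normrN (@ger0_norm _ 2)// -/I => H.
have H2 : 2 ^+ n * I <= D * (h / lam) ^+ n * (2 * (r + n%:R) * lam) ^+ n.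
  apply: le_trans H _; rewrite ler_wpM2l ?mulr_ge0 ?exprn_ge0 ?divr_ge0 ?(ltW h0) ?(ltW l0)//.
  rewrite lerXn2r ?nnegrE ?mulr_ge0 ?addr_ge0 ?mulr_ge0 ?(ltW h0) ?(ltW l0)//.
  rewrite -mulrA ler_pM2l// mulrDl lerD2l ler_wpM2l//.
have H3 : 2 ^+ n * (lam * `|x|) ^+ n * (h / lam) ^+ n = 1.
  rewrite -!exprMn (_ : _ * _ = 1) ?expr1n//.
  by rewrite /h; field; rewrite !gt_eqF.
rewrite -(@ler_pM2l _ (2 ^+ n)) ?exprn_gt0// mulrA.
apply: (@le_trans _ _ (D * (h / lam) ^+ n * (2 * (r + n%:R) * lam) ^+ n * (lam * `|x|) ^+ n)).
  by rewrite ler_wpM2r// exprn_ge0// mulr_ge0// ltW.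
have -> : D * (h / lam) ^+ n * (2 * (r + n%:R) * lam) ^+ n * (lam * `|x|) ^+ n =
  (2 ^+ n * (lam * `|x|) ^+ n * (h / lam) ^+ n) * (D * (r + n%:R) ^+ n * lam ^+ n).
  by rewrite !exprMn; ring.
rewrite H3 mul1r [2 ^+ n * _]mulrC !exprMn.
have : 0 <= D * (r + n%:R) ^+ n * lam ^+ n.
  by rewrite !mulr_ge0 ?exprn_ge0 ?addr_ge0 ?(ltW l0).
have : 1 <= 2 ^+ n :> R by rewrite exprn_ege1// ler1n.
have : 1 <= 2 ^+ n * 2 ^+ n :> R by rewrite -exprMn exprn_ege1// -natrM ler1n.
move=> _ h1 h2.
rewrite (_ : D * (2 ^+ n * (r + n%:R) ^+ n) * lam ^+ n * 2 ^+ n =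
  (2 ^+ n * 2 ^+ n) * (D * (r + n%:R) ^+ n * lam ^+ n)); last by ring.
by rewrite ler_peMl// -exprMn exprn_ege1// -natrM ler1n.
Qed.

End oscillation.

(** * Wave packets *)

Section triangle_kernel.
Context {R : realType} {n : nat}.
Implicit Types (V : 'rV[R]_n -> R) (x xi zeta eta : 'rV[R]_n).

Lemma triangle_rV_ge0 (a : R) xi : 0 <= triangle_rV a xi.
Proof. by apply: prodr_ge0 => i _; exact: triangle_ge0. Qed.

Lemma triangle_rV_le (a : R) xi : 0 <= a -> triangle_rV a xi <= a ^+ n.
Proof.
move=> a0; rewrite -{2}(card_ord n) -prodr_const; apply: ler_prod => i _.
by rewrite triangle_ge0 triangle_le.
Qed.

Lemma triangle_rV_out (a : R) xi : 0 <= a -> ~ box 0 a xi -> triangle_rV a xi = 0.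
Proof.
move=> a0 /existsNP[i /negP]; rewrite mxE subr0 -ltNge => h.
by rewrite /triangle_rV (bigD1 i)//= triangle_out ?mul0r// ltW.
Qed.

Lemma triangle_rV_in (a : R) xi : 0 <= a -> box 0 (a / 2) xi ->
  (a / 2) ^+ n <= triangle_rV a xi.
Proof.
move=> a0 h; rewrite -{1}(card_ord n) -prodr_const; apply: ler_prod => i _.
rewrite divr_ge0//=; apply: triangle_in.
by have := h i; rewrite mxE subr0.
Qed.

Lemma measurable_triangle_rV (a : R) : measurable_fun setT (triangle_rV a : 'rV[R]_n -> R).
Proof.
apply: measurable_prod => i _.
exact: (measurableT_comp (measurable_triangle a) (measurable_coor i)).
Qed.

Lemma measurable_sub2 : measurable_fun setT (fun z : 'rV[R]_n * 'rV[R]_n => z.1 - z.2).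
Proof.
apply: measurable_fun_rVP => i; under eq_fun do rewrite !mxE.
apply: measurable_funB.
  exact: (measurableT_comp (measurable_coor i) measurable_fst).
exact: (measurableT_comp (measurable_coor i) measurable_snd).
Qed.

Lemma measurable_subr xi : measurable_fun setT (fun zeta : 'rV[R]_n => xi - zeta).
Proof.
apply: measurable_fun_rVP => i; under eq_fun do rewrite !mxE.
by apply: measurable_funB => //; exact: measurable_coor.
Qed.

Lemma box_sub (a : R) xi zeta : box 0 a (xi - zeta) <-> box xi a zeta.
Proof.
by split=> h i; have := h i; rewrite !mxE ?subr0 distrC// -opprB normrN opprK addrC.
Qed.

(** Convolution with the triangle kernel: on the Fourier side, multiplication by
    a Fejer kernel. *)
Definition smoothing (a : R) V xi : R :=
  \int[lebesgue_rV]_zeta (V zeta * triangle_rV a (xi - zeta)).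

Section smoothing.
Variables (a : R) (a0 : 0 <= a).

Lemma smoothing_integrand V (M : R) xi : measurable_fun setT V ->
  (forall zeta, `|V zeta| <= M) ->
  [/\ measurable_fun setT (fun zeta => V zeta * triangle_rV a (xi - zeta)),
      forall zeta, `|V zeta * triangle_rV a (xi - zeta)| <= M * a ^+ n &
      forall zeta, ~ box xi a zeta -> V zeta * triangle_rV a (xi - zeta) = 0].
Proof.
move=> mV VM; split.
- apply: measurable_funM => //.
  exact: (measurableT_comp (measurable_triangle_rV a) (measurable_subr xi)).
- by move=> zeta; rewrite normrM (ger0_norm (triangle_rV_ge0 _ _)) ler_pM// ?triangle_rV_ge0// triangle_rV_le.
- by move=> zeta h; rewrite triangle_rV_out ?mulr0// => /box_sub.
Qed.

Lemma smoothing_integrable V (M : R) xi : measurable_fun setT V ->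
  (forall zeta, `|V zeta| <= M) ->
  lebesgue_rV.-integrable setT (EFin \o (fun zeta => V zeta * triangle_rV a (xi - zeta))).
Proof.
move=> mV VM; have [h1 h2 h3] := smoothing_integrand xi mV VM.
exact: integrable_box_bounded a0 h1 h2 h3.
Qed.

Lemma smoothing_le V (M : R) xi : measurable_fun setT V ->
  (forall zeta, `|V zeta| <= M) ->
  `|smoothing a V xi| <= M * (a ^+ n * (2 * a) ^+ n).
Proof.
move=> mV VM; have [h1 h2 h3] := smoothing_integrand xi mV VM.
by rewrite mulrA; exact: Rintegral_box_le a0 h1 h2 h3.
Qed.

(** By translation invariance of the integral. *)
Lemma smoothing_iter_diffop V (D rho : R) i h (b : nat) xi : measurable_fun setT V ->
  dbound i h b D rho V ->
  iter b (diffop i h) (smoothing a V) xi = smoothing a (iter b (diffop i h) V) xi.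
Proof.
move=> mV; elim: b xi => [|b IH] xi dV //.
rewrite /= {1}/diffop !IH; try exact: dboundW.
set U := iter b _ V.
have mU : measurable_fun setT U by exact: measurable_iter_diffop.
have UM zeta : `|U zeta| <= D * rho ^+ b by exact: dV.
have mUs : measurable_fun setT (fun zeta => U (shift_coord i h zeta)) by exact: measurable_comp_shift.
have UsM zeta : `|U (shift_coord i h zeta)| <= D * rho ^+ b by exact: dV.
have e : smoothing a U (shift_coord i h xi) =
    smoothing a (fun zeta => U (shift_coord i h zeta)) xi.
  have [h1 _ _] := smoothing_integrand (shift_coord i h xi) mU UM.
  rewrite /smoothing -(Rintegral_shift i h h1); apply: eq_Rintegral => zeta _.
  by rewrite /shift_coord; congr (_ * triangle_rV _ _); rewrite opprD addrACA subrr addr0.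
rewrite e /smoothing -RintegralB//; last 2 first.
- exact: smoothing_integrable mUs UsM.
- exact: smoothing_integrable mU UM.
by apply: eq_Rintegral => zeta _; rewrite /diffop mulrBl.
Qed.

Lemma dbound_smoothing V (D rho : R) i h (b : nat) : measurable_fun setT V ->
  dbound i h b D rho V ->
  dbound i h b (D * (a ^+ n * (2 * a) ^+ n)) rho (smoothing a V).
Proof.
move=> mV dV c cb xi.
have dVc : dbound i h c D rho V by move=> e ec; apply: dV; exact: leq_trans cb.
rewrite (smoothing_iter_diffop xi mV dVc) mulrAC.
apply: smoothing_le; first exact: measurable_iter_diffop.
by move=> zeta; exact: dV.
Qed.

Lemma measurable_smoothing V : measurable_fun setT V ->
  (forall zeta, 0 <= V zeta) -> measurable_fun setT (smoothing a V).
Proof.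
move=> mV V0; rewrite /smoothing.
pose F (z : 'rV[R]_n * 'rV[R]_n) : \bar R := (V z.2 * triangle_rV a (z.1 - z.2))%:E.
have mF : measurable_fun setT F.
  apply/measurable_EFinP; apply: measurable_funM.
    exact: (measurableT_comp mV measurable_snd).
  exact: (measurableT_comp (measurable_triangle_rV a) measurable_sub2).
apply: (measurableT_comp (@fine_measurable R setT measurableT)).
apply: (measurable_fun_fubini_tonelli_F F) => //.
by move=> z; rewrite lee_fin mulr_ge0 ?triangle_rV_ge0.
Qed.

Lemma smoothing_ge0 V xi : (forall zeta, 0 <= V zeta) -> 0 <= smoothing a V xi.
Proof.
by move=> V0; apply: Rintegral_ge0 => z _; rewrite mulr_ge0 ?triangle_rV_ge0.
Qed.

Lemma smoothing_support V eta (r : R) xi : (forall zeta, ~ box eta r zeta -> V zeta = 0) ->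
  ~ box eta (r + a) xi -> smoothing a V xi = 0.
Proof.
move=> V0 xb; rewrite /smoothing (@eq_Rintegral _ _ _ lebesgue_rV setT (fun=> 0)).
  by rewrite Rintegral_cst// mul0r.
move=> zeta _; have [h|h] := pselect (box eta r zeta); last by rewrite V0 ?mul0r.
rewrite triangle_rV_out ?mulr0// => /box_sub h'; apply: xb => i.
rewrite -(subrKA (zeta ord0 i)) (le_trans (ler_normD _ _))// addrC lerD//.
by rewrite distrC.
Qed.

Lemma smoothing_lower V eta (r : R) xi (M : R) : measurable_fun setT V ->
  (forall zeta, 0 <= V zeta) -> (forall zeta, `|V zeta| <= M) -> 0 <= r -> r <= a / 2 ->
  (forall zeta, box eta (2 * r) zeta -> V zeta = 1) ->
  box eta r xi -> (a / 2) ^+ n * (2 * r) ^+ n <= smoothing a V xi.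
Proof.
move=> mV V0 VM r0 ra V1 xb.
rewrite -(@Rintegral_box_cst _ _ xi r ((a / 2) ^+ n) r0); apply: le_Rintegral => //.
- exact: integrable_box_cst.
- exact: smoothing_integrable mV VM.
move=> zeta _; rewrite indicE; case: (boolP (zeta \in _)) => h.
  rewrite inE in h; rewrite V1; last first.
    move=> i; rewrite -(subrKA (xi ord0 i)) (le_trans (ler_normD _ _))// mulr2n mulrDl mul1r lerD//.
  rewrite mul1r mulr1; apply: triangle_rV_in => //.
  by apply/box_sub => i; exact: le_trans (h i) ra.
by rewrite mulr0 mulr_ge0// triangle_rV_ge0.
Qed.

End smoothing.
End triangle_kernel.

Section wave_packets.
Context {R : realType} {n : nat} (psi : nat -> 'rV[R]_n -> R[i]).
Hypothesis psiP : LP_partition psi.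
Implicit Types (x xi zeta eta : 'rV[R]_n) (lam : R).

Definition window lam eta : 'rV[R]_n -> R := lp_bump psi eta lam^-1.

(** Up to a constant factor, the Fourier transform of the packet below. *)
Definition profile lam eta : 'rV[R]_n -> R := smoothing lam (window lam eta).

(** A product of two explicit inverse Fourier transforms, so that its own Fourier
    transform is a convolution. *)
Definition packet lam eta x : R[i] :=
  fejer_rV lam x * inv_fourier (fun xi => (window lam eta xi)%:C%C) x.

Lemma integralC_real (h : 'rV[R]_n -> R) :
  integralC lebesgue_rV (fun x => (h x)%:C%C) = (\int[lebesgue_rV]_x h x)%:C%C.
Proof. by apply: complexP => //=; rewrite Rintegral_cst// mul0r. Qed.

Lemma measurable_window lam eta : measurable_fun setT (window lam eta).
Proof.
apply: continuous_measurable_rV; exact: (lp_bump_smooth psiP eta lam^-1 [::]).1.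
Qed.

Lemma window_ge0 lam eta xi : 0 <= window lam eta xi.
Proof. exact: lp_bump_ge0. Qed.

Lemma window_bounded : exists2 M : R, 0 < M & forall lam eta xi, `|window lam eta xi| <= M.
Proof.
have [M M0 MP] := lp_bump_bounded psiP; exists M => // lam eta xi.
by rewrite /window ger0_norm ?lp_bump_ge0.
Qed.

Lemma window_support lam eta xi : 0 < lam -> ~ box eta (2 * lam) xi -> window lam eta xi = 0.
Proof.
move=> l0 h; apply: (lp_bump_support psiP); first by rewrite invr_gt0.
by rewrite invrK.
Qed.

Lemma window1 lam eta xi : 0 < lam -> box eta (lam / n.+1%:R) xi -> window lam eta xi = 1.
Proof.
move=> l0 h; apply: (lp_bump1 psiP); first by rewrite invr_gt0.
by rewrite invrK.
Qed.

Lemma integrableC_window lam eta : 0 < lam ->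
  integrableC lebesgue_rV (fun xi => (window lam eta xi)%:C%C).
Proof.
move=> l0; have [M _ MP] := window_bounded.
have r0 : 0 <= 2 * lam by rewrite mulr_ge0// ltW.
split; last exact: integrable0.
exact: integrable_box_bounded r0 (measurable_window lam eta) (MP lam eta)
  (fun y => @window_support lam eta y l0).
Qed.

Lemma inv_fourier1 (h : 'rV[R]_n -> R[i]) x : inv_fourier h x =
  integralC lebesgue_rV (fun y => h y * cis2pi (1 * dotp x y)).
Proof.
rewrite /inv_fourier -[LHS]/(integralC lebesgue_rV _).
by under eq_fun do rewrite -[dotp _ _]mul1r.
Qed.

Lemma integrableC_packet lam eta : 0 < lam -> integrableC lebesgue_rV (packet lam eta).
Proof.
move=> l0; have [h _ _] := multiplication_formula 1 (integrableC_fejer_rV lam) (integrableC_window eta l0).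
have E : packet lam eta = (fun x => fejer_rV lam x *
    integralC lebesgue_rV (fun y => (window lam eta y)%:C%C * cis2pi (1 * dotp x y))).
  by apply/funext => x; rewrite /packet inv_fourier1.
by rewrite E.
Qed.

(** Fubini's theorem alone: the transform of the Fejer kernel is known, and the
    other factor is written as an integral. *)
Lemma fourier_packet lam eta xi : 0 < lam ->
  fourier (packet lam eta) xi = ((@fejer_mass R) ^+ n)%:C%C * (profile lam eta xi)%:C%C.
Proof.
move=> l0.
have ia : integrableC lebesgue_rV (fun x => fejer_rV lam x * cis2pi (- dotp x xi)).
  exact: integrableC_cis (integrableC_fejer_rV lam) (measurable_funN (measurable_dotpl xi)).
have [_ _ e] := multiplication_formula 1 ia (integrableC_window eta l0).
transitivity (integralC lebesgue_rV (fun x => fejer_rV lam x * cis2pi (- dotp x xi) *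
    integralC lebesgue_rV (fun y => (window lam eta y)%:C%C * cis2pi (1 * dotp x y)))).
  rewrite /fourier -[LHS]/(integralC lebesgue_rV _); congr integralC.
  by apply/funext => x; rewrite /packet inv_fourier1; ring.
rewrite e.
have -> : (fun y => (window lam eta y)%:C%C * integralC lebesgue_rV
    (fun x => fejer_rV lam x * cis2pi (- dotp x xi) * cis2pi (1 * dotp x y))) =
  (fun y => ((@fejer_mass R ^+ n) * (window lam eta y * triangle_rV lam (xi - y)))%:C%C).
  apply/funext => y.
  have -> : (fun x => fejer_rV lam x * cis2pi (- dotp x xi) * cis2pi (1 * dotp x y)) =
      (fun x => fejer_rV lam x * cis2pi (- dotp x (xi - y))).
    apply/funext => x; rewrite -mulrA -cis2piD mul1r; congr (_ * cis2pi _).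
    by rewrite ![dotp x _]dotpC dotpBl; ring.
  by rewrite fourier_fejer_rV -rmorphM; congr (_%:C%C); ring.
rewrite integralC_real -rmorphM; congr (_%:C%C).
have [M _ MP] := window_bounded.
have iS := smoothing_integrable (ltW l0) xi (measurable_window lam eta) (MP lam eta).
exact: (RintegralZl _ measurableT iS).
Qed.

Lemma measurable_profile lam eta : 0 < lam -> measurable_fun setT (profile lam eta).
Proof.
move=> l0; exact: measurable_smoothing (measurable_window lam eta) (window_ge0 lam eta).
Qed.

Lemma profile_ge0 lam eta xi : 0 <= profile lam eta xi.
Proof. by apply: smoothing_ge0 => z; exact: window_ge0. Qed.

Lemma profile_support lam eta xi : 0 < lam -> ~ box eta (3 * lam) xi -> profile lam eta xi = 0.
Proof.
move=> l0 h; apply: (smoothing_support (ltW l0) (eta := eta) (r := 2 * lam)).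
  by move=> z; exact: window_support.
by rewrite (_ : 2 * lam + lam = 3 * lam)//; ring.
Qed.

(** The hypotheses on the partition bound the derivatives of psi_k at length
    scale 2^k. *)
Lemma LP_differences : exists2 M, 0 <= M & forall k i h, 0 <= h ->
  dbound i h n M (h / 2 ^+ k) (fun x => complex.Re (psi k x)) /\
  dbound i h n M (h / 2 ^+ k) (fun x => complex.Im (psi k x)).
Proof.
case: (psiP) => _ _ _ hd _.
pose al (ib : 'I_n * 'I_n.+1) : multiindex n := [ffun j => if j == ib.1 then ib.2 : nat else 0%N].
have /choice[M MP] ib := hd (al ib).
have mdE (ib : 'I_n * 'I_n.+1) f : mderive (al ib) f = iter ib.2 (partial ib.1) f.
  have H (l : seq 'I_n) : uniq l -> foldr (fun i => iter (al ib i) (partial i)) f l =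
      if ib.1 \in l then iter ib.2 (partial ib.1) f else f.
    elim: l => //= j l IH /andP[jl ul]; rewrite IH// ffunE inE eq_sym.
    case: (eqVneq ib.1 j) => [E|_] //=; first by rewrite E (negbTE jl).
  by rewrite /mderive H ?enum_uniq// mem_enum.
have szE ib : msize (al ib) = ib.2.
  rewrite /msize (bigD1 ib.1)//= ffunE eqxx big1 ?addn0// => j jb.
  by rewrite ffunE (negbTE jb).
pose B := \sum_ib `|M ib|.
have MB ib : M ib <= B.
  by rewrite (le_trans (ler_norm _))// /B (bigD1 ib)//= lerDl sumr_ge0.
exists B; first exact: sumr_ge0.
move=> k i h h0.
have key (F : R[i] -> R) : (forall z, `|F z| <= normc z) ->
    (forall ib x, F (cmderive (al ib) (psi k) x) = iter ib.2 (partial ib.1) (fun y => F (psi k y)) x) ->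
    smooth (fun x => F (psi k x)) -> dbound i h n B (h / 2 ^+ k) (fun x => F (psi k x)).
  move=> F1 FE sF b bn x.
  have H y : `|iter b (partial i) (fun y => F (psi k y)) y| <= B / 2 ^+ k ^+ b.
    pose ib : 'I_n * 'I_n.+1 := (i, Ordinal (bn : (b < n.+1)%N)).
    rewrite -(FE ib) ler_pdivlMr ?exprn_gt0// mulrC.
    apply: le_trans (MB ib); apply: le_trans (MP ib k y).
    by rewrite szE exprM ler_wpM2l ?exprn_ge0.
  apply: le_trans (iter_diffop_le h0 sF H x) _.
  by rewrite expr_div_n mulrA mulrAC.
have [s1 s2] := LP_smooth psiP k.
split.
  by apply: key => //; [exact: Re_le_normc|move=> ib x; rewrite /= mdE].
by apply: key => //; [exact: Im_le_normc|move=> ib x; rewrite /= mdE].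
Qed.

Lemma dbound_rhoW i h a (D rho rho' : R) (f : 'rV[R]_n -> R) : 0 <= D -> 0 <= rho <= rho' ->
  dbound i h a D rho f -> dbound i h a D rho' f.
Proof.
move=> D0 /andP[r0 rr] H b ba x; apply: le_trans (H b ba x) _.
by rewrite ler_wpM2l// lerXn2r ?nnegrE// (le_trans r0).
Qed.

Lemma profile_differences : exists2 M, 0 <= M & forall lam eta i h, 0 < lam -> 0 <= h ->
  dbound i h n (M * lam ^+ (2 * n)) (h / lam) (profile lam eta).
Proof.
have [M M0 MP] := LP_differences.
exists ((2 ^+ n * (M * M) + 2 ^+ n * (M * M)) * 2 ^+ n).
  by rewrite mulr_ge0// addr_ge0// !mulr_ge0.
move=> lam eta i h l0 h0.
have li : 0 <= lam^-1 by rewrite invr_ge0 ltW.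
have [d1 d2] := MP 0%N i (lam^-1 * h) (mulr_ge0 li h0).
rewrite expr0 divr1 mulrC in d1 d2.
have aff (f : 'rV[R]_n -> R) : dbound i (h / lam) n M (h / lam) f ->
    dbound i h n M (h / lam) (fun x => f (lam^-1 *: (x - eta))).
  by move=> df b bn x; rewrite iter_diffop_affine mulrC; exact: df.
have hl : 0 <= h / lam by rewrite divr_ge0// ltW.
have dW : dbound i h n (2 ^+ n * (M * M) + 2 ^+ n * (M * M)) (h / lam) (window lam eta).
  by apply: dboundD; apply: dboundM => //; apply: (@aff (fun y => _ (psi 0%N y))).
have := dbound_smoothing (ltW l0) (measurable_window lam eta) dW.
have E : lam ^+ n * (2 * lam) ^+ n = 2 ^+ n * lam ^+ (2 * n).
  by rewrite exprMn mul2n -addnn exprD; ring.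
by rewrite E mulrA.
Qed.

(** As lam <= 2^k, the amplitude psi_k * profile varies at length scale lam, and
    the decay of oscillating integrals applies to the cosine and the sine. *)
Lemma block_decay : (0 < n)%N -> exists2 K, 0 < K & forall lam eta k x,
  0 < lam -> lam <= 2 ^+ k ->
  let v := normc (inv_fourier (fun xi => psi k xi * (profile lam eta xi)%:C%C) x) in
  v <= K * lam ^+ (3 * n) /\ v * (lam * `|x|) ^+ n <= K * lam ^+ (3 * n).
Proof.
move=> n0; have [M M0 MP] := LP_differences; have [N N0 NP] := profile_differences.
pose D := 2 ^+ n * (M * N) * (2 * (3 + n%:R)) ^+ n.
have D0 : 0 <= D by rewrite mulr_ge0 ?exprn_ge0 ?mulr_ge0 ?addr_ge0.
exists (4 * D + 1); first by rewrite ltr_wpDl ?mulr_ge0.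
move=> lam eta k x l0 lk.
have [mr mi] := LP_cmeasurable psiP k.
have mp := measurable_profile eta l0.
have mcos : measurable_fun [set: R] (fun t : R => cos (2 * pi * t)).
  by apply: (measurableT_comp (@measurable_cos R)); exact: measurable_funM.
have msin : measurable_fun [set: R] (fun t : R => sin (2 * pi * t)).
  by apply: (measurableT_comp (@measurable_sin R)); exact: measurable_funM.
have cos1 t : `|cos (2 * pi * t)| <= 1 :> R by rewrite ler_norml cos_geN1 cos_le1.
have sin1 t : `|sin (2 * pi * t)| <= 1 :> R by rewrite ler_norml sin_geN1 sin_le1.
have halfE t : 2 * pi * (t + 2^-1) = 2 * pi * t + pi :> R by field.
have cosh t : cos (2 * pi * (t + 2^-1)) = - cos (2 * pi * t) :> R by rewrite halfE cosDpi.
have sinh t : sin (2 * pi * (t + 2^-1)) = - sin (2 * pi * t) :> R by rewrite halfE sinDpi.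
have dF (f : 'rV[R]_n -> R) : (forall i h, 0 <= h -> dbound i h n M (h / 2 ^+ k) f) ->
    forall i h, 0 <= h -> dbound i h n (2 ^+ n * (M * (N * lam ^+ (2 * n)))) (h / lam)
      (fun xi => f xi * profile lam eta xi).
  move=> df i h h0; have hl : 0 <= h / lam by rewrite divr_ge0// ltW.
  apply: dboundM => //; last exact: NP.
  apply: dbound_rhoW (df i h h0) => //; rewrite divr_ge0//=.
  by rewrite ler_wpM2l// lef_pV2 ?posrE ?exprn_gt0.
have sF (f : 'rV[R]_n -> R) xi : ~ box eta (3 * lam) xi -> f xi * profile lam eta xi = 0.
  by move=> h; rewrite (profile_support l0 h) mulr0.
have C0 : 0 <= 2 ^+ n * (M * (N * lam ^+ (2 * n))).
  by rewrite !mulr_ge0 ?exprn_ge0 ?(ltW l0).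
have CE : 2 ^+ n * (M * (N * lam ^+ (2 * n))) * (2 * (3 + n%:R)) ^+ n * lam ^+ n = D * lam ^+ (3 * n).
  by rewrite /D (_ : (3 * n = 2 * n + n)%N) ?exprD; [ring|rewrite mulSn addnC].
have osc (f : 'rV[R]_n -> R) (g : R -> R) : measurable_fun setT f ->
    (forall i h, 0 <= h -> dbound i h n M (h / 2 ^+ k) f) ->
    measurable_fun setT g -> (forall t, `|g t| <= 1) -> (forall t, g (t + 2^-1) = - g t) ->
    let I := `|\int[lebesgue_rV]_xi (f xi * profile lam eta xi * g (dotp x xi))| in
    I <= D * lam ^+ (3 * n) /\ I * (lam * `|x|) ^+ n <= D * lam ^+ (3 * n).
  move=> mf df mg g1 gh.
  have := @oscillation_decay _ _ (fun xi => f xi * profile lam eta xi) g x eta lam 3 _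
    n0 l0 (ler0n _ _) C0 mg g1 gh (measurable_funM mf mp) (dF f df) (sF f).
  by rewrite CE.
have dr i h h0 := (MP k i h h0).1; have di i h h0 := (MP k i h h0).2.
have [a1 a2] := osc _ _ mr dr mcos cos1 cosh.
have [b1 b2] := osc _ _ mi di msin sin1 sinh.
have [c1 c2] := osc _ _ mr dr msin sin1 sinh.
have [e1 e2] := osc _ _ mi di mcos cos1 cosh.
have int (f : 'rV[R]_n -> R) (g : R -> R) : measurable_fun setT f ->
    (forall i h, 0 <= h -> dbound i h n M (h / 2 ^+ k) f) ->
    measurable_fun setT g -> (forall t, `|g t| <= 1) ->
    lebesgue_rV.-integrable setT (EFin \o (fun xi => f xi * profile lam eta xi * g (dotp x xi))).
  move=> mf df mg g1.
  apply: (@integrable_box_bounded _ _ _ eta (3 * lam) (2 ^+ n * (M * (N * lam ^+ (2 * n))))).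
  - by rewrite mulr_ge0// ltW.
  - apply: measurable_funM; first exact: measurable_funM.
    exact: (measurableT_comp mg (measurable_dotp x)).
  - move=> xi; rewrite normrM -[leRHS]mulr1 ler_pM//.
    by have := dF f df (Ordinal n0) 0 (lexx _) 0%N isT xi; rewrite expr0 mulr1.
  - by move=> xi xb; rewrite (sF f)// mul0r.
have vE : normc (inv_fourier (fun xi => psi k xi * (profile lam eta xi)%:C%C) x) <=
  `|\int[lebesgue_rV]_xi (complex.Re (psi k xi) * profile lam eta xi * cos (2 * pi * dotp x xi))| +
  `|\int[lebesgue_rV]_xi (complex.Im (psi k xi) * profile lam eta xi * sin (2 * pi * dotp x xi))| +
  (`|\int[lebesgue_rV]_xi (complex.Re (psi k xi) * profile lam eta xi * sin (2 * pi * dotp x xi))| +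
  `|\int[lebesgue_rV]_xi (complex.Im (psi k xi) * profile lam eta xi * cos (2 * pi * dotp x xi))|).
  apply: le_trans (normc_le_norm1 _) _; rewrite /norm1; apply: lerD.
    apply: le_trans (ler_normB _ _); rewrite -RintegralB//; last 2 first.
    - exact: int mr dr mcos cos1.
    - exact: int mi di msin sin1.
    apply: le_of_eq; congr `|_|; apply: eq_Rintegral => xi _.
    by rewrite !cReM cImM /= !mulr0 subr0 add0r.
  apply: le_trans (ler_normD _ _); rewrite -RintegralD//; last 2 first.
  - exact: int mr dr msin sin1.
  - exact: int mi di mcos cos1.
  apply: le_of_eq; congr `|_|; apply: eq_Rintegral => xi _.
  by rewrite !cImM cReM /= !mulr0 subr0 add0r.
have l3 : 0 <= lam ^+ (3 * n) by rewrite exprn_ge0// ltW.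
have y0 : 0 <= (lam * `|x|) ^+ n by rewrite exprn_ge0// mulr_ge0// ltW.
move=> v; split.
  apply: le_trans vE _; apply: le_trans (lerD (lerD a1 b1) (lerD c1 e1)) _.
  by rewrite mulrDl mul1r; lra.
apply: le_trans (ler_wpM2r y0 vE) _.
rewrite mulrDl [X in X + _]mulrDl [X in _ + X]mulrDl.
apply: le_trans (lerD (lerD a2 b2) (lerD c2 e2)) _.
by rewrite mulrDl mul1r; lra.
Qed.

Lemma profile_bounded lam eta : 0 < lam -> exists M, forall xi, norm1 (profile lam eta xi)%:C%C <= M.
Proof.
move=> l0; have [M _ MP] := window_bounded.
exists (M * (lam ^+ n * (2 * lam) ^+ n)) => xi; rewrite /norm1/= normr0 addr0.
exact: smoothing_le (ltW l0) _ _ _ (measurable_window _ _) (MP _ _).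
Qed.

Lemma cmeasurable_profile lam eta : 0 < lam -> cmeasurable (fun xi => (profile lam eta xi)%:C%C).
Proof. by move=> l0; split; [exact: measurable_profile|exact: measurable_cst]. Qed.

(** For |x| <= d / lam the demodulated phase is at most 1 on the support of the
    nonnegative profile, so at least half of its integral survives. *)
Lemma packet_lower : exists d c, [/\ 0 < d, 0 < c & forall lam eta x, 0 < lam -> lam * `|x| <= d ->
  c * lam ^+ (3 * n) <= complex.Re (cis2pi (- dotp x eta) *
    inv_fourier (fun xi => (profile lam eta xi)%:C%C) x)].
Proof.
(* The window is 1 on the box of radius lam / (n + 1), which is 2 r lam. *)
pose r : R := (2 * n.+1%:R)^-1; have r0 : 0 < r by rewrite invr_gt0 mulr_gt0.
pose c := 2^-1 * (2^-1 ^+ n * (2 * r) ^+ n * (2 * r) ^+ n).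
exists (24 * n.+1%:R)^-1, c; split.
- by rewrite invr_gt0 mulr_gt0.
- by rewrite !mulr_gt0 ?exprn_gt0 ?mulr_gt0.
move=> lam eta x l0 xl.
have mp := measurable_profile eta l0.
have [M MP] := profile_bounded eta l0.
have pM xi : `|profile lam eta xi| <= M by exact: le_trans (norm1_Re _) (MP xi).
have l30 : 0 <= 3 * lam by rewrite mulr_ge0// ltW.
have ip : integrableC lebesgue_rV (fun xi => (profile lam eta xi)%:C%C).
  exact: integrableC_box_bounded l30 (cmeasurable_profile eta l0) MP
    (fun y h => congr1 (fun t : R => t%:C%C) (profile_support l0 h)).
have igc : integrableC lebesgue_rV (fun xi => (profile lam eta xi)%:C%C * cis2pi (dotp x xi)).
  exact: integrableC_cis ip (measurable_dotp x).
rewrite /inv_fourier -[cintegral _]/(integralC lebesgue_rV _) -(integralCZ (cis2pi (- dotp x eta)) igc).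
rewrite -[complex.Re _]/(\int[lebesgue_rV]_xi complex.Re (cis2pi (- dotp x eta) *
  ((profile lam eta xi)%:C%C * cis2pi (dotp x xi)))).
have mc : measurable_fun setT (fun xi => cos (2 * pi * dotp x (xi - eta))).
  apply: (measurableT_comp (@measurable_cos R)); apply: measurable_funM => //.
  under eq_fun do rewrite dotpC dotpBl.
  by apply: measurable_funB => //; exact: measurable_dotpl.
rewrite (@eq_Rintegral _ _ _ lebesgue_rV setT
  (fun xi => profile lam eta xi * cos (2 * pi * dotp x (xi - eta)))); last first.
  move=> xi _; rewrite mulrCA -cis2piD cReM /= mul0r subr0; congr (_ * cos (_ * _)).
  by rewrite ![dotp x _]dotpC dotpBl addrC.
have key xi : 2^-1 * profile lam eta xi <= profile lam eta xi * cos (2 * pi * dotp x (xi - eta)).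
  have [h|h] := pselect (box eta (3 * lam) xi); last by rewrite (profile_support l0 h) mulr0 mul0r.
  rewrite mulrC ler_wpM2l ?profile_ge0//.
  have t8 : `|dotp x (xi - eta)| <= 8^-1.
    have hb : box 0 (3 * lam) (xi - eta) by move=> i; have := h i; rewrite !mxE subr0.
    apply: le_trans (dotp_le x hb) _.
    have -> : n%:R * (3 * lam) * `|x| = n%:R * 3 * (lam * `|x|) by ring.
    apply: (@le_trans _ _ (n.+1%:R * 3 * (24 * n.+1%:R)^-1)).
      by rewrite ler_pM ?mulr_ge0 ?(ltW l0)// ler_wpM2r// ler_nat.
    by apply: le_of_eq; field.
  set t := dotp _ _ in t8 *.
  have := one_minus_cos_le (2 * pi * t).
  have : (2 * pi * t) ^+ 2 <= 1.
    rewrite -(real_normK (num_real _)) exprn_ile1//.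
    rewrite !normrM (ger0_norm (pi_ge0 R)) ger0_norm//.
    have p4 : pi <= 4 :> R.
      by have := @pihalf_lt2 R; rewrite ltr_pdivrMr// => h8; rewrite ltW// (lt_le_trans h8)//; lra.
    apply: (@le_trans _ _ (2 * 4 * 8^-1)); last by lra.
    by rewrite ler_pM ?mulr_ge0 ?pi_ge0// ler_pM2l.
  by move=> h1 h2; lra.
apply: (@le_trans _ _ (\int[lebesgue_rV]_xi (2^-1 * ((lam / 2) ^+ n * (2 * (r * lam)) ^+ n) * \1_(box eta (r * lam)) xi))).
  have rl0 : 0 <= r * lam by rewrite mulr_ge0// ltW.
  rewrite (Rintegral_box_cst _ _ rl0) /c.
  apply: le_of_eq.
  rewrite (_ : (3 * n = n + n + n)%N); last by rewrite !mulSn mul0n addn0 addnA.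
  by rewrite !exprD !exprMn; ring.
have rl0 : 0 <= r * lam by rewrite mulr_ge0// ltW.
apply: le_Rintegral => //.
- exact: integrable_box_cst.
- apply: (@integrable_box_bounded _ _ _ eta (3 * lam) M l30).
  + exact: measurable_funM.
  + move=> xi; rewrite normrM -[leRHS]mulr1 ler_pM//.
    by rewrite ler_norml cos_geN1 cos_le1.
  + by move=> xi xb; rewrite (profile_support l0 xb) mul0r.
move=> xi _; apply: le_trans (key xi); rewrite -mulrA ler_pM2l ?invr_gt0//.
rewrite indicE; case: (boolP (xi \in _)) => h; last by rewrite mulr0 profile_ge0.
rewrite inE in h; rewrite mulr1.
have [W _ WP] := window_bounded.
apply: (@smoothing_lower _ _ lam (ltW l0) (window lam eta) eta (r * lam) xi W) => //.
- exact: measurable_window.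
- exact: window_ge0.
- by rewrite mulrC ler_pM2l// /r lef_pV2 ?posrE ?mulr_gt0// ler_peMr// ler1n.
- move=> zeta hz; apply: window1 => // i; apply: le_trans (hz i) _.
  by rewrite /r; apply: le_of_eq; field.
Qed.

End wave_packets.

(** * Lorentz norms and sequence norms *)

Section sequence_norms.
Context {R : realType}.
Local Open Scope ereal_scope.
Implicit Types w : nat -> \bar R.

(** Hence almost everywhere means everywhere, and the essential supremum is a
    supremum. *)
Lemma counting_eq0 (N : set nat) : counting N = 0 :> \bar R -> N = set0.
Proof.
move=> N0; apply/seteqP; split=> // k Nk; have : counting [set k] = 0 :> \bar R.
  apply/eqP; rewrite -measure_le0 -N0; apply: le_measure; rewrite ?inE//.
  by move=> _ ->.
rewrite /counting; case: ifPn => [_|/asboolPn[]]; last exact: finite_set1.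
by rewrite fset_set1 finmap.cardfs1 => -[] /eqP; rewrite oner_eq0.
Qed.

Lemma Lnorm_counting_sup w : (forall k, 0 <= w k) ->
  Lnorm counting +oo w = ereal_sup (range w).
Proof.
move=> w0; rewrite unlock.
have -> : (0 < counting [set: nat] :> \bar R).
  rewrite lt_neqAle measure_ge0 andbT eq_sym; apply/eqP => /counting_eq0 h.
  by have : [set: nat] 0%N by []; rewrite h.
rewrite (_ : abse \o w = w); last by apply/funext => k /=; rewrite gee0_abs.
apply/eqP; rewrite eq_le; apply/andP; split.
  by apply/ess_sup_inf.ess_supP; apply: aeW => k; apply: ereal_sup_ubound; exists k.
apply: ge_ereal_sup => _ [k _ <-].
have [N [_ N0 h]] := ess_sup_inf.ess_sup_ge (@counting nat R) w.
by rewrite (counting_eq0 N0) in h; apply: contrapT => /h.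
Qed.

Lemma Lnorm_counting_sum w : (forall k, 0 <= w k) ->
  Lnorm counting 1 w = \sum_(k <oo) w k.
Proof.
move=> w0; rewrite Lnorm1 ge0_integral_count//.
by apply: eq_eseriesr => k _; rewrite gee0_abs.
Qed.

End sequence_norms.

Section lorentz.
Context {R : realType} {n : nat} (n_gt0 : (0 < n)%N).
Local Open Scope ereal_scope.
Implicit Types (f : 'rV[R]_n -> \bar R).

Lemma measurable_level f (a : R) : measurable_fun setT f ->
  measurable [set x | a%:E < `|f x|].
Proof.
move=> mf; rewrite -[X in measurable X]setTI; apply: emeasurable_fun_o_infty => //.
exact: measurableT_comp.
Qed.

Lemma measurable_distribution_fun f : measurable_fun setT f ->
  measurable_fun setT (distribution_fun f : measurableTypeR R -> \bar R).
Proof.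
move=> mf.
pose A : set (measurableTypeR R * 'rV[R]_n) := [set z | z.1%:E < `|f z.2|].
have mA : measurable A.
  rewrite -[A]setTI; apply: measurable_lte => //.
    by apply/measurable_EFinP; exact: measurable_fst.
  apply: measurableT_comp => //; exact: (measurableT_comp mf measurable_snd).
rewrite (_ : distribution_fun f = lebesgue_rV \o xsection A).
  exact: measurable_fun_xsection.
by apply/funext => a; rewrite /distribution_fun /= xsectionE.
Qed.

(** The level set at height a lies in the box of radius (B / a) ^ (p / n). *)
Lemma lorentz_weak_le f (p B : R) : measurable_fun setT f ->
  (0 < p)%R -> (0 <= B)%R ->
  (forall x, `|f x| * (`|x| `^ (n%:R / p))%:E <= B%:E) ->
  lorentz_norm p +oo f <= (2 `^ (n%:R / p) * B)%:E.
Proof.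
move=> mf p0 B0 fB; rewrite /lorentz_norm; apply: ge_ereal_sup => _ [a /= + <-].
rewrite in_itv/= andbT => a0.
have n0 : (0 < n%:R :> R)%R by rewrite ltr0n.
have al0 : (0 < n%:R / p)%R by rewrite divr_gt0.
pose r := ((B / a) `^ (n%:R / p)^-1)%R.
have r0 : (0 <= r)%R by exact: powR_ge0.
have Ba0 : (0 <= B / a)%R by rewrite divr_ge0// ltW.
have sub : [set x | a%:E < `|f x|] `<=` box 0%R r.
  move=> x /= ax.
  have {}ax : (`|x| `^ (n%:R / p) <= B / a)%R.
    rewrite ler_pdivlMr// mulrC -lee_fin EFinM.
    by apply: le_trans (fB x); rewrite lee_wpmul2r ?lee_fin ?powR_ge0// ltW.
  have xr : (`|x| <= r)%R.
    rewrite -[leLHS](powRr1 (normr_ge0 x)) -(mulfV (lt0r_neq0 al0)) powRrM.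
    by rewrite ge0_ler_powR ?nnegrE ?powR_ge0// invr_ge0 ltW.
  by rewrite (mx_norm_box x r0) in xr; exact/asboolP.
have d_le : distribution_fun f a <= ((2 * r) ^+ n)%:E.
  rewrite -(lebesgue_rV_box (0%R : 'rV[R]_n) r0); apply: le_measure; rewrite ?inE//.
    exact: measurable_level.
  exact: measurable_box.
have pV0 : (0 <= p^-1)%R by rewrite invr_ge0 ltW.
have : distribution_fun f a `^ p^-1 <= ((2 * r) ^+ n)%:E `^ p^-1.
  by apply: gt0_ler_poweR; rewrite ?in_itv/= ?leey ?andbT ?measure_ge0 ?lee_fin ?exprn_ge0 ?mulr_ge0.
rewrite poweR_EFin -powR_mulrn ?mulr_ge0// -powRrM powRM// /r -powRrM.
rewrite mulVf ?lt0r_neq0// powRr1// => h.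
apply: (@le_trans _ _ (a%:E * (2 `^ (n%:R / p) * (B / a))%:E)).
  by rewrite lee_pmul2l// ?lte_fin.
by rewrite -EFinM lee_fin mulrCA [(a * _)%R]mulrC divfK// lt0r_neq0.
Qed.

Lemma lorentz_integrand_ge f (p a A r : R) z : measurable_fun setT f ->
  (0 < p)%R -> (0 < a)%R -> (a < A)%R -> (0 <= r)%R ->
  (forall x, box z r x -> A%:E <= `|f x|) ->
  ((2 * r) `^ (n%:R / p))%:E <= (a%:E * distribution_fun f a `^ p^-1) `^ 1 * (a^-1)%:E.
Proof.
move=> mf p0 a0 aA r0 fA.
have pV0 : (0 <= p^-1)%R by rewrite invr_ge0 ltW.
rewrite poweRe1; last by rewrite mule_ge0 ?poweR_ge0// lee_fin ltW.
rewrite muleAC -EFinM divff ?lt0r_neq0// mul1e.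
have d_ge : ((2 * r) ^+ n)%:E <= distribution_fun f a.
  rewrite -(lebesgue_rV_box z r0); apply: le_measure; rewrite ?inE.
  - exact: measurable_box.
  - exact: measurable_level.
  - by move=> x /fA; apply: lt_le_trans; rewrite lte_fin.
rewrite powRrM powR_mulrn ?mulr_ge0// -poweR_EFin.
by apply: gt0_ler_poweR; rewrite ?in_itv/= ?leey ?andbT ?measure_ge0 ?lee_fin ?exprn_ge0 ?mulr_ge0.
Qed.

(** Dyadic bands of heights are disjoint, and each of them sees the whole box
    on which the function exceeds its upper end. *)
Lemma lorentz_strong_ge f (p c : R) (N : nat) (A r : nat -> R) (z : nat -> 'rV[R]_n) :
  measurable_fun setT f -> (0 < p)%R ->
  (forall i, 0 < A i)%R -> (forall i, 2 * A i <= A i.+1)%R -> (forall i, 0 <= r i)%R ->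
  (forall i x, (i < N)%N -> box (z i) (r i) x -> (A i)%:E <= `|f x|) ->
  (forall i, (i < N)%N -> c <= (2 * r i) `^ (n%:R / p) * A i)%R ->
  (p * (N%:R * (c / 2)))%:E <= lorentz_norm p 1 f.
Proof.
move=> mf p0 A0 AA r0 fA cA.
rewrite /lorentz_norm invr1 poweRe1; last first.
  apply: mule_ge0; first by rewrite lee_fin ltW.
  by apply: integral_ge0 => a /=; rewrite in_itv/= andbT => a0;
    rewrite mule_ge0 ?poweR_ge0// lee_fin invr_ge0 ltW.
rewrite EFinM lee_pmul2l// ?lte_fin//.
pose h (a : R) : \bar R := (a%:E * distribution_fun f a `^ p^-1) `^ 1 * (a^-1)%:E.
rewrite -/h.
have mh : measurable_fun setT (h : measurableTypeR R -> \bar R).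
  apply: emeasurable_funM; last first.
    by apply/measurable_EFinP; exact: measurable_invr.
  apply: (measurableT_comp (measurable_poweR 1)); apply: emeasurable_funM.
    exact/measurable_EFinP.
  exact: (measurableT_comp (measurable_poweR p^-1) (measurable_distribution_fun mf)).
have h0 (a : R) : (0 < a)%R -> 0 <= h a.
  by move=> a0; rewrite mule_ge0 ?poweR_ge0// lee_fin invr_ge0 ltW.
suff key M : (M <= N)%N ->
    (M%:R * (c / 2))%:E <= \int[lebesgue_measure]_(a in `]0%R, (A M / 2)%R[) h a.
  apply: le_trans (key N (leqnn N)) _; apply: ge0_subset_integral => //.
  - exact: measurable_funS mh.
  - by move=> a /=; rewrite in_itv/= andbT; exact: h0.
  - by move=> a /=; rewrite !in_itv/= andbT => /andP[].
elim: M => [|M IH] MN.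
  by rewrite mul0r; apply: integral_ge0 => a /=; rewrite in_itv/= => /andP[a0 _]; exact: h0.
have AM2 : (0 < A M / 2)%R by rewrite divr_gt0.
pose I1 : set R := `]0%R, (A M / 2)%R[%classic.
pose I2 : set R := `[(A M / 2)%R, A M[%classic.
apply: (@le_trans _ _ (\int[lebesgue_measure]_(a in I1 `|` I2) h a)); last first.
  apply: ge0_subset_integral => //.
  - by apply: measurableU; exact: measurable_itv.
  - exact: measurable_funS mh.
  - by move=> a /=; rewrite in_itv/= => /andP[+ _]; exact: h0.
  - move=> a [|] /=; rewrite !in_itv/= => /andP[a1 a2]; apply/andP; split => //.
    + by apply: lt_le_trans a2 _; rewrite ler_pM2r// (le_trans _ (AA M))// ler_peMl ?ler1n// ltW.
    + exact: lt_le_trans AM2 a1.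
    + by apply: lt_le_trans a2 _; rewrite ler_pdivlMr// mulrC.
rewrite ge0_integral_setU//; last first.
- apply/disj_setPRL => a; rewrite /I1 /I2 /= !in_itv/= => /andP[a1 _] /andP[_ a2].
  by have := lt_le_trans a2 a1; rewrite ltxx.
- move=> a [|]; rewrite /I1 /I2 /= in_itv/= => /andP[a1 a2]; apply: h0 => //.
  exact: lt_le_trans AM2 a1.
- exact: measurable_funS mh.
- exact: measurable_itv.
- exact: measurable_itv.
rewrite -natr1 mulrDl mul1r EFinD; apply: leeD; first by apply: IH; exact: ltnW.
apply: (@le_trans _ _ (\int[lebesgue_measure]_(a in I2) ((2 * r M) `^ (n%:R / p))%:E)).
  have mI2 : measurable I2 by exact: measurable_itv.
  rewrite integral_cst; last exact: mI2.
  rewrite [X in _ * X](lebesgue_measure_itv `[(A M / 2)%R, A M[) /= lte_fin.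
  rewrite ltr_pdivrMr// ltr_pMr ?ltr1n// -EFinB -EFinM lee_fin.
  rewrite (_ : A M - A M / 2 = A M / 2)%R; last by field.
  by rewrite mulrA ler_pM2r// cA.
apply: ge0_le_integral => //.
- exact: measurable_itv.
- by move=> a _; rewrite lee_fin powR_ge0.
- exact: measurable_funS mh.
move=> a; rewrite /I2 /= in_itv/= => /andP[a1 a2].
apply: (@lorentz_integrand_ge f p a (A M) (r M) (z M)) => //; first exact: lt_le_trans AM2 a1.
by move=> x; exact: fA.
Qed.

End lorentz.

Section block_norms.
Context {R : realType} {n : nat} (n_gt0 : (0 < n)%N).
Implicit Types (psi : nat -> 'rV[R]_n -> R[i]) (u : functional R n).

Definition weighted_block psi s u (k : nat) (x : 'rV[R]_n) : R :=
  2 `^ (k%:R * s) * normc (LPblock psi k u x).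

Lemma weighted_block_ge0 psi s u k x : 0 <= weighted_block psi s u k x.
Proof. by rewrite mulr_ge0 ?powR_ge0 ?normc_nneg. Qed.

Lemma LPblock_ccontinuous psi k u : ccontinuous (LPblock psi k u).
Proof.
rewrite /LPblock; case: xgetP => [g _ []//|_].
by split => x; exact: cst_continuous.
Qed.

Lemma measurable_weighted_block psi s u k :
  measurable_fun setT (weighted_block psi s u k).
Proof.
have [h1 h2] := LPblock_ccontinuous psi k u.
have /(measurable_funX 2) m1 := continuous_measurable_rV h1.
have /(measurable_funX 2) m2 := continuous_measurable_rV h2.
apply: measurable_funM => //.
rewrite (_ : (fun _ => _) = (@Num.sqrt R) \o (fun x => complex.Re (LPblock psi k u x) ^+ 2 +
    complex.Im (LPblock psi k u x) ^+ 2)).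
  apply: measurableT_comp; last exact: measurable_funD.
  apply: continuous_measurable_fun; exact: sqrt_continuous.
by apply/funext => x /=; rewrite normc_sqrtE.
Qed.

Lemma TLL_sup_le psi s p u (B : R) : 0 < p -> 0 <= B ->
  (forall k x, weighted_block psi s u k x * `|x| `^ (n%:R / p) <= B) ->
  (TLL_norm psi s +oo p +oo u <= (2 `^ (n%:R / p) * B)%:E)%E.
Proof.
move=> p0 B0 kB; rewrite /TLL_norm.
have E x : Lnorm counting +oo%E (fun j : nat => (weighted_block psi s u j x)%:E) =
    ereal_sup (range (fun j => (weighted_block psi s u j x)%:E)).
  by apply: Lnorm_counting_sup => k; rewrite lee_fin weighted_block_ge0.
have E0 x : (0 <= Lnorm counting +oo%E (fun j : nat => (weighted_block psi s u j x)%:E))%E.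
  exact: Lnorm_ge0.
apply: lorentz_weak_le => //.
  rewrite (_ : (fun x => _) = (fun x => esups (fun k => (weighted_block psi s u k x)%:E) 0)).
    apply: measurable_fun_esups => k; apply/measurable_EFinP.
    exact: measurable_weighted_block.
  by apply/funext => x; rewrite [LHS]E /esups; congr ereal_sup;
    apply/seteqP; split=> _ [k _ <-]; exists k.
move=> x; rewrite [X in (X * _)%E]gee0_abs; last exact: E0.
rewrite [X in (X * _)%E]E muleC.
have [->|x0] := eqVneq (`|x| `^ (n%:R / p)) 0; first by rewrite mul0e.
have xp : 0 < `|x| `^ (n%:R / p) by rewrite lt_neqAle eq_sym x0 powR_ge0.
rewrite -lee_pdivlMl//; apply: ge_ereal_sup => _ [k _ <-].
by rewrite -EFinM lee_fin mulrC ler_pdivlMr.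
Qed.

Lemma TLL_sum_ge psi s p u (c : R) (N : nat) (A r : nat -> R) (z : nat -> 'rV[R]_n) : 0 < p ->
  (forall i, 0 < A i) -> (forall i, 2 * A i <= A i.+1) -> (forall i, 0 <= r i) ->
  (forall i x, (i < N)%N -> box (z i) (r i) x ->
    exists K, A i <= \sum_(0 <= k < K) weighted_block psi s u k x) ->
  (forall i, (i < N)%N -> c <= (2 * r i) `^ (n%:R / p) * A i) ->
  ((p * (N%:R * (c / 2)))%:E <= TLL_norm psi s 1 p 1 u)%E.
Proof.
move=> p0 A0 AA r0 fA cA; rewrite /TLL_norm.
have w0 x k : (0 <= (weighted_block psi s u k x)%:E)%E by rewrite lee_fin weighted_block_ge0.
have E x : Lnorm counting 1%E (fun j : nat => (weighted_block psi s u j x)%:E) =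
    (\sum_(j <oo) (weighted_block psi s u j x)%:E)%E.
  by apply: Lnorm_counting_sum => k.
apply: (@lorentz_strong_ge _ _ _ p c N A r z) => //.
  rewrite (_ : (fun x => _) = (fun x => \sum_(j <oo) (weighted_block psi s u j x)%:E)%E).
    apply: ge0_emeasurable_sum => // k _; apply/measurable_EFinP.
    exact: measurable_weighted_block.
  by apply/funext => x; exact: E.
move=> i x iN xb; rewrite gee0_abs; last exact: Lnorm_ge0.
have [K AK] := fA i x iN xb; rewrite [leRHS]E.
apply: le_trans (nneseries_lim_ge K _) => //.
by rewrite sumEFin lee_fin.
Qed.

(** Turns bounds on the three norms of one distribution into a numerical
    inequality. *)
Lemma interpolation_test psi s s1 s2 p p1 p2 theta C u (B1 B2 D : R) :
  0 < theta < 1 -> 0 < C -> 0 < B1 -> 0 < B2 -> tempered u ->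
  (forall f : functional R n,
     (TLL_space psi s1 +oo%E p1 +oo%E `&` TLL_space psi s2 +oo%E p2 +oo%E) f ->
     (TLL_norm psi s 1%E p 1%E f <=
      C%:E * TLL_norm psi s1 +oo p1 +oo f `^ (1 - theta)
           * TLL_norm psi s2 +oo p2 +oo f `^ theta)%E) ->
  (TLL_norm psi s1 +oo p1 +oo u <= B1%:E)%E ->
  (TLL_norm psi s2 +oo p2 +oo u <= B2%:E)%E ->
  (D%:E <= TLL_norm psi s 1 p 1 u)%E ->
  D <= C * (B1 `^ (1 - theta) * B2 `^ theta).
Proof.
move=> /andP[t0 t1] C0 B10 B20 tu H h1 h2 h3.
have N0 s' p' : (0 <= TLL_norm psi s' +oo p' +oo u)%E.
  apply: ereal_sup_ge; exists (1%:E * distribution_fun (fun x => Lnorm counting +oo%E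
      (fun j : nat => (2 `^ (j%:R * s') * normc (LPblock psi j u x))%:E)) 1 `^ p'^-1)%E.
    by exists 1 => //=; rewrite in_itv/= ltr01.
  by rewrite mule_ge0 ?poweR_ge0.
have := H u; move=> /(_ _) h.
have {h} := h (conj (conj tu (le_lt_trans h1 (ltry _))) (conj tu (le_lt_trans h2 (ltry _)))).
move=> h; rewrite -lee_fin EFinM EFinM -!poweR_EFin.
apply: (le_trans h3); apply: (le_trans h); rewrite -muleA.
have mono (y : \bar R) (b t : R) : (0 <= y)%E -> (y <= b%:E)%E -> 0 <= t -> (y `^ t <= b%:E `^ t)%E.
  move=> y0 yb t_ge0; apply: gt0_ler_poweR => //; rewrite in_itv/= leey andbT //.
  exact: le_trans yb.
rewrite lee_pmul2l ?lte_fin//; apply: lee_pmul; rewrite ?poweR_ge0//.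
  by apply: mono; rewrite ?N0 ?subr_ge0 ?(ltW t1).
by apply: mono; rewrite ?N0 ?(ltW t0).
Qed.

End block_norms.

(** * Superpositions of wave packets *)

Lemma normcD (R : rcfType) (z w : R[i]) : normc (z + w) <= normc z + normc w.
Proof. by have := ler_normD z w; rewrite -rmorphD lecR. Qed.

Lemma normc_sum (R : rcfType) (I : Type) (r : seq I) (P : pred I) (F : I -> R[i]) :
  normc (\sum_(i <- r | P i) F i) <= \sum_(i <- r | P i) normc (F i).
Proof.
elim/big_rec2: _ => [|i y1 y2 _ h]; first by rewrite normc0.
by apply: le_trans (normcD _ _) _; rewrite lerD2l.
Qed.

Lemma Re_sum (R : rcfType) (I : Type) (r : seq I) (P : pred I) (F : I -> R[i]) :
  complex.Re (\sum_(i <- r | P i) F i) = \sum_(i <- r | P i) complex.Re (F i).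
Proof. by elim/big_rec2: _ => [//|i y1 y2 _ <-]; case: y2 (F i) => [a b] [c d]. Qed.

Section superposition.
Context {R : realType} {n : nat} (psi : nat -> 'rV[R]_n -> R[i]).
Hypothesis psiP : LP_partition psi.
Hypothesis n_gt0 : (0 < n)%N.
Implicit Types (x xi eta : 'rV[R]_n) (lam : R).

Definition packet_block k lam eta : 'rV[R]_n -> R[i] :=
  inv_fourier (fun xi => psi k xi * (profile psi lam eta xi)%:C%C).

Definition profile_mass : R := @fejer_mass R ^+ n.

Lemma profile_mass_gt0 : 0 < profile_mass.
Proof. by rewrite exprn_gt0// fejer_mass_gt0. Qed.

Lemma integrableC_profile lam eta : 0 < lam ->
  integrableC lebesgue_rV (fun xi => (profile psi lam eta xi)%:C%C).
Proof.
move=> l0; have [M MP] := profile_bounded psiP eta l0.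
have l30 : 0 <= 3 * lam by rewrite mulr_ge0// ltW.
exact: integrableC_box_bounded l30 (cmeasurable_profile psiP eta l0) MP
    (fun y h => congr1 (fun t : R => t%:C%C) (profile_support psiP l0 h)).
Qed.

Lemma integrableC_block k lam eta x : 0 < lam ->
  integrableC lebesgue_rV (fun xi => psi k xi * (profile psi lam eta xi)%:C%C * cis2pi (dotp x xi)).
Proof.
move=> l0; have [M MP] := LP_bounded psiP.
apply: integrableC_cis; last exact: measurable_dotp.
have := integrableC_bounded (integrableC_profile eta l0) (LP_cmeasurable psiP k) (MP k).
by under eq_fun do rewrite mulrC.
Qed.

Section finite_sum.
Variables (N : nat) (b lam : nat -> R) (eta : nat -> 'rV[R]_n).
Hypothesis lam_gt0 : forall i, 0 < lam i.

(** The normalisation gives the i-th term a height comparable to b_i near the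
    origin. *)
Definition superposition x : R[i] :=
  \sum_(i < N) (b i / lam i ^+ (3 * n))%:C%C * packet psi (lam i) (eta i) x.

Lemma integrableC_superposition : integrableC lebesgue_rV superposition.
Proof.
by apply: integrableC_sum => i; apply: integrableCZ; exact: integrableC_packet.
Qed.

Lemma tempered_superposition : tempered (distr_of superposition).
Proof. by apply: distr_tempered; exact: integrableC_superposition. Qed.

Lemma LPblock_superposition k x : LPblock psi k (distr_of superposition) x =
  profile_mass%:C%C * \sum_(i < N) (b i / lam i ^+ (3 * n))%:C%C * packet_block k (lam i) (eta i) x.
Proof.
pose G xi : R[i] := \sum_(i < N) (b i / lam i ^+ (3 * n))%:C%C * (profile psi (lam i) (eta i) xi)%:C%C.
have mG : cmeasurable G.
  apply: (@integrableC_measurable _ _ _ lebesgue_rV); apply: integrableC_sum => i.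
  by apply: integrableCZ; exact: integrableC_profile.
have [M GM] : exists M, forall xi, norm1 (G xi) <= M.
  rewrite /G; elim: N => [|m [M IH]].
    by exists 0 => xi; rewrite big_ord0 norm1_0.
  have [M' MP] := profile_bounded psiP (eta m) (lam_gt0 m).
  exists (M + norm1 (b m / lam m ^+ (3 * n))%:C%C * M') => xi; rewrite big_ord_recr/=.
  apply: le_trans (norm1D _ _) (lerD (IH xi) _).
  by apply: le_trans (norm1M _ _) _; rewrite ler_wpM2l ?norm1_ge0.
have FG xi : fourier superposition xi = profile_mass%:C%C * G xi.
  rewrite /fourier -[LHS]/(integralC lebesgue_rV _) /superposition.
  under eq_fun do rewrite mulr_suml.
  rewrite integralC_sum; last first.
    move=> i; apply: integrableC_cis; first by apply: integrableCZ; exact: integrableC_packet.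
    exact: measurable_funN (measurable_dotpl xi).
  rewrite /G mulr_sumr; apply: eq_bigr => i _.
  under eq_fun do rewrite -mulrA.
  rewrite integralCZ; last first.
    apply: integrableC_cis; first exact: integrableC_packet.
    exact: measurable_funN (measurable_dotpl xi).
  by rewrite -[integralC _ _]/(fourier _ xi) fourier_packet// mulrCA.
rewrite (LPblock_distr psiP k integrableC_superposition mG GM FG); congr (_ * _).
rewrite /inv_fourier -[LHS]/(integralC lebesgue_rV _) /G.
under eq_fun do rewrite mulr_sumr mulr_suml.
have ib i : integrableC lebesgue_rV (fun xi => psi k xi * (profile psi (lam i) (eta i) xi)%:C%C * cis2pi (dotp x xi)).
  exact: integrableC_block.
under eq_fun => xi do under eq_bigr => i _ do rewrite (mulrCA (psi k xi)) -mulrA.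
rewrite integralC_sum; last by move=> i; exact: integrableCZ.
by apply: eq_bigr => i _; rewrite integralCZ.
Qed.

End finite_sum.

(** y ^ al is at most 1 or at most y ^ n, according to whether y <= 1. *)
Lemma decay_interpolation (v y K al : R) : 0 <= v -> 0 <= y -> 0 <= al <= n%:R ->
  v <= K -> v * y ^+ n <= K -> v * y `^ al <= K.
Proof.
move=> v0 y0 /andP[al0 aln] h1 h2; have [y1|y1] := lerP y 1.
  apply: le_trans h1; rewrite ler_piMr//.
  apply: (@le_trans _ _ (1 `^ al)); last by rewrite powR1.
  by rewrite ge0_ler_powR ?nnegrE.
apply: le_trans h2; rewrite ler_wpM2l// -powR_mulrn//.
by apply: ler_powR => //; exact: ltW.
Qed.

Lemma packet_block_decay : exists2 K, 0 < K & forall lam eta k x al,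
  0 < lam -> lam <= 2 ^+ k -> 0 <= al <= n%:R ->
  normc (packet_block k lam eta x) * `|x| `^ al <= K * lam ^+ (3 * n) * lam `^ (- al).
Proof.
have [K K0 KP] := block_decay psiP n_gt0; exists K => // lam eta k x al l0 lk al0.
have [h1 h2] := KP lam eta k x l0 lk.
have y0 : 0 <= lam * `|x| by rewrite mulr_ge0// ltW.
have := decay_interpolation (normc_nneg _) y0 al0 h1 h2.
rewrite powRM ?(ltW l0)// powRN => h.
by rewrite ler_pdivlMr ?powR_gt0// -mulrA [X in _ * X]mulrC.
Qed.

Lemma norm_inv_fourier_profile_ge : exists d c, [/\ 0 < d, 0 < c & forall lam eta x,
  0 < lam -> lam * `|x| <= d ->
  c * lam ^+ (3 * n) <= normc (inv_fourier (fun xi => (profile psi lam eta xi)%:C%C) x)].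
Proof.
have [d [c [d0 c0 h]]] := packet_lower psiP; exists d, c; split=> // lam eta x l0 lx.
apply: le_trans (h lam eta x l0 lx) _; apply: le_trans (ler_norm _) _.
by apply: le_trans (Re_le_normc _) _; rewrite normcM normc_cis2pi mul1r.
Qed.

(** A frequency in the middle of the j-th dyadic shell. *)
Definition carrier (j : nat) : 'rV[R]_n :=
  (3 / 2 * 2 ^+ j) *: delta_mx ord0 (Ordinal n_gt0).

(** The factor 12 n makes 3 lam at most 2^j / 4, and the contribution of the
    other coordinates to the Euclidean norm too small to leave the shell. *)
Lemma carrier_box j lam xi : 0 < lam -> lam <= 2 ^+ j / (12 * n%:R) ->
  box (carrier j) (3 * lam) xi -> 2 ^+ j < euclid xi < 2 ^+ j.+1.
Proof.
move=> l0 lj xb; set t : R := 2 ^+ j; have t0 : 0 < t by rewrite exprn_gt0.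
have n1 : 1 <= n%:R :> R by rewrite ler1n.
have l3 : 3 * lam * n%:R <= t / 4.
  have := lj; rewrite ler_pdivlMr ?mulr_gt0 ?(lt_le_trans _ n1)// => h.
  by rewrite ler_pdivlMr//; apply: le_trans h; apply: le_of_eq; ring.
have l3' : 3 * lam <= t / 4.
  by apply: le_trans l3; rewrite ler_peMr// mulr_ge0// ltW.
set i0 := Ordinal n_gt0.
have x0 : `|xi ord0 i0 - 3 / 2 * t| <= t / 4.
  by have := xb i0; rewrite !mxE !eqxx mulr1 => h; exact: le_trans h l3'.
have xi' i : i != i0 -> `|xi ord0 i| <= 3 * lam.
  by move=> ii; have := xb i; rewrite !mxE eqxx (negbTE ii) mulr0 subr0.
move: x0; rewrite ler_distl => /andP[x01 x02].
apply/andP; split.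
  apply: lt_le_trans (coord_le_euclid xi i0); apply: lt_le_trans (ler_norm _).
  by apply: lt_le_trans x01; lra.
rewrite -[ltRHS]ger0_norm ?exprn_ge0// -sqrtr_sqr /euclid ltr_sqrt ?exprn_gt0//.
rewrite (bigD1 i0)//=.
apply: (@le_lt_trans _ _ ((7 / 4 * t) ^+ 2 + \sum_(i < n | i != i0) (3 * lam) ^+ 2)).
  apply: lerD.
    by rewrite lerXn2r ?nnegrE; lra.
  by apply: ler_sum => i /xi' h; rewrite -(real_normK (num_real _)) lerXn2r ?nnegrE ?mulr_ge0 ?(ltW l0).
apply: (@le_lt_trans _ _ ((7 / 4 * t) ^+ 2 + (t / 4) ^+ 2)).
  rewrite lerD2l; apply: (@le_trans _ _ (\sum_(i < n) (3 * lam) ^+ 2)).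
    by rewrite [leRHS](bigD1 i0)//= lerDr sqr_ge0.
  rewrite sumr_const card_ord -mulr_natl.
  apply: (@le_trans _ _ ((3 * lam * n%:R) * (3 * lam))).
    by apply: le_of_eq; ring.
  by rewrite expr2 ler_pM ?mulr_ge0 ?(ltW l0).
rewrite [2 ^+ j.+1]exprS -/t -subr_gt0.
rewrite (_ : _ - _ = 7 / 8 * t ^+ 2); last by field.
by rewrite mulr_gt0 ?exprn_gt0.
Qed.

Lemma high_block_zero j k lam x : (0 < j)%N -> 0 < lam -> lam <= 2 ^+ j / (12 * n%:R) ->
  k != j -> k != j.+1 -> packet_block k lam (carrier j) x = 0.
Proof.
move=> j0 l0 lj kj kj1; rewrite /packet_block /inv_fourier -[LHS]/(integralC lebesgue_rV _).
transitivity (integralC lebesgue_rV (fun _ : 'rV[R]_n => 0)); last exact: integralC0.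
congr integralC; apply/funext => xi.
have [h|h] := pselect (box (carrier j) (3 * lam) xi).
  by rewrite (LP_high psiP j0 (carrier_box l0 lj h)).1// !mul0r.
by rewrite (profile_support psiP l0 h) mulr0 mul0r.
Qed.

Lemma high_block_sum j lam x : (0 < j)%N -> 0 < lam -> lam <= 2 ^+ j / (12 * n%:R) ->
  packet_block j lam (carrier j) x + packet_block j.+1 lam (carrier j) x =
  inv_fourier (fun xi => (profile psi lam (carrier j) xi)%:C%C) x.
Proof.
move=> j0 l0 lj; have := integralCD (integrableC_block j (carrier j) x l0)
  (integrableC_block j.+1 (carrier j) x l0).
rewrite -[integralC lebesgue_rV _ + _]/(packet_block j lam (carrier j) x +
  packet_block j.+1 lam (carrier j) x) => <-.
rewrite /inv_fourier -[RHS]/(integralC lebesgue_rV _); congr integralC; apply/funext => xi.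
rewrite -!mulrDl; have [h|h] := pselect (box (carrier j) (3 * lam) xi).
  by rewrite (LP_high psiP j0 (carrier_box l0 lj h)).2 mul1r.
by rewrite (profile_support psiP l0 h) !mulr0 mul0r.
Qed.

Lemma low_block lam x : 0 < lam -> 3 * n%:R * lam < 1 ->
  (forall k, (0 < k)%N -> packet_block k lam 0 x = 0) /\
  packet_block 0 lam 0 x = inv_fourier (fun xi => (profile psi lam 0 xi)%:C%C) x.
Proof.
move=> l0 nl.
have low xi : box 0 (3 * lam) xi -> euclid xi < 1.
  move=> h; apply: le_lt_trans (euclid_box _ h) _; first by rewrite mulr_ge0// ltW.
  by apply: le_lt_trans nl; apply: le_of_eq; ring.
split=> [k k0|]; rewrite /packet_block /inv_fourier -[LHS]/(integralC lebesgue_rV _).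
  transitivity (integralC lebesgue_rV (fun _ : 'rV[R]_n => 0)); last exact: integralC0.
  congr integralC; apply/funext => xi.
  have [h|h] := pselect (box 0 (3 * lam) xi).
    by rewrite (LP_low psiP (low _ h)).2// !mul0r.
  by rewrite (profile_support psiP l0 h) mulr0 mul0r.
rewrite -[RHS]/(integralC lebesgue_rV _); congr integralC; apply/funext => xi.
have [h|h] := pselect (box 0 (3 * lam) xi).
  by rewrite (LP_low psiP (low _ h)).1 mul1r.
by rewrite (profile_support psiP l0 h) mulr0.
Qed.

End superposition.

(** * Packets in separate dyadic shells *)

Lemma powR_inv (R : realType) (x a : R) : 0 <= x -> x^-1 `^ a = x `^ (- a).
Proof. by move=> x0; rewrite -(powR_inv1 x0) -powRrM mulN1r. Qed.

Section high_frequency_family.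
Context {R : realType} {n : nat} (psi : nat -> 'rV[R]_n -> R[i]).
Hypothesis psiP : LP_partition psi.
Hypothesis n_gt0 : (0 < n)%N.
Implicit Types (x : 'rV[R]_n) (b lam : nat -> R) (j : nat -> nat) (s p : R).
Local Notation mass := (@profile_mass R n).

(** Frequencies far enough apart not to share a Littlewood-Paley block, and
    bandwidths small enough to stay inside one dyadic shell. *)
Definition shell_separated b lam j : Prop :=
  [/\ forall i, 0 < b i, forall i, 0 < lam i,
      forall i, lam i <= 2 ^+ j i / (12 * n%:R),
      forall i, (0 < j i)%N & forall i, (j i + 2 <= j i.+1)%N].

Definition high_distr N b lam j : functional R n :=
  distr_of (superposition psi N b lam (fun i => carrier n_gt0 (j i))).

Lemma shell_separated_lt j i i' : (forall i, (j i + 2 <= j i.+1)%N) -> (i < i')%N ->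
  (j i + 2 <= j i')%N.
Proof.
move=> jj; elim: i' => // i' IH; rewrite ltnS leq_eqVlt => /predU1P[->//|/IH h].
by apply: leq_trans h _; apply: leq_trans (jj i'); exact: leq_addr.
Qed.

Lemma bandwidth_le b lam j i k : shell_separated b lam j -> (j i <= k)%N -> lam i <= 2 ^+ k.
Proof.
case=> _ _ /(_ i) h _ _ jk; apply: le_trans h _.
apply: (@le_trans _ _ (2 ^+ j i)); last by rewrite ler_eXn2l// ltr1n.
have n1 : 1 <= n%:R :> R by rewrite ler1n.
rewrite ler_pdivrMr; last by rewrite mulr_gt0// (lt_le_trans _ n1).
by rewrite ler_peMr ?exprn_ge0//; lra.
Qed.

Lemma high_block N b lam j s i k x : shell_separated b lam j -> (i < N)%N ->
  k = j i \/ k = (j i).+1 ->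
  weighted_block psi s (high_distr N b lam j) k x =
  2 `^ (k%:R * s) * (mass * (b i / lam i ^+ (3 * n)) *
    normc (packet_block psi k (lam i) (carrier n_gt0 (j i)) x)).
Proof.
move=> sep iN kj; have [b0 l0 lj j0 jj] := sep.
rewrite /weighted_block LPblock_superposition//.
have -> : \sum_(i < N) (b i / lam i ^+ (3 * n))%:C%C * packet_block psi k (lam i) (carrier n_gt0 (j i)) x =
    (b i / lam i ^+ (3 * n))%:C%C * packet_block psi k (lam i) (carrier n_gt0 (j i)) x.
  rewrite (bigD1 (Ordinal iN))//= big1 ?addr0// => i' ii'.
  have {}ii' : (i' != i :> nat) by [].
  have [k1 k2] : k != j i' /\ k != (j i').+1.
    move: ii'; rewrite neq_ltn => /orP[] /(shell_separated_lt jj) h; split; apply/eqP; lia.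
  by rewrite (high_block_zero psiP n_gt0 x (j0 i') (l0 i') (lj i') k1 k2) mulr0.
rewrite !normcM !normc_real ger0_norm; last exact: ltW (@profile_mass_gt0 R n).
rewrite ger0_norm; last by rewrite divr_ge0 ?exprn_ge0 ?ltW.
by rewrite !mulrA.
Qed.

Lemma high_block0 N b lam j s k x : shell_separated b lam j ->
  (forall i, (i < N)%N -> k <> j i /\ k <> (j i).+1) ->
  weighted_block psi s (high_distr N b lam j) k x = 0.
Proof.
move=> [b0 l0 lj j0 jj] kj; rewrite /weighted_block LPblock_superposition//.
rewrite big1 ?mulr0 ?normc0 ?mulr0// => i _; have [/eqP h1 /eqP h2] := kj i (ltn_ord i).
by rewrite (high_block_zero psiP n_gt0 x (j0 i) (l0 i) (lj i))// mulr0.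
Qed.

Lemma powR2_succ (s : R) (j k : nat) : k = j \/ k = j.+1 ->
  2 `^ (- `|s|) * 2 `^ (j%:R * s) <= 2 `^ (k%:R * s) <= 2 `^ `|s| * 2 `^ (j%:R * s).
Proof.
move=> kj; have t0 : (2 : R) != 0 by [].
rewrite -!powRD ?t0 ?implybT//.
have h : - `|s| + j%:R * s <= k%:R * s <= `|s| + j%:R * s.
  have s1 := ler_norm s; have s2 := ler_norm (- s); rewrite normrN in s2.
  have s3 := normr_ge0 s.
  by case: kj => ->; rewrite -?natr1 ?mulrDl ?mul1r; apply/andP; split; lra.
by case/andP: h => h1 h2; rewrite !ler_powR ?ler1n.
Qed.

(** The blocks of distinct packets are disjoint, so only the decay of a single
    packet matters: it is interpolated to the order n / p. *)
Lemma high_upper s p : 1 < p -> exists2 K, 0 < K & forall N b lam j B,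
  shell_separated b lam j -> 0 <= B ->
  (forall i, (i < N)%N -> b i * 2 `^ ((j i)%:R * s) * lam i `^ (- (n%:R / p)) <= B) ->
  (TLL_norm psi s +oo p +oo (high_distr N b lam j) <= (K * B)%:E)%E.
Proof.
move=> p1; have p0 : 0 < p by lra.
have [K K0 KP] := packet_block_decay psiP n_gt0.
have al : 0 <= n%:R / p <= n%:R.
  by rewrite divr_ge0 ?(ltW p0)//= ler_pdivrMr// ler_peMr// ltW.
have m0 := @profile_mass_gt0 R n.
exists (2 `^ (n%:R / p) * (2 `^ `|s| * mass * K)).
  by rewrite !mulr_gt0 ?powR_gt0.
move=> N b lam j B sep B0 hB; rewrite -[(_ * _ * B)]mulrA.
have := @TLL_sup_le _ _ n_gt0 psi s p (high_distr N b lam j) (2 `^ `|s| * mass * K * B) p0; apply.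
  by rewrite mulr_ge0// ltW// !mulr_gt0 ?powR_gt0.
move=> k x; have [[i [iN kj]]|none] := pselect (exists i, (i < N)%N /\ (k = j i \/ k = (j i).+1)); last first.
  rewrite high_block0// ?mul0r; first by rewrite mulr_ge0// ltW// !mulr_gt0 ?powR_gt0.
  by move=> i iN; split=> kj; apply: none; exists i; split => //; [left|right].
rewrite (high_block s x sep iN kj).
have [b0 l0 lj j0 jj] := sep.
have lk : lam i <= 2 ^+ k by apply: (bandwidth_le sep); case: kj => ->.
have h := KP (lam i) (carrier n_gt0 (j i)) k x (n%:R / p) (l0 i) lk al.
have /andP[_ p2] := powR2_succ s kj.
have c0 : 0 <= mass * (b i / lam i ^+ (3 * n)).
  by rewrite ltW// mulr_gt0// divr_gt0// exprn_gt0.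
rewrite -[leRHS]mulrA -[leRHS]mulrA -[leLHS]mulrA -[X in _ * X]mulrA.
apply: (@le_trans _ _ (2 `^ (k%:R * s) * (mass * (b i / lam i ^+ (3 * n)) *
    (K * lam i ^+ (3 * n) * lam i `^ (- (n%:R / p)))))).
  by rewrite ler_wpM2l ?powR_ge0// ler_wpM2l.
have -> : 2 `^ (k%:R * s) * (mass * (b i / lam i ^+ (3 * n)) *
    (K * lam i ^+ (3 * n) * lam i `^ (- (n%:R / p)))) =
    2 `^ (k%:R * s) * (mass * K * (b i * lam i `^ (- (n%:R / p)))).
  by field; rewrite expf_neq0// gt_eqF.
apply: (@le_trans _ _ (2 `^ `|s| * 2 `^ ((j i)%:R * s) * (mass * K * (b i * lam i `^ (- (n%:R / p)))))).
  by rewrite ler_wpM2r// ltW// !mulr_gt0 ?powR_gt0.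
have -> : 2 `^ `|s| * 2 `^ ((j i)%:R * s) * (mass * K * (b i * lam i `^ (- (n%:R / p)))) =
  2 `^ `|s| * (mass * (K * (b i * 2 `^ ((j i)%:R * s) * lam i `^ (- (n%:R / p))))) by ring.
by rewrite !ler_wpM2l ?powR_ge0 ?(ltW m0) ?(ltW K0)// hB.
Qed.

(** Two consecutive blocks add up to the whole packet. *)
Lemma high_lower s : exists d c, [/\ 0 < d, 0 < c & forall N b lam j i x,
  shell_separated b lam j -> (i < N)%N -> lam i * `|x| <= d ->
  c * (b i * 2 `^ ((j i)%:R * s)) <= weighted_block psi s (high_distr N b lam j) (j i) x +
    weighted_block psi s (high_distr N b lam j) (j i).+1 x].
Proof.
have [d [c [d0 c0 dc]]] := norm_inv_fourier_profile_ge psiP.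
have m0 := @profile_mass_gt0 R n.
exists d, (2 `^ (- `|s|) * mass * c); split=> //.
  by rewrite !mulr_gt0 ?powR_gt0.
move=> N b lam j i x sep iN lx; have [b0 l0 lj j0 jj] := sep.
rewrite (high_block s x sep iN (or_introl erefl)) (high_block s x sep iN (or_intror erefl)).
set v := normc _; set v' := normc _.
have vv : c * lam i ^+ (3 * n) <= v + v'.
  apply: le_trans (dc (lam i) (carrier n_gt0 (j i)) x (l0 i) lx) _.
  by rewrite -(high_block_sum psiP n_gt0 x (j0 i) (l0 i) (lj i)); exact: normcD.
have /andP[p1 _] := powR2_succ s (or_introl (erefl (j i))).
have /andP[p2 _] := powR2_succ s (or_intror (erefl (j i).+1)).
set a := 2 `^ (- `|s|) * _ in p1 p2.
have k0 : 0 <= mass * (b i / lam i ^+ (3 * n)).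
  by rewrite ltW// mulr_gt0// divr_gt0// exprn_gt0.
apply: (@le_trans _ _ (a * (mass * (b i / lam i ^+ (3 * n)) * v) +
                       a * (mass * (b i / lam i ^+ (3 * n)) * v'))); last first.
  by apply: lerD; rewrite ler_wpM2r// mulr_ge0// normc_nneg.
rewrite -mulrDr -mulrDr.
apply: (@le_trans _ _ (a * (mass * (b i / lam i ^+ (3 * n)) * (c * lam i ^+ (3 * n))))).
  apply: le_of_eq; rewrite /a.
  by field; rewrite expf_neq0// gt_eqF.
rewrite ler_wpM2l//; last by rewrite ler_wpM2l.
by rewrite /a mulr_ge0 ?powR_ge0.
Qed.

(** Packets whose heights grow geometrically live on different dyadic levels. *)
Lemma high_lacunary s p : 1 < p -> exists2 c, 0 < c & forall N b lam j D,
  shell_separated b lam j -> 0 <= D ->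
  (forall i, 2 * (b i * 2 `^ ((j i)%:R * s)) <= b i.+1 * 2 `^ ((j i.+1)%:R * s)) ->
  (forall i, (i < N)%N -> D <= b i * 2 `^ ((j i)%:R * s) * lam i `^ (- (n%:R / p))) ->
  ((c * N%:R * D)%:E <= TLL_norm psi s 1 p 1 (high_distr N b lam j))%E.
Proof.
move=> p1; have p0 : 0 < p by lra.
have [d [c [d0 c0 dc]]] := high_lower s.
exists (p * ((2 * d) `^ (n%:R / p) * c / 2)).
  by rewrite !mulr_gt0 ?powR_gt0 ?mulr_gt0.
move=> N b lam j D sep D0 bb hD; have [b0 l0 lj j0 jj] := sep.
have -> : p * ((2 * d) `^ (n%:R / p) * c / 2) * N%:R * D =
  p * (N%:R * ((2 * d) `^ (n%:R / p) * c * D / 2)) by ring.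
apply: (@TLL_sum_ge _ _ _ _ _ _ _ _ (fun i => c * (b i * 2 `^ ((j i)%:R * s)))
  (fun i => d / lam i) (fun=> 0)) => //.
- by move=> i; rewrite !mulr_gt0 ?powR_gt0.
- by move=> i; rewrite mulrCA ler_pM2l.
- by move=> i; rewrite divr_ge0// ltW.
- move=> i x iN xb.
  have r0 : 0 <= d / lam i by rewrite divr_ge0// ltW.
  have xd : lam i * `|x| <= d.
    by rewrite mulrC -ler_pdivlMr// (mx_norm_box x r0); exact/asboolP.
  exists (j i).+2; rewrite 2?big_nat_recr//=; apply: le_trans (dc N b lam j i x sep iN xd) _.
  rewrite -addrA lerDr; apply: sumr_ge0 => k _; exact: weighted_block_ge0.
move=> i iN; have -> : (2 * (d / lam i)) `^ (n%:R / p) = (2 * d) `^ (n%:R / p) * lam i `^ (- (n%:R / p)).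
  rewrite mulrA powRM ?mulr_ge0 ?(ltW d0) ?invr_ge0 ?(ltW (l0 i))//.
  by rewrite powR_inv// ltW.
have -> : (2 * d) `^ (n%:R / p) * lam i `^ (- (n%:R / p)) * (c * (b i * 2 `^ ((j i)%:R * s))) =
  (2 * d) `^ (n%:R / p) * c * (b i * 2 `^ ((j i)%:R * s) * lam i `^ (- (n%:R / p))) by ring.
by rewrite ler_wpM2l ?hD// mulr_ge0 ?powR_ge0 ?(ltW c0).
Qed.

End high_frequency_family.
Arguments shell_separated {R} n b lam j.

(** * Packets at frequency zero *)

Section geometric_sums.
Context {R : realType}.

(** The increments of z / (1 + z) along a geometric progression dominate
    min z 1/z, and they telescope. *)
Lemma sum_min_geometric (Q z : R) (N : nat) : 1 < Q -> 0 < z ->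
  \sum_(i < N) Num.min (z * Q ^+ i) (z * Q ^+ i)^-1 <= 2 * (1 + Q) / (Q - 1).
Proof.
move=> Q1 z0; set C := 2 * (1 + Q) / (Q - 1).
have C0 : 0 < C by rewrite divr_gt0; lra.
pose phi (t : R) := t / (1 + t).
have step (t : R) : 0 < t -> Num.min t t^-1 <= C * (phi (t * Q) - phi t).
  move=> t0; have -> : C * (phi (t * Q) - phi t) = 2 * (1 + Q) * t / ((1 + t * Q) * (1 + t)).
    rewrite /C /phi; field; rewrite !gt_eqF ?subr_gt0 //=; nra.
  have den : 0 < (1 + t * Q) * (1 + t) by rewrite mulr_gt0//; nra.
  rewrite ler_pdivlMr//; have [t1|t1] := lerP t 1.
    apply: (@le_trans _ _ (t * ((1 + t * Q) * (1 + t)))).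
      by rewrite ler_wpM2r ?ge_min ?lexx// ltW.
    rewrite (_ : 2 * (1 + Q) * t = t * ((1 + Q) * 2)); last by ring.
    by rewrite ler_wpM2l ?(ltW t0)// ler_pM//; nra.
  apply: (@le_trans _ _ (t^-1 * ((1 + t * Q) * (1 + t)))).
    by rewrite ler_wpM2r ?ge_min ?lexx ?orbT// ltW.
  rewrite mulrC ler_pdivrMr//.
  rewrite (_ : 2 * (1 + Q) * t * t = (t * (1 + Q)) * (2 * t)); last by ring.
  by rewrite ler_pM//; nra.
have zi i : 0 < z * Q ^+ i by rewrite mulr_gt0// exprn_gt0; lra.
have tele : \sum_(i < N) Num.min (z * Q ^+ i) (z * Q ^+ i)^-1 <= C * (phi (z * Q ^+ N) - phi z).
  elim: N => [|N IH]; first by rewrite big_ord0 expr0 mulr1 subrr mulr0.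
  rewrite big_ord_recr/=; apply: le_trans (lerD IH (step _ (zi N))) _.
  by rewrite -mulrA -exprSr -mulrDr; apply: le_of_eq; congr (_ * _); ring.
apply: le_trans tele _; rewrite -[leRHS]mulr1 ler_wpM2l ?(ltW C0)//.
have p1 : phi (z * Q ^+ N) <= 1.
  by rewrite /phi ler_pdivrMr ?mul1r; have := zi N; lra.
have p0 : 0 <= phi z by rewrite /phi divr_ge0; lra.
lra.
Qed.

End geometric_sums.

Section low_frequency_family.
Context {R : realType} {n : nat} (psi : nat -> 'rV[R]_n -> R[i]).
Hypothesis psiP : LP_partition psi.
Hypothesis n_gt0 : (0 < n)%N.
Implicit Types (x : 'rV[R]_n) (s p q : R).
Local Notation mass := (@profile_mass R n).

(** Packets at frequency zero, with bandwidths in geometric progression and with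
    heights that give all of them the same size in weak L^(n / al). *)
Definition low_distr N (al lam q : R) : functional R n :=
  distr_of (superposition psi N (fun i => (lam * q ^+ i) `^ al) (fun i => lam * q ^+ i) (fun=> 0)).

Definition low_packet (lam : R) : 'rV[R]_n -> R[i] :=
  inv_fourier (fun xi => (profile psi lam 0 xi)%:C%C).

Section fixed_family.
Variables (N : nat) (al lam q : R).
Hypotheses (lam_gt0 : 0 < lam) (q_gt1 : 1 < q) (low : 3 * n%:R * (lam * q ^+ N) <= 1).

Let l0 i : 0 < lam * q ^+ i.
Proof. by rewrite mulr_gt0// exprn_gt0// (lt_trans ltr01). Qed.

Let ll i : (i < N)%N -> 3 * n%:R * (lam * q ^+ i) < 1.
Proof.
move=> iN; apply: lt_le_trans low; rewrite ltr_pM2l; last by rewrite mulr_gt0// ltr0n.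
by rewrite ltr_pM2l// ltr_eXn2l.
Qed.

Lemma low_weighted0 s k x : (0 < k)%N -> weighted_block psi s (low_distr N al lam q) k x = 0.
Proof.
move=> k0; rewrite /weighted_block LPblock_superposition//.
rewrite big1 ?mulr0 ?normc0 ?mulr0// => i _.
by rewrite (low_block psiP x (l0 i) (ll (ltn_ord i))).1// mulr0.
Qed.

Lemma low_weighted s x : weighted_block psi s (low_distr N al lam q) 0 x =
  mass * normc (\sum_(i < N) ((lam * q ^+ i) `^ al / (lam * q ^+ i) ^+ (3 * n))%:C%C *
    low_packet (lam * q ^+ i) x).
Proof.
rewrite /weighted_block LPblock_superposition// mul0r powRr0 mul1r normcM normc_real.
rewrite ger0_norm; last exact: ltW (@profile_mass_gt0 R n).
congr (_ * normc _); apply: eq_bigr => i _.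
by rewrite (low_block psiP x (l0 i) (ll (ltn_ord i))).2.
Qed.

Lemma low_packetE i x : (i < N)%N -> low_packet (lam * q ^+ i) x = packet_block psi 0 (lam * q ^+ i) 0 x.
Proof. by move=> iN; rewrite (low_block psiP x (l0 i) (ll iN)).2. Qed.

End fixed_family.

(** Relative to |x| ^ (- n / p), the i-th packet contributes at most a power of
    min y 1/y with y = lam q^i |x|; the sum over i is geometric. *)
Lemma low_upper s p q al : 1 < p -> 1 < q -> exists2 K, 0 < K & forall N lam B,
  0 < lam -> 3 * n%:R * (lam * q ^+ N) <= 1 -> 0 <= B ->
  (forall i, (i < N)%N -> (lam * q ^+ i) `^ al * (lam * q ^+ i) `^ (- (n%:R / p)) <= B) ->
  (TLL_norm psi s +oo p +oo (low_distr N al lam q) <= (K * B)%:E)%E.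
Proof.
move=> p1 q1; have p0 : 0 < p by lra.
have [K K0 KP] := block_decay psiP n_gt0.
have n0 : 0 < n%:R :> R by rewrite ltr0n.
set ga := n%:R / p; have ga0 : 0 < ga by rewrite divr_gt0.
have gan : ga < n%:R by rewrite ltr_pdivrMr// ltr_pMr.
(* The decay on either side of y = 1 has its own exponent; the smaller one
   serves both. *)
pose be := Num.min ga (n%:R - ga).
have be0 : 0 < be by rewrite lt_min ga0 subr_gt0.
have beg : be <= ga by rewrite ge_min lexx.
have ben : be <= n%:R - ga by rewrite ge_min lexx orbT.
pose Q := q `^ be; have Q1 : 1 < Q.
  apply: (@le_lt_trans _ _ (1 `^ be)); first by rewrite powR1.
  by rewrite gt0_ltr_powR ?nnegrE//; lra.
pose S := 2 * (1 + Q) / (Q - 1).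
have S0 : 0 < S by rewrite divr_gt0; lra.
have m0 := @profile_mass_gt0 R n.
exists (2 `^ ga * (mass * K * S)); first by rewrite mulr_gt0 ?powR_gt0// mulr_gt0// mulr_gt0.
move=> N lam B l0 low B0 hB; rewrite -[(_ * _ * B)]mulrA.
have li i : 0 < lam * q ^+ i by rewrite mulr_gt0// exprn_gt0// (lt_trans ltr01).
have T0 : 0 <= mass * K * S * B by rewrite mulr_ge0// ltW// mulr_gt0// mulr_gt0.
have := @TLL_sup_le _ _ n_gt0 psi s p (low_distr N al lam q) (mass * K * S * B) p0; apply.
  exact: T0.
move=> [|k] x; last by rewrite low_weighted0// mul0r.
have [->|x0] := eqVneq x 0.
  by rewrite normr0 powR0 ?gt_eqF// mulr0.
have nx : 0 < `|x| by rewrite normr_gt0.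
rewrite low_weighted// -mulrA (_ : mass * K * S * B = mass * (K * B * S)); last by ring.
rewrite ler_wpM2l ?(ltW m0)//.
apply: le_trans (ler_wpM2r (powR_ge0 _ _) (normc_sum _ _ _)) _.
rewrite mulr_suml.
pose z := (lam * `|x|) `^ be.
have z0 : 0 < z by rewrite powR_gt0// mulr_gt0.
apply: (@le_trans _ _ (\sum_(i < N) K * B * Num.min (z * Q ^+ i) (z * Q ^+ i)^-1)); last first.
  rewrite -mulr_sumr ler_wpM2l ?mulr_ge0 ?(ltW K0)//.
  exact: sum_min_geometric.
apply: ler_sum => i _; have iN := ltn_ord i.
set la := lam * q ^+ i; have la0 : 0 < la by exact: li.
set y := la * `|x|; have y0 : 0 < y by rewrite mulr_gt0.
have zy : z * Q ^+ i = y `^ be.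
  rewrite /z /Q -powR_mulrn ?powR_ge0// powRAC -powRM ?powR_ge0 ?mulr_ge0 ?(ltW l0)//.
  by rewrite powR_mulrn; [rewrite /y /la mulrAC|lra].
have lk : la <= 2 ^+ 0.
  rewrite expr0; have n1 : 1 <= n%:R :> R by rewrite ler1n.
  have := low; have : la <= lam * q ^+ N.
    by rewrite /la ler_pM2l// ler_eXn2l// ltnW.
  by have := la0; nra.
have [v1 v2] := KP la 0 0%N x la0 lk.
rewrite zy normcM normc_real (low_packetE l0 q1 low x iN).
have c0 : 0 < la `^ al / la ^+ (3 * n) by rewrite divr_gt0 ?powR_gt0 ?exprn_gt0.
rewrite (ger0_norm (ltW c0)).
rewrite -[inv_fourier _ x]/(packet_block psi 0 la 0 x) -/y in v1 v2.
set v := normc _ in v1 v2 *; have v0 : 0 <= v by exact: normc_nneg.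
have xy : `|x| `^ ga = la `^ (- ga) * y `^ ga.
  have e : y `^ ga = la `^ ga * `|x| `^ ga := powRM ga (ltW la0) (normr_ge0 x).
  have f : la `^ (- ga) = (la `^ ga)^-1 := powRN la ga.
  by rewrite e f mulKf// gt_eqF// powR_gt0.
have key : v * y `^ ga <= K * la ^+ (3 * n) * Num.min (y `^ be) (y `^ be)^-1.
  have l30 : 0 <= la ^+ (3 * n) by rewrite exprn_ge0// ltW.
  rewrite -powRN; have [y1|y1] := lerP y 1.
    have h : y `^ ga <= Num.min (y `^ be) (y `^ (- be)).
      rewrite le_min; apply/andP; split; apply: ger_powR; rewrite ?y0 ?y1//; lra.
    by rewrite ler_pM ?powR_ge0.
  have h : y `^ (ga - n%:R) <= Num.min (y `^ be) (y `^ (- be)).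
    by rewrite le_min; apply/andP; split; apply: ler_powR; rewrite ?(ltW y1)//; lra.
  have -> : v * y `^ ga = v * y ^+ n * y `^ (ga - n%:R).
    rewrite -mulrA -powR_mulrn ?(ltW y0)// -powRD ?subrKC//.
    by rewrite (gt_eqF y0) implybT.
  by rewrite ler_pM ?powR_ge0 ?mulr_ge0 ?exprn_ge0 ?(ltW y0).
rewrite xy.
have -> : la `^ al / la ^+ (3 * n) * v * (la `^ (- ga) * y `^ ga) =
  la `^ al * la `^ (- ga) * ((v * y `^ ga) / la ^+ (3 * n)) by field; rewrite expf_neq0// gt_eqF.
apply: (@le_trans _ _ (B * (K * Num.min (y `^ be) (y `^ be)^-1))); last first.
  by apply: le_of_eq; ring.
rewrite ler_pM ?mulr_ge0 ?powR_ge0 ?invr_ge0 ?exprn_ge0 ?(ltW la0)//; first exact: hB.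
by rewrite ler_pdivrMr ?exprn_gt0// mulrAC.
Qed.

Lemma exists_ratio (al be w : R) : 0 < al -> 0 < be -> 0 < w ->
  exists q : R, [/\ 1 < q, 2 <= q `^ al & q `^ (- be) <= w].
Proof.
move=> a0 b0 w0; pose q1 : R := 2 `^ al^-1; pose q2 := w^-1 `^ be^-1.
have q10 : 1 < q1.
  apply: (@le_lt_trans _ _ (1 `^ al^-1)); first by rewrite powR1.
  by rewrite gt0_ltr_powR ?nnegrE ?invr_gt0//; lra.
have q20 : 0 < q2 by rewrite powR_gt0// invr_gt0.
exists (q1 + q2); split; first lra.
  apply: (@le_trans _ _ (q1 `^ al)).
    by rewrite /q1 -powRrM mulVf ?powRr1// gt_eqF.
  by rewrite ge0_ler_powR ?nnegrE ?(ltW a0)//; lra.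
rewrite powRN -[leRHS]invrK lef_pV2 ?posrE ?invr_gt0 ?powR_gt0//; last lra.
apply: (@le_trans _ _ (q2 `^ be)).
  by rewrite /q2 -powRrM mulVf ?powRr1 ?invr_ge0 ?(ltW w0)// gt_eqF.
by rewrite ge0_ler_powR ?nnegrE ?(ltW b0)//; lra.
Qed.

(** On the annulus where |x| is comparable to 1 / (lam q^i), packets of larger
    bandwidth have decayed, and those of smaller bandwidth still have positive
    real part, so the i-th packet is visible. *)
Lemma low_annulus al : 0 < al < n%:R -> exists q d c, [/\ 1 < q, 0 < d, 0 < c, 2 <= q `^ al &
  forall s N lam i x, 0 < lam -> 3 * n%:R * (lam * q ^+ N) <= 1 -> (i < N)%N ->
  d / 2 <= lam * q ^+ i * `|x| <= d ->
  c * (lam * q ^+ i) `^ al <= weighted_block psi s (low_distr N al lam q) 0 x].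
Proof.
move=> /andP[al0 aln].
have [K K0 KP] := block_decay psiP n_gt0.
have [d [c [d0 c0 dc]]] := packet_lower psiP.
pose K' := K * (2 / d) ^+ n; have K'0 : 0 < K' by rewrite mulr_gt0// exprn_gt0// divr_gt0.
have m0 := @profile_mass_gt0 R n.
have w0 : 0 < Num.min 2^-1 (c / (4 * K')) by rewrite lt_min invr_gt0 ltr0n divr_gt0// mulr_gt0.
have nal : 0 < n%:R - al by rewrite subr_gt0.
have [q [q1 q2 qw]] := exists_ratio al0 nal w0.
have q0 : 0 < q by lra.
exists q, d, (mass * (c / 2)); split => //; first by rewrite !mulr_gt0 ?invr_gt0 ?ltr0n.
move=> s N lam i x l0 low iN /andP[xd1 xd2].
set w := q `^ (- (n%:R - al)) in qw.
have w_gt0 : 0 < w by exact: powR_gt0.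
have [w12 wc] : w <= 2^-1 /\ w <= c / (4 * K').
  by move: qw; rewrite le_min => /andP.
pose la l := lam * q ^+ l.
have la0 l : 0 < la l by rewrite mulr_gt0// exprn_gt0.
pose T l := (la l `^ al / la l ^+ (3 * n))%:C%C * low_packet (la l) x.
have ReT l : complex.Re (T l) = la l `^ al / la l ^+ (3 * n) * complex.Re (low_packet (la l) x).
  by rewrite /T cReM /= mul0r subr0.
have co0 l : 0 < la l `^ al / la l ^+ (3 * n) by rewrite divr_gt0 ?powR_gt0 ?exprn_gt0.
have nl l : (l < N)%N -> la l <= lam * q ^+ N.
  by move=> lN; rewrite /la ler_pM2l// ler_eXn2l// ltnW.
have pos l : (l <= i)%N -> c * la l `^ al <= complex.Re (T l).
  move=> li; rewrite ReT.
  have ld : la l * `|x| <= d.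
    apply: le_trans xd2; rewrite ler_wpM2r// /la ler_pM2l// ler_eXn2l//.
  have := dc (la l) 0 x (la0 l) ld; rewrite dotpC /dotp.
  rewrite big1; last by move=> k _; rewrite mxE mul0r.
  rewrite oppr0 (_ : cis2pi 0 = 1 :> R[i]); last by rewrite /cis2pi mulr0 cos0 sin0.
  rewrite mul1r -/(low_packet (la l)) => h.
  apply: le_trans (ler_wpM2l (ltW (co0 l)) h).
  apply: le_of_eq; field.
  by rewrite expf_neq0// gt_eqF.
have small m : (i + m.+1 < N)%N -> - (la i `^ al * (K' * w ^+ m.+1)) <= complex.Re (T (i + m.+1)%N).
  move=> mN; set l := (i + m.+1)%N; rewrite -[leRHS]opprK lerN2.
  apply: le_trans (ler_norm _) _; rewrite normrN; apply: le_trans (Re_le_normc _) _.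
  rewrite /T normcM normc_real (ger0_norm (ltW (co0 l))).
  have lk : la l <= 2 ^+ 0.
    rewrite expr0; have n1 : 1 <= n%:R :> R by rewrite ler1n.
    by have := low; have := nl l mN; have := la0 l; nra.
  have [_ v2] := KP (la l) 0 0%N x (la0 l) lk.
  rewrite (low_packetE l0 q1 low x mN) -/(packet_block psi 0 (la l) 0) in v2 *.
  set v := normc _ in v2 *; have v0 : 0 <= v by exact: normc_nneg.
  have yE : la l * `|x| = q ^+ m.+1 * (la i * `|x|) by rewrite /la /l exprD; ring.
  have y_ge : q ^+ m.+1 * (d / 2) <= la l * `|x| by rewrite yE ler_pM2l// exprn_gt0.
  have t0 : 0 < q ^+ m.+1 * (d / 2) by rewrite mulr_gt0 ?exprn_gt0 ?divr_gt0.
  have vle : v <= K * la l ^+ (3 * n) / (q ^+ m.+1 * (d / 2)) ^+ n.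
    rewrite ler_pdivlMr ?exprn_gt0//; apply: le_trans v2.
    by rewrite ler_wpM2l// lerXn2r ?nnegrE ?(ltW t0)// (le_trans (ltW t0)).
  apply: le_trans (ler_wpM2l (ltW (co0 l)) vle) _.
  have E1 : la l `^ al = la i `^ al * (q ^+ m.+1) `^ al.
    rewrite -powRM ?(ltW (la0 i)) ?exprn_ge0 ?(ltW q0)//; congr (_ `^ _).
    by rewrite /la /l exprD mulrA.
  have E2 : w ^+ m.+1 = (q ^+ m.+1) `^ al / (q ^+ m.+1) ^+ n.
    have qm0 : 0 < q ^+ m.+1 by rewrite exprn_gt0.
    rewrite -[(q ^+ m.+1) ^+ n]powR_mulrn ?(ltW qm0)// -powRB; last by rewrite (gt_eqF qm0) implybT.
    rewrite -powR_mulrn ?powR_ge0// powRAC powR_mulrn ?(ltW q0)//.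
    by rewrite opprB.
  rewrite E1 E2 /K'; apply: le_of_eq.
  rewrite !exprMn !exprVn; field.
  by rewrite !expf_neq0 ?gt_eqF.
(* The factor 1 - 2^-M keeps the geometric series in closed form for the
   induction. *)
have acc M : (i + M < N)%N -> la i `^ al * (c - 2 * K' * w * (1 - 2^-1 ^+ M)) <=
    \sum_(l < (i + M).+1) complex.Re (T l).
  elim: M => [|M IH] MN.
    rewrite expr0 subrr mulr0 subr0 addn0 big_ord_recr/= mulrC -[leLHS]add0r lerD//.
      apply: sumr_ge0 => l _; apply: le_trans (pos l (ltnW (ltn_ord l))).
      by rewrite mulr_ge0 ?powR_ge0 ?ltW.
    exact: pos.
  rewrite addnS in MN *; rewrite big_ord_recr/=.
  have h1 := IH (ltnW MN); have h2 : - (la i `^ al * (K' * w ^+ M.+1)) <= complex.Re (T (i + M).+1).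
    by have := small M; rewrite addnS; apply.
  apply: le_trans (lerD h1 h2).
  have wM : w ^+ M.+1 <= w * 2^-1 ^+ M.
    by rewrite exprS ler_wpM2l ?(ltW w_gt0)// lerXn2r ?nnegrE ?(ltW w_gt0)//; lra.
  rewrite -mulrBr ler_wpM2l ?powR_ge0//.
  have : K' * w ^+ M.+1 <= K' * (w * 2^-1 ^+ M) by rewrite ler_wpM2l// ltW.
  rewrite [2^-1 ^+ M.+1]exprS; lra.
have {acc} fin : c / 2 * la i `^ al <= \sum_(l < N) complex.Re (T l).
  have NE : ((i + (N - i.+1)).+1 = N)%N by rewrite -addSn subnKC.
  have := acc (N - i.+1)%N; rewrite NE => /(_ (leqnn N)); apply: le_trans.
  rewrite [leLHS]mulrC ler_wpM2l ?powR_ge0//.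
  have e0 : 0 <= 2^-1 ^+ (N - i.+1) :> R by rewrite exprn_ge0.
  have : w * (4 * K') <= c by rewrite -ler_pdivlMr// mulr_gt0.
  have := mulr_gt0 K'0 w_gt0; nra.
rewrite low_weighted// -mulrA ler_wpM2l ?(ltW m0)//.
apply: (le_trans fin); rewrite -Re_sum; apply: le_trans (ler_norm _) _; exact: Re_le_normc.
Qed.

(** A box inside each annulus carries a fixed amount of the L^(p,1) norm. *)
Lemma low_lacunary s p : 1 < p -> exists q c, [/\ 1 < q, 0 < c & forall N lam,
  0 < lam -> 3 * n%:R * (lam * q ^+ N) <= 1 ->
  ((c * N%:R)%:E <= TLL_norm psi s 1 p 1 (low_distr N (n%:R / p) lam q))%E].
Proof.
move=> p1; have p0 : 0 < p by lra.
have n0 : 0 < n%:R :> R by rewrite ltr0n.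
have al : 0 < n%:R / p < n%:R by rewrite divr_gt0//= ltr_pdivrMr// ltr_pMr.
have [q [d [c [q1 d0 c0 q2 qdc]]]] := low_annulus al.
have q0 : 0 < q by lra.
exists q, (p * ((d / 2) `^ (n%:R / p) * c / 2)); split => //.
  by rewrite mulr_gt0// divr_gt0// mulr_gt0// powR_gt0// divr_gt0.
move=> N lam l0 low.
pose la l := lam * q ^+ l.
have la0 l : 0 < la l by rewrite mulr_gt0// exprn_gt0.
pose r l := d / (4 * la l).
have r0 l : 0 < r l by rewrite divr_gt0// mulr_gt0.
have -> : p * ((d / 2) `^ (n%:R / p) * c / 2) * N%:R =
  p * (N%:R * ((d / 2) `^ (n%:R / p) * c / 2)) by ring.
apply: (@TLL_sum_ge _ _ _ _ _ _ _ _ (fun i => c * la i `^ (n%:R / p)) r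
  (fun i => (3 * r i) *: delta_mx ord0 (Ordinal n_gt0))) => //.
- by move=> i; rewrite mulr_gt0// powR_gt0.
- move=> i; rewrite mulrCA ler_pM2l// [la i.+1](_ : _ = q * la i); last by rewrite /la exprS mulrCA.
  by rewrite [leRHS]powRM ?(ltW q0) ?(ltW (la0 i))// ler_wpM2r ?powR_ge0.
- by move=> i; exact: ltW.
- move=> i x iN xb; exists 1%N; rewrite big_nat1; apply: qdc => //.
  have rE : la i * (4 * r i) = d by rewrite /r; field; rewrite !gt_eqF.
  rewrite -/(la i); apply/andP; split.
    have := xb (Ordinal n_gt0); rewrite !mxE !eqxx mulr1 ler_distl => /andP[h _].
    have h2 : 2 * r i <= `|x|.
      apply: le_trans (mx_norm_coord x (Ordinal n_gt0)); apply: le_trans (ler_norm _).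
      by apply: le_trans h; lra.
    by rewrite -rE (_ : _ / 2 = la i * (2 * r i)) ?ler_pM2l//; field.
  have r40 : 0 <= 4 * r i by rewrite mulr_ge0// ltW.
  rewrite -rE ler_pM2l// (mx_norm_box x r40); apply/asboolP => k.
  rewrite mxE subr0; set z : 'rV[R]_n := _ *: _ in xb.
  have := ler_normD (x ord0 k - z ord0 k) (z ord0 k); rewrite subrK => h.
  apply: le_trans h _; apply: (@le_trans _ _ (r i + 3 * r i)); last lra.
  apply: lerD; first exact: xb.
  have r30 : 0 <= 3 * r i by have := r0 i; lra.
  rewrite /z !mxE normrM (ger0_norm r30).
  by rewrite ler_piMr//; case: (_ && _); rewrite ?normr1 ?normr0.
move=> i iN; have -> : 2 * r i = d / 2 * (la i)^-1 by rewrite /r; field; rewrite gt_eqF.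
have d20 : 0 <= d / 2 by rewrite divr_ge0// ltW.
have li0 : 0 <= (la i)^-1 by rewrite invr_ge0 ltW.
rewrite (powRM _ d20 li0) (powR_inv _ (ltW (la0 i))) powRN.
by rewrite mulrA [_ / _ * c]mulrAC divfK// gt_eqF// powR_gt0.
Qed.

End low_frequency_family.

(** * Necessary conditions *)

Section growth.
Context {R : realType}.

Lemma bounded_multiples (a C : R) : (forall N : nat, N%:R * a <= C) -> a <= 0.
Proof.
move=> h; rewrite leNgt; apply/negP => a0.
have := archi_boundP (normr_ge0 (C / a)); set N := Num.bound _ => CN.
have := h N; rewrite leNgt => /negP; apply.
by rewrite -ltr_pdivrMr//; exact: le_lt_trans (ler_norm _) CN.
Qed.

Lemma bounded_powers (t C : R) : (forall N : nat, 2 `^ (N%:R * t) <= C) -> t <= 0.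
Proof.
move=> h; have l2 : 0 < ln 2 :> R by rewrite ln_gt0// ltr1n.
rewrite -(pmulr_lle0 _ l2); apply: (@bounded_multiples _ C) => N.
apply: le_trans (h N); rewrite /powR pnatr_eq0/=.
by apply: le_trans (expR_ge1Dx _); rewrite mulrA lerDr.
Qed.

Lemma two_powRN (a : R) : 2 `^ (- a) * 2 `^ a = 1.
Proof. by rewrite powRN mulVf// gt_eqF// powR_gt0. Qed.

Lemma interpolate_powers (a th e1 e2 x1 x2 E : R) : 0 < a -> 0 <= e1 -> 0 <= e2 ->
  (e1 * a `^ (E * x1)) `^ (1 - th) * (e2 * a `^ (E * x2)) `^ th =
  e1 `^ (1 - th) * e2 `^ th * a `^ (E * ((1 - th) * x1 + th * x2)).
Proof.
move=> a0 e10 e20.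
have -> : a `^ (E * ((1 - th) * x1 + th * x2)) = (a `^ (E * x1)) `^ (1 - th) * (a `^ (E * x2)) `^ th.
  by rewrite -!powRrM -powRD ?(gt_eqF a0) ?implybT//; congr (_ `^ _); ring.
by rewrite !powRM ?powR_ge0// mulrACA.
Qed.

Lemma powR_dyadic (e a : R) (j : nat) : 0 <= e ->
  (e * 2 ^+ j) `^ (- a) = e `^ (- a) * 2 `^ (- (j%:R * a)).
Proof.
move=> e0; rewrite powRM ?exprn_ge0// -[2 ^+ j]powR_mulrn// -powRrM.
by congr (_ * _ `^ _); rewrite mulrN.
Qed.

End growth.

Section necessary_conditions.
Context {R : realType} {n : nat} (psi : nat -> 'rV[R]_n -> R[i]).
Hypothesis psiP : LP_partition psi.
Hypothesis n_gt0 : (0 < n)%N.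
Variables (s s1 s2 p p1 p2 theta C : R).
Hypotheses (p_gt1 : 1 < p) (p1_gt1 : 1 < p1) (p2_gt1 : 1 < p2).
Hypotheses (theta_gt0 : 0 < theta) (theta_lt1 : theta < 1) (C_gt0 : 0 < C).
Hypothesis ineq : forall f : functional R n,
  (TLL_space psi s1 +oo%E p1 +oo%E `&` TLL_space psi s2 +oo%E p2 +oo%E) f ->
  (TLL_norm psi s 1%E p 1%E f <=
   C%:E * TLL_norm psi s1 +oo p1 +oo f `^ (1 - theta)
        * TLL_norm psi s2 +oo p2 +oo f `^ theta)%E.

Let n0 : 0 < n%:R :> R. Proof. by rewrite ltr0n. Qed.
Let p_gt0 : 0 < p. Proof. exact: lt_trans ltr01 p_gt1. Qed.
Let eps : R := (12 * n%:R)^-1.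
Let eps0 : 0 < eps. Proof. by rewrite invr_gt0 mulr_gt0. Qed.

Let test u (B1 B2 D : R) := @interpolation_test _ _ psi s s1 s2 p p1 p2 theta C u B1 B2 D
  (introT andP (conj theta_gt0 theta_lt1)) C_gt0.

Lemma high_test : exists2 K, 0 < K & forall N b lam j D B1 B2,
  shell_separated n b lam j -> 0 < B1 -> 0 < B2 -> 0 <= D ->
  (forall i, 2 * (b i * 2 `^ ((j i)%:R * s)) <= b i.+1 * 2 `^ ((j i.+1)%:R * s)) ->
  (forall i, (i < N)%N -> b i * 2 `^ ((j i)%:R * s1) * lam i `^ (- (n%:R / p1)) <= B1) ->
  (forall i, (i < N)%N -> b i * 2 `^ ((j i)%:R * s2) * lam i `^ (- (n%:R / p2)) <= B2) ->
  (forall i, (i < N)%N -> D <= b i * 2 `^ ((j i)%:R * s) * lam i `^ (- (n%:R / p))) ->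
  N%:R * D <= K * (B1 `^ (1 - theta) * B2 `^ theta).
Proof.
have [K1 K10 h1] := high_upper psiP n_gt0 s1 p1_gt1.
have [K2 K20 h2] := high_upper psiP n_gt0 s2 p2_gt1.
have [c c0 h3] := high_lacunary psiP n_gt0 s p_gt1.
exists (C * (K1 `^ (1 - theta) * K2 `^ theta) / c).
  by rewrite divr_gt0// mulr_gt0// mulr_gt0// powR_gt0.
move=> N b lam j D B1 B2 sep B10 B20 D0 bb hB1 hB2 hD.
have tu : tempered (high_distr psi n_gt0 N b lam j).
  by case: sep => _ l0 _ _ _; exact: tempered_superposition.
have := test (mulr_gt0 K10 B10) (mulr_gt0 K20 B20) tu ineq (h1 N b lam j B1 sep (ltW B10) hB1)
  (h2 N b lam j B2 sep (ltW B20) hB2) (h3 N b lam j D sep D0 bb hD).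
rewrite !powRM ?(ltW K10) ?(ltW K20) ?(ltW B10) ?(ltW B20)//.
set u1 := K1 `^ _; set u2 := K2 `^ _; set w1 := B1 `^ _; set w2 := B2 `^ _ => h.
rewrite -(ler_pM2l c0); apply: le_trans (_ : _ <= C * (u1 * w1 * (u2 * w2))) _.
  by rewrite [leLHS]mulrA.
by apply: le_of_eq; field; rewrite gt_eqF.
Qed.

Let sI := (1 - theta) * s1 + theta * s2.
Let rI := (1 - theta) / p1 + theta / p2.

(** Frequency tending to infinity at fixed shape. *)
Lemma high_scaling : s - n%:R / p <= sI - n%:R * rI.
Proof.
have [K K0 hK] := high_test.
rewrite -subr_le0.
pose e a := eps `^ (- (n%:R / a)).
have ea0 a : 0 < e a by exact: powR_gt0.
(* Only the packet of index 0 is tested; the others are there because the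
   heights must grow along the whole sequence. *)
apply: (@bounded_powers _ _ (K * (e p1 `^ (1 - theta) * e p2 `^ theta) / e p /
  2 `^ (2 * (s - n%:R / p - (sI - n%:R * rI))))) => J.
pose E := (J + 2)%N.
pose j i := (E + 2 * i)%N.
pose b i : R := 2 ^+ i * 2 `^ (- ((j i)%:R * s)).
pose lam (i : nat) : R := eps * 2 ^+ E.
have bs i : b i * 2 `^ ((j i)%:R * s) = 2 ^+ i by rewrite /b -mulrA two_powRN mulr1.
have sep : shell_separated n b lam j.
  split.
  - by move=> i; rewrite mulr_gt0 ?exprn_gt0 ?powR_gt0.
  - by move=> i; rewrite mulr_gt0 ?exprn_gt0.
  - by move=> i; rewrite /lam mulrC ler_wpM2r ?(ltW eps0)// ler_eXn2l ?ltr1n// leq_addr.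
  - by move=> i; rewrite /j /E addn_gt0 addn_gt0 orbT.
  - by move=> i; rewrite /j mulnS [(2 + _)%N]addnC addnA.
have bk sk a : b 0%N * 2 `^ ((j 0%N)%:R * sk) * lam 0%N `^ (- (n%:R / a)) =
    e a * 2 `^ (E%:R * (sk - s - n%:R / a)).
  rewrite /b /lam mul1r /j muln0 addn0 powR_dyadic ?(ltW eps0)// mulrCA; congr (_ * _).
  by rewrite -!powRD ?pnatr_eq0 ?implybT//; congr (_ `^ _); ring.
have pos a x : 0 < e a * 2 `^ x by rewrite mulr_gt0// powR_gt0.
have : 1%:R * (e p * 2 `^ (E%:R * (s - s - n%:R / p))) <=
    K * ((e p1 * 2 `^ (E%:R * (s1 - s - n%:R / p1))) `^ (1 - theta) *
         (e p2 * 2 `^ (E%:R * (s2 - s - n%:R / p2))) `^ theta).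
  apply: (hK 1%N b lam j _ _ _ sep (pos _ _) (pos _ _) (ltW (pos _ _))).
  - by move=> i; rewrite !bs exprS.
  - by move=> [|//] _; rewrite bk.
  - by move=> [|//] _; rewrite bk.
  - by move=> [|//] _; rewrite bk.
rewrite interpolate_powers ?(ltW (ea0 _))// mul1r => h.
set t := s - n%:R / p - (sI - n%:R * rI).
have Et : E%:R * (s - s - n%:R / p) =
  E%:R * ((1 - theta) * (s1 - s - n%:R / p1) + theta * (s2 - s - n%:R / p2)) + (J%:R * t + 2 * t).
  by rewrite /t /E /sI /rI natrD; ring.
have pD x y : 2 `^ (x + y) = 2 `^ x * 2 `^ y :> R by rewrite powRD ?pnatr_eq0 ?implybT.
rewrite Et !pD in h.
set w := 2 `^ (E%:R * _) in h; have w0 : 0 < w by exact: powR_gt0.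
rewrite ler_pdivlMr ?powR_gt0// ler_pdivlMr// -(ler_pM2r w0).
rewrite -[leRHS]mulrA; apply: le_trans h.
by rewrite [leLHS]mulrC [_ * e p]mulrC mulrCA.
Qed.

(** Packets with heights and bandwidths both growing with the frequency, in the
    scaling that leaves all three norms of a single packet unchanged. *)
Lemma high_critical : s1 - n%:R / p1 = s - n%:R / p -> s2 - n%:R / p2 = s - n%:R / p -> False.
Proof.
move=> e1 e2; have [K K0 hK] := high_test.
pose e a := eps `^ (- (n%:R / a)).
have ea0 a : 0 < e a by exact: powR_gt0.
set al := n%:R / p in e1 e2; have al0 : 0 < al by rewrite divr_gt0.
(* The heights are 2^(j_i al), so spacing the j_i by L >= 1 / al doubles them. *)
pose L := (Num.bound al^-1 + 2)%N.
have Lal : 1 <= L%:R * al.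
  rewrite -ler_pdivrMr// div1r ltW// (lt_le_trans (archi_boundP _)) ?invr_ge0 ?(ltW al0)//.
  by rewrite ler_nat leq_addr.
pose j i := (i.+1 * L)%N.
pose b i : R := 2 `^ (- ((j i)%:R * (s - al))).
pose lam i : R := eps * 2 ^+ j i.
have bk i sk a : b i * 2 `^ ((j i)%:R * sk) * lam i `^ (- (n%:R / a)) =
    e a * 2 `^ ((j i)%:R * (sk - n%:R / a - (s - al))).
  rewrite /b /lam powR_dyadic ?(ltW eps0)// mulrCA; congr (_ * _).
  by rewrite -!powRD ?pnatr_eq0 ?implybT//; congr (_ `^ _); ring.
have sep : shell_separated n b lam j.
  split.
  - by move=> i; exact: powR_gt0.
  - by move=> i; rewrite mulr_gt0 ?exprn_gt0.
  - by move=> i; rewrite /lam mulrC.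
  - by move=> i; rewrite /j /L muln_gt0 addn_gt0 orbT.
  - by move=> i; rewrite /j [in leqRHS]mulSn addnC leq_add2r /L leq_addl.
suff : e p <= 0 by rewrite leNgt ea0.
apply: (@bounded_multiples _ _ (K * (e p1 `^ (1 - theta) * e p2 `^ theta))) => N.
apply: (hK N b lam j (e p) (e p1) (e p2) sep) => //.
- exact: ltW.
- move=> i; rewrite /b -!powRD ?pnatr_eq0 ?implybT//.
  have -> : - ((j i.+1)%:R * (s - al)) + (j i.+1)%:R * s = L%:R * al + (- ((j i)%:R * (s - al)) + (j i)%:R * s).
    by rewrite /j [in LHS]mulSn natrD; ring.
  rewrite [leRHS]powRD ?pnatr_eq0 ?implybT// ler_wpM2r ?powR_ge0//.
  by rewrite -[leLHS]powRr1// ler_powR// ler1n.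
- by move=> i _; rewrite bk e1 subrr mulr0 powRr0 mulr1.
- by move=> i _; rewrite bk e2 subrr mulr0 powRr0 mulr1.
- by move=> i _; rewrite bk subrr mulr0 powRr0 mulr1.
Qed.

(** One bump in each frequency shell, all at the same place: the l^1 sum over
    the shells is N times larger than the supremum. *)
Lemma high_stacked : s1 = s -> s2 = s -> False.
Proof.
move=> e1 e2.
have [K1 K10 h1] := high_upper psiP n_gt0 s1 p1_gt1.
have [K2 K20 h2] := high_upper psiP n_gt0 s2 p2_gt1.
have [d [c [d0 c0 h3]]] := high_lower psiP n_gt0 s.
pose e a := eps `^ (- (n%:R / a)).
have ea0 a : 0 < e a by exact: powR_gt0.
pose j i := (2 * i + 2)%N.
pose b i : R := 2 `^ (- ((j i)%:R * s)).
pose lam (i : nat) : R := eps.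
have bs i : b i * 2 `^ ((j i)%:R * s) = 1 by rewrite /b two_powRN.
have sep : shell_separated n b lam j.
  split => //.
  - by move=> i; exact: powR_gt0.
  - move=> i; rewrite /lam -[leLHS]mul1r ler_wpM2r ?(ltW eps0)//.
    by apply: exprn_ege1; rewrite ler1n.
  - by move=> i; rewrite /j addn_gt0 orbT.
  - by move=> i; rewrite /j mulnS addnC addnA.
pose r := d / eps; have r0 : 0 < r by rewrite divr_gt0.
suff : p * ((2 * r) `^ (n%:R / p) * c / 2) <= 0.
  by rewrite leNgt => /negP; apply; rewrite mulr_gt0 ?p_gt0// divr_gt0// mulr_gt0// powR_gt0// mulr_gt0.
apply: (@bounded_multiples _ _ (C * ((K1 * e p1) `^ (1 - theta) * (K2 * e p2) `^ theta))) => -[|N].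
  by rewrite mul0r !mulr_ge0 ?powR_ge0// ltW.
have tu : tempered (high_distr psi n_gt0 N.+1 b lam j).
  by case: sep => _ l0 _ _ _; exact: tempered_superposition.
apply: (test (mulr_gt0 K10 (ea0 _)) (mulr_gt0 K20 (ea0 _)) tu ineq).
- by apply: h1 => // [|i _]; [exact: ltW|rewrite e1 bs mul1r].
- by apply: h2 => // [|i _]; [exact: ltW|rewrite e2 bs mul1r].
have -> : N.+1%:R * (p * ((2 * r) `^ (n%:R / p) * c / 2)) =
  p * (1%:R * ((2 * r) `^ (n%:R / p) * (c * N.+1%:R) / 2)) by ring.
apply: (@TLL_sum_ge _ _ _ _ _ _ _ 1%N (fun i => 2 ^+ i * (c * N.+1%:R)) (fun=> r) (fun=> 0)).
- exact: p_gt0.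
- by move=> i; rewrite !mulr_gt0 ?exprn_gt0 ?ltr0n.
- by move=> i; rewrite [2 ^+ i.+1]exprS -mulrA.
- by move=> i; exact: ltW.
- move=> [|//] x _ xb.
  have xd : eps * `|x| <= d.
    by rewrite mulrC -ler_pdivlMr// (mx_norm_box x (ltW r0)); exact/asboolP.
  exists (2 * N.+1 + 2)%N; rewrite expr0 mul1r.
  have stack M : (M <= N.+1)%N -> c * M%:R <=
      \sum_(0 <= k < 2 * M + 2) weighted_block psi s (high_distr psi n_gt0 N.+1 b lam j) k x.
    elim: M => [_|M IH MN].
      by rewrite mulr0; apply: sumr_ge0 => k _; exact: weighted_block_ge0.
    rewrite (_ : (2 * M.+1 + 2 = (2 * M + 2).+2)%N); last by rewrite mulnS -addnA addnC addn2.
    rewrite 2?big_nat_recr//= -addrA -natr1 mulrDr mulr1; apply: lerD; first exact: IH (ltnW MN).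
    by have := h3 N.+1 b lam j M x sep MN xd; rewrite bs mulr1.
  exact: stack.
- by move=> [|//] _; rewrite expr0 mul1r mulrA.
Qed.

Lemma low_distr_tempered N al lam q : 0 < lam -> 1 < q -> tempered (low_distr psi N al lam q).
Proof.
move=> l0 q1; apply: tempered_superposition => // i.
by rewrite mulr_gt0// exprn_gt0// (lt_trans ltr01).
Qed.

(** Bandwidth tending to zero at frequency zero. *)
Lemma low_scaling : n%:R / p <= n%:R * rI.
Proof.
have [q [c [q1 c0 h3]]] := low_lacunary psiP n_gt0 s p_gt1.
have [K1 K10 h1] := low_upper psiP n_gt0 s1 (n%:R / p) p1_gt1 q1.
have [K2 K20 h2] := low_upper psiP n_gt0 s2 (n%:R / p) p2_gt1 q1.
have q0 : 0 < q by rewrite (lt_trans ltr01).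
set al := n%:R / p in h1 h2 h3 *.
pose l : R := (3 * n%:R * q)^-1; have l_gt0 : 0 < l by rewrite invr_gt0 !mulr_gt0.
pose e a := l `^ (al - n%:R / a); have ea0 a : 0 < e a by exact: powR_gt0.
rewrite -subr_le0.
apply: (@bounded_powers _ _ (C * ((K1 * e p1) `^ (1 - theta) * (K2 * e p2) `^ theta) / c)) => J.
pose lam := l * 2 `^ (- J%:R); have lam0 : 0 < lam by rewrite mulr_gt0 ?powR_gt0.
have low : 3 * n%:R * (lam * q ^+ 1) <= 1.
  have -> : 3 * n%:R * (lam * q ^+ 1) = 2 `^ (- J%:R).
    by rewrite /lam /l expr1; field; rewrite !gt_eqF.
  by rewrite powRN invf_le1 ?powR_gt0// -[leLHS](powRr0 2) ler_powR// ler1n.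
have lamE a : lam `^ al * lam `^ (- (n%:R / a)) = e a * 2 `^ (J%:R * - (al - n%:R / a)).
  rewrite -powRD ?(gt_eqF lam0) ?implybT// /lam powRM ?(ltW l_gt0) ?powR_ge0// -powRrM.
  by congr (_ * _ `^ _); rewrite mulNr mulrN.
have pos a : 0 < e a * 2 `^ (J%:R * - (al - n%:R / a)) by rewrite mulr_gt0 ?powR_gt0.
have b1 i : (i < 1)%N -> (lam * q ^+ i) `^ al * (lam * q ^+ i) `^ (- (n%:R / p1)) <=
    e p1 * 2 `^ (J%:R * - (al - n%:R / p1)) by case: i => // _; rewrite expr0 mulr1 lamE.
have b2 i : (i < 1)%N -> (lam * q ^+ i) `^ al * (lam * q ^+ i) `^ (- (n%:R / p2)) <=
    e p2 * 2 `^ (J%:R * - (al - n%:R / p2)) by case: i => // _; rewrite expr0 mulr1 lamE.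
have h := test (mulr_gt0 K10 (pos p1)) (mulr_gt0 K20 (pos p2)) (low_distr_tempered 1 al lam0 q1) ineq
  (h1 _ _ _ lam0 low (ltW (pos p1)) b1) (h2 _ _ _ lam0 low (ltW (pos p2)) b2) (h3 _ _ lam0 low).
have g1 : 0 <= K1 * e p1 := ltW (mulr_gt0 K10 (ea0 p1)).
have g2 : 0 <= K2 * e p2 := ltW (mulr_gt0 K20 (ea0 p2)).
set M := (K1 * e p1) `^ _ * _.
have {}h : c <= C * (M * 2 `^ (J%:R * ((1 - theta) * - (al - n%:R / p1) + theta * - (al - n%:R / p2)))).
  rewrite -[leLHS]mulr1; apply: le_trans h _; apply: le_of_eq.
  by congr (C * _); rewrite (mulrA K1) (mulrA K2); exact: interpolate_powers.
have -> : J%:R * (al - n%:R * rI) = - (J%:R * ((1 - theta) * - (al - n%:R / p1) + theta * - (al - n%:R / p2))).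
  by rewrite /rI; ring.
rewrite powRN ler_pdivlMr// mulrC ler_pdivrMr ?powR_gt0//; apply: le_trans h _.
by rewrite mulrA.
Qed.

(** A lacunary sum of dilates of a low-frequency bump behaves like |x|^(-n/p),
    which is in weak L^p, while its L^(p,1) norm grows with the number of terms. *)
Lemma low_critical : p1 = p -> p2 = p -> False.
Proof.
move=> e1 e2.
have [q [c [q1 c0 h3]]] := low_lacunary psiP n_gt0 s p_gt1.
have [K1 K10 h1] := low_upper psiP n_gt0 s1 (n%:R / p) p1_gt1 q1.
have [K2 K20 h2] := low_upper psiP n_gt0 s2 (n%:R / p) p2_gt1 q1.
have q0 : 0 < q by rewrite (lt_trans ltr01).
suff : c <= 0 by rewrite leNgt c0.
apply: (@bounded_multiples _ _ (C * ((K1 * 1) `^ (1 - theta) * (K2 * 1) `^ theta))) => N.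
pose lam : R := (3 * n%:R * q ^+ N)^-1.
have lam0 : 0 < lam by rewrite invr_gt0 !mulr_gt0 ?exprn_gt0.
have low : 3 * n%:R * (lam * q ^+ N) <= 1.
  apply: le_of_eq; rewrite /lam.
  by field; rewrite ?expf_neq0 ?gt_eqF.
have b1 i : (i < N)%N -> (lam * q ^+ i) `^ (n%:R / p) * (lam * q ^+ i) `^ (- (n%:R / p)) <= 1.
  by move=> _; rewrite powRN mulfV// gt_eqF// powR_gt0// mulr_gt0// exprn_gt0.
rewrite e1 in h1; rewrite e2 in h2; rewrite mulrC.
apply: (test (mulr_gt0 K10 ltr01) (mulr_gt0 K20 ltr01) (low_distr_tempered N (n%:R / p) lam0 q1) ineq _ _ (h3 N lam lam0 low)).
- by rewrite e1; apply: h1.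
- by rewrite e2; apply: h2.
Qed.

End necessary_conditions.

Theorem theorem3p7 (R : realType) (n : nat) (n_gt0 : (0 < n)%N)
    (psi : nat -> 'rV[R]_n -> R[i]) (psiP : LP_partition psi)
    (s s1 s2 p p1 p2 theta : R)
    (p_gt1 : 1 < p) (p1_gt1 : 1 < p1) (p2_gt1 : 1 < p2)
    (theta_gt0 : 0 < theta) (theta_lt1 : theta < 1) :
  let s' := (1 - theta) * s1 + theta * s2 in
  let p' := ((1 - theta) / p1 + theta / p2)^-1 in
  (exists C : R, 0 < C /\
     forall f : functional R n,
       (TLL_space psi s1 +oo%E p1 +oo%E `&` TLL_space psi s2 +oo%E p2 +oo%E) f ->
       (TLL_norm psi s 1%E p 1%E f <=
        C%:E * TLL_norm psi s1 +oo p1 +oo f `^ (1 - theta)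
             * TLL_norm psi s2 +oo p2 +oo f `^ theta)%E) ->
  [\/ [/\ s' = s, p' = p, s1 <> s2, p1 <> p2 &
          s2 - s1 <> n%:R / p2 - n%:R / p1],
      [/\ s' > s, p' = p & p1 <> p2],
      [/\ s' - s = n%:R / p' - n%:R / p, n%:R / p' - n%:R / p > 0 &
          s2 - s1 <> n%:R / p2 - n%:R / p1] |
      s' - s > n%:R / p' - n%:R / p /\ n%:R / p' - n%:R / p > 0].
Proof.
move=> s' p' [C [C0 ineq]].
have n0 : 0 < n%:R :> R by rewrite ltr0n.
have h1 := high_scaling psiP n_gt0 p_gt1 p1_gt1 p2_gt1 theta_gt0 theta_lt1 C0 ineq.
have h2 := high_critical psiP n_gt0 p_gt1 p1_gt1 p2_gt1 theta_gt0 theta_lt1 C0 ineq.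
have h3 := high_stacked psiP n_gt0 p_gt1 p1_gt1 p2_gt1 theta_gt0 theta_lt1 C0 ineq.
have h4 := low_scaling psiP n_gt0 p_gt1 p1_gt1 p2_gt1 theta_gt0 theta_lt1 C0 ineq.
have h5 := low_critical psiP n_gt0 p_gt1 p1_gt1 p2_gt1 theta_gt0 theta_lt1 C0 ineq.
rewrite -/s' in h1; set rI := (1 - theta) / p1 + theta / p2 in h1 h4.
have p'E : n%:R / p' = n%:R * rI by rewrite /p' invrK.
rewrite p'E.
(* If s - n/p is the interpolated value, then s1 - n/p1 = s2 - n/p2 forces
   both to be equal to it. *)
have crit : s' - s = n%:R * rI - n%:R / p -> s2 - s1 <> n%:R / p2 - n%:R / p1.
  move=> es e12.
  have d12 : s1 - n%:R / p1 = s2 - n%:R / p2 by lra.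
  have d : s' - n%:R * rI = s1 - n%:R / p1.
    have -> : s' - n%:R * rI = (1 - theta) * (s1 - n%:R / p1) + theta * (s2 - n%:R / p2).
      by rewrite /s' /rI; ring.
    by rewrite -d12; ring.
  by apply: h2; lra.
have [r_gt|r_eq] : n%:R / p < n%:R * rI \/ n%:R / p = n%:R * rI.
  by move: h4; rewrite le_eqVlt => /predU1P[->|]; [right|left].
- have r0 : 0 < n%:R * rI - n%:R / p by rewrite subr_gt0.
  have [e|lt] : s' - s = n%:R * rI - n%:R / p \/ n%:R * rI - n%:R / p < s' - s.
    have : n%:R * rI - n%:R / p <= s' - s by lra.
    by rewrite le_eqVlt => /predU1P[->|]; [left|right].
  + by apply: Or43; split=> //; exact: crit.
  + by apply: Or44.
have p'p : p' = p by rewrite /p' -/rI -(mulfI (lt0r_neq0 n0) r_eq) invrK.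
have p12 : p1 <> p2.
  move=> e; have p1p : p1 = p.
    by rewrite -p'p /p' -e -mulrDl subrK mul1r invrK.
  by apply: h5 => //; rewrite -e.
have [e|lt] : s' = s \/ s < s'.
  by have : s <= s' by [lra]; rewrite le_eqVlt => /predU1P[->|]; [left|right].
- apply: Or41; split=> // [e12|]; last by apply: crit; lra.
  have s1s : s1 = s by rewrite -e /s' -e12; ring.
  by apply: h3 => //; rewrite -e12.
- exact: Or42.
Qed.
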